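(* Let $(\vec{\varepsilon}_0,\vec{\theta}_0)\in\Omega_1\times\Omega_2$ and assume all of the following. (a) All entries of $\Pi^{\vec{\varepsilon}_0}$ are strictly positive. (b) For all $y\in\mathcal{Y}$, $q^{\vec{\theta}_0}(z|y)>0$ for all $z\in\mathcal{Z}$. (c) There exists $r_2>0$ such that: for any $(y,z)\in\mathcal{Y}\times\mathcal{Z}$, $\vec{\theta}\mapsto q^{\vec{\theta}}(z|y)$ is (complex) analytic on $\mathbb{C}^{m_2}_{\vec{\theta}_0}(r_2)$; for any $y\in\mathcal{Y}$, $q^{\vec{\theta}}(z|y)$ is jointly continuous in $(z,\vec{\theta})$ on $\mathcal{Z}\times\mathbb{C}^{m_2}_{\vec{\theta}_0}(r_2)$; and the three integrals $$\int_{\mathcal{Z}}\breve{q}(z,r_2)\,dz,\qquad \int_{\mathcal{Z}}\breve{q}(z,r_2)\log\hat{q}(z,r_2)\,dz,\qquad \int_{\mathcal{Z}}\breve{q}(z,r_2)\log\breve{q}(z,r_2)\,dz$$ are all finite, where $\breve{q}(z,r_2)=\sup_{(y,\vec{\theta})\in\mathcal{Y}\times\mathbb{C}^{m_2}_{\vec{\theta}_0}(r_2)}|q^{\vec{\theta}}(z|y)|$ and $\hat{q}(z,r_2)=\inf_{(y,\vec{\theta})\in\mathcal{Y}\times\mathbb{C}^{m_2}_{\vec{\theta}_0}(r_2)}|q^{\vec{\theta}}(z|y)|$. (d) For some $I\in\{1,\dots,l\}$: (i) there exists $r_2>0$ such that for all $j$ the family of functions $\{\vec{\theta}\mapsto q^{\vec{\theta}}(z|j)/q^{\vec{\theta}}(z|I)\}_{z\in\mathcal{Z}}$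 on $\mathbb{C}^{m_2}_{\vec{\theta}_0}(r_2)$ is equicontinuous; (ii) there exists $r_2>0$ such that for each $z\in\mathcal{Z}$ the real function $\log q^{\vec{\theta}}(z|I)$ can be analytically extended to $\mathbb{C}^{m_2}_{\vec{\theta}_0}(r_2)$, and for all $j$, $$\int_{\mathcal{Z}}\ \sup_{\vec{\theta}\in\mathbb{C}^{m_2}_{\vec{\theta}_0}(r_2)}\left|q^{\vec{\theta}}(z|j)\log q^{\vec{\theta}}(z|I)\right|dz<\infty.$$ If, in addition, for the same $I$ as in (d), there exists $r_2>0$ such that for any $\varepsilon>0$ there exists a compact subset $\Sigma\subset\mathcal{Z}$ such that for all $z\notin\Sigma$, all $j\neq I$ and all $\vec{\theta}\in\mathbb{C}^{m_2}_{\vec{\theta}_0}(r_2)$, $$\left|\frac{q^{\vec{\theta}}(z|j)}{q^{\vec{\theta}}(z|I)}\right|\le\varepsilon,$$ then the entropy rate $H(Z)$, as a function of $(\vec{\varepsilon},\vec{\theta})$, is analytic around $(\vec{\varepsilon}_0,\vec{\theta}_0)$.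
   Context: Let $\mathcal{Y}=\{1,2,\dots,l\}$ and $\mathcal{Z}=\mathbb{R}$. Let $\Omega_1\subset\mathbb{R}^{m_1}$ and $\Omega_2\subset\mathbb{R}^{m_2}$ be bounded domains (open connected sets). For $\vec{\varepsilon}\in\Omega_1$, $\Pi^{\vec{\varepsilon}}=(\pi^{\vec{\varepsilon}}_{ij})_{l\times l}$ is a stochastic matrix depending real-analytically on $\vec{\varepsilon}$, and $Y=(Y_n)$ is the $\mathcal{Y}$-valued stationary first-order Markov chain with transition matrix $\Pi^{\vec{\varepsilon}}$ and stationary vector $\pi^{\vec{\varepsilon}}$. For $\vec{\theta}\in\Omega_2$ and $y\in\mathcal{Y}$, $q^{\vec{\theta}}(\cdot|y)$ is a probability density on $\mathcal{Z}$, and for each $(y,z)$ the map $\vec{\theta}\mapsto q^{\vec{\theta}}(z|y)$ is real analytic on $\Omega_2$; the same notation denotes its complex analytic extension to a complex neighborhood of a given point. $\mathbb{C}^{m}_{x}(r)$ denotes the (open) $r$-neighborhood of $x$ in $\mathbb{C}^m$. The hidden Markov chain $Z$ is the output of the memoryless channel with input $Y$: conditionally on $Y$, the $Z_n$ are independent and $Z_n$ has density $q^{\vec{\theta}}(\cdot|Y_n)$. Let $p=p^{\vec{\varepsilon},\vec{\theta}}$ denote the resulting (joint) densities, with $z_{-n}^0=(z_{-n},\dots,z_0)$. The entropy rate is $$H(Z)=\lim_{n\to\infty}\frac{1}{n+1}H(Z_{-n}^0),\qquad H(Z_{-n}^0)=-\int_{\mathcal{Z}^{n+1}}p(z_{-n}^0)\log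 p(z_{-n}^0)\,dz_{-n}^0.$$ ''Analytic around $(\vec{\varepsilon}_0,\vec{\theta}_0)$'' means real analytic, jointly in $(\vec{\varepsilon},\vec{\theta})$, on a neighborhood of $(\vec{\varepsilon}_0,\vec{\theta}_0)$ in $\Omega_1\times\Omega_2$. *)

(* Defs.v *)
From HB Require Import structures.
From mathcomp Require Import all_boot all_order all_algebra.
From mathcomp Require Import all_classical all_reals all_analysis.
From mathcomp Require Import complex.

Set Implicit Arguments.
Unset Strict Implicit.
Unset Printing Implicit Defensive.

Import Order.TTheory GRing.Theory Num.Theory.
Import numFieldNormedType.Exports.

Local Open Scope classical_set_scope.
Local Open Scope ring_scope.

(* The topology of the modulus on R[i]; MathComp-Analysis only puts it on the
   alias R[i]^o. *)
HB.instance Definition _ (R : realType) :=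
  PseudoPointedMetric.copy R[i] (R[i]^o).

Section Analytic.
Variables (K : numFieldType) (m : nat).

Definition monomial_at (h : 'rV[K]_m) (a : {ffun 'I_m -> nat}) : K :=
  \prod_(i < m) h 0 i ^+ a i.

(* Sum over the multi-indices all of whose components are < N. *)
Definition box_sum (F : {ffun 'I_m -> nat} -> K) (N : nat) : K :=
  \sum_(a : {ffun 'I_m -> 'I_N}) F [ffun i => nat_of_ord (a i)].

(* On a polydisc around x, f is the sum of an absolutely convergent power
   series. This is real analyticity for K = R and complex analyticity for
   K = R[i] (where M is forced to be real, since `<=` compares imaginary
   parts for equality). *)
Definition analytic_at (f : 'rV[K]_m -> K) (x : 'rV[K]_m) : Prop :=
  exists c : {ffun 'I_m -> nat} -> K, exists2 r : K, 0 < r &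
    forall h : 'rV[K]_m, (forall i, `|h 0 i| < r) ->
      (exists M : K, forall N : nat,
          box_sum (fun a => `|c a * monomial_at h a|) N <= M) /\
      box_sum (fun a => c a * monomial_at h a) N @[N --> \oo] --> f (x + h).

Definition analytic_on (A : set 'rV[K]_m) (f : 'rV[K]_m -> K) : Prop :=
  forall x, A x -> analytic_at f x.

End Analytic.

Section ComplexBall.
Variables (R : realType) (m : nat).

Definition toC (x : 'rV[R]_m) : 'rV[R[i]]_m := map_mx (real_complex R) x.

(* The Euclidean r-neighborhood in C^m of a real point x. *)
Definition Cball (x : 'rV[R]_m) (r : R) : set 'rV[R[i]]_m :=
  [set t | Num.sqrt (\sum_(i < m) Normc.normc (t 0 i - toC x 0 i) ^+ 2) < r].

Definition analytic_extension (Om : set 'rV[R]_m) (A : set 'rV[R[i]]_m)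
    (f : 'rV[R]_m -> R) (g : 'rV[R[i]]_m -> R[i]) : Prop :=
  analytic_on A g /\
  forall t, Om t -> A (toC t) -> g (toC t) = real_complex R (f t).

Definition bounded_domain (Om : set 'rV[R]_m) : Prop :=
  [/\ open Om, connected Om & bounded_set Om].

End ComplexBall.

Lemma product_measure1_sigma_finite d1 d2 (T1 : measurableType d1)
    (T2 : measurableType d2) (R : realType)
    (m1 : {sigma_finite_measure set T1 -> \bar R})
    (m2 : {sigma_finite_measure set T2 -> \bar R}) :
  sigma_finite setT (product_measure1 m1 m2).
Proof.
have /sigma_finiteP[F [TF ndF Foo]] := sigma_finiteT m1.
have /sigma_finiteP[G [TG ndG Goo]] := sigma_finiteT m2.
exists (fun n => F n `*` G n).
  rewrite -setXTT TF TG predeqE => -[x y]; split.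
    move=> [/= [n _ Fnx] [k _ Gky]]; exists (maxn n k) => //; split.
    - by move: x Fnx; exact/subsetPset/ndF/leq_maxl.
    - by move: y Gky; exact/subsetPset/ndG/leq_maxr.
  by move=> [n _ []/= ? ?]; split; exists n.
move=> k; have [? ?] := Foo k; have [? ?] := Goo k.
split; first exact: measurableX.
by rewrite product_measure1E// lte_mul_pinfty// ge0_fin_numE.
Qed.

Lemma pushforward_sigma_finite d1 d2 (T1 : measurableType d1)
    (T2 : measurableType d2) (R : realType)
    (p : {measure set T1 -> \bar R}) (f : T1 -> T2) (g : T2 -> T1) :
  sigma_finite setT p ->
  measurable_fun setT f -> measurable_fun setT g -> cancel f g ->
  exists q : {sigma_finite_measure set T2 -> \bar R}, pushforward p f = q.
Proof.
move=> [F FT Foo] mf mg fK.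
pose q : {measure set T2 -> \bar R} :=
  measure_function_pushforward__canonical__measure_function_Measure p mf.
have sf : sigma_finite setT (Measure.sort q).
  exists (fun k => g @^-1` F k); first by rewrite -preimage_bigcup -FT.
  move=> k; have [mF Fk] := Foo k; split.
    by rewrite -[X in measurable X]setTI; exact: mg.
  rewrite /q /= /pushforward -comp_preimage.
  by rewrite (_ : g \o f = id)//; apply/funext.
pose qs := Measure_isSigmaFinite.Build _ _ _ (Measure.sort q) sf.
pose Q : {sigma_finite_measure set T2 -> \bar R} := HB.pack (Measure.sort q) qs.
by exists Q.
Qed.

Section Lebesgue.
Variable R : realType.

(* R with the Borel sigma-algebra that carries `lebesgue_measure`. *)
Local Notation BR := (measurableTypeR R).

Definition cons_pair n (x : BR * n.-tuple BR) : n.+1.-tuple BR :=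
  [the n.+1.-tuple BR of x.1 :: x.2].

Fixpoint lebesgue_tuple n : set (n.-tuple BR) -> \bar R :=
  match n with
  | 0 => \d_ [tuple]
  | n'.+1 => pushforward
      (product_measure1 (@lebesgue_measure R) (@lebesgue_tuple n'))
      (@cons_pair n')
  end.

Lemma measurable_cons_pair n : measurable_fun setT (@cons_pair n).
Proof. exact: measurable_cons. Qed.

Lemma lebesgue_tuple_measure n :
  exists mu : {sigma_finite_measure set (n.-tuple BR) -> \bar R},
    @lebesgue_tuple n = mu.
Proof.
elim: n => [|n [mu IH]].
  by exists [the {sigma_finite_measure set (0.-tuple BR) -> \bar R}
    of \d_ [tuple]].
pose uncons (t : n.+1.-tuple BR) := (thead t, [tuple of behead t]).
have mu' : measurable_fun setT uncons.
  apply/measurable_fun_pairP; split; first exact: measurable_tnth.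
  exact: measurable_behead.
have cK : cancel (@cons_pair n) uncons.
  by case=> x t; congr pair; apply/val_inj.
have [q qE] := pushforward_sigma_finite
  (product_measure1_sigma_finite (@lebesgue_measure R) mu)
  (@measurable_cons_pair n) mu' cK.
by exists q; rewrite /= IH.
Qed.

Let lebesgue_tuple0 n : lebesgue_tuple (n := n) set0 = 0%E.
Proof. by have [mu ->] := lebesgue_tuple_measure n; exact: measure0. Qed.

Let lebesgue_tuple_ge0 n A : (0 <= lebesgue_tuple (n := n) A)%E.
Proof. by have [mu ->] := lebesgue_tuple_measure n; exact: measure_ge0. Qed.

Let lebesgue_tuple_sigma_additive n :
  semi_sigma_additive (@lebesgue_tuple n).
Proof.
by have [mu ->] := lebesgue_tuple_measure n; exact: measure_semi_sigma_additive.
Qed.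

HB.instance Definition _ n := isMeasure.Build _ _ _ (@lebesgue_tuple n)
  (@lebesgue_tuple0 n) (@lebesgue_tuple_ge0 n) (@lebesgue_tuple_sigma_additive n).

Let lebesgue_tuple_sigma_finite n : sigma_finite setT (@lebesgue_tuple n).
Proof. by have [mu ->] := lebesgue_tuple_measure n; exact: sigma_finiteT. Qed.

HB.instance Definition _ n := Measure_isSigmaFinite.Build _ _ _
  (@lebesgue_tuple n) (@lebesgue_tuple_sigma_finite n).

End Lebesgue.

Section HiddenMarkov.
Variables (R : realType) (l : nat).

Definition stochastic (P : 'M[R]_l) : Prop :=
  (forall i j, 0 <= P i j) /\ (forall i, \sum_(j < l) P i j = 1).

Definition stationary_vector (P : 'M[R]_l) (pi : 'rV[R]_l) : Prop :=
  [/\ forall i, 0 <= pi 0 i, \sum_(i < l) pi 0 i = 1 & pi *m P = pi].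

Definition probability_density (f : R -> R) : Prop :=
  [/\ measurable_fun setT f, forall z, 0 <= f z &
      (\int[@lebesgue_measure R]_z (f z)%:E = 1)%E].

(* The law of Y, the initial vector pi, the transition matrix P, and the
   channel densities f z y = q(z | y). *)
Variables (pi : 'rV[R]_l) (P : 'M[R]_l) (f : R -> 'I_l -> R).

(* P(Y_{-n} = y_0, ..., Y_0 = y_n) *)
Definition path_prob n (y : {ffun 'I_n.+1 -> 'I_l}) : R :=
  pi 0 (y ord0) *
  \prod_(i < n) P (y (widen_ord (leqnSn n) i)) (y (lift ord0 i)).

(* The density p(z_{-n}, ..., z_0) of the channel output, obtained by
   conditioning on Y_{-n}, ..., Y_0; the tuple z lists z_{-n}, ..., z_0. *)
Definition joint_density n (z : n.+1.-tuple (measurableTypeR R)) : R :=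
  \sum_(y : {ffun 'I_n.+1 -> 'I_l})
     path_prob y * \prod_(i < n.+1) f (tnth z i) (y i).

(* H(Z_{-n}^0); since ln 0 = 0, the convention 0 log 0 = 0 holds. *)
Definition block_entropy n : \bar R :=
  (- \int[@lebesgue_tuple R n.+1]_z
       (joint_density z * ln (joint_density z))%:E)%E.

Definition mean_block_entropy n : \bar R :=
  ((n.+1%:R^-1)%:E * block_entropy n)%E.

Definition entropy_rate : \bar R := limn mean_block_entropy.

Definition entropy_rate_defined : Prop :=
  (forall n, block_entropy n \is a fin_num) /\
  exists h : R, mean_block_entropy n @[n --> \oo] --> h%:E.

End HiddenMarkov.

Section Envelopes.
Variables (R : realType) (l m : nat).
Variables (q : 'rV[R[i]]_m -> R -> 'I_l -> R[i]) (x : 'rV[R]_m) (r : R).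

Definition sup_envelope (z : R) : \bar R :=
  ereal_sup [set (Normc.normc (q t z y))%:E | y in [set: 'I_l] & t in Cball x r].

Definition inf_envelope (z : R) : \bar R :=
  ereal_inf [set (Normc.normc (q t z y))%:E | y in [set: 'I_l] & t in Cball x r].

End Envelopes.

(* Main.v *)
Require Import Defs.
From HB Require Import structures.
From mathcomp Require Import all_boot all_order all_algebra.
From mathcomp Require Import all_classical all_reals all_analysis.
From mathcomp Require Import complex finmap separable cyclotomic.
From mathcomp Require Import measurable_realfun ring lra.

Set Implicit Arguments.
Unset Strict Implicit.
Unset Printing Implicit Defensive.

Import Order.TTheory GRing.Theory Num.Theory.
Import numFieldNormedType.Exports.

Local Open Scope classical_set_scope.
Local Open Scope ring_scope.

(** Near the base point the entropy rate is the sum of a power series in [h], the increment of the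
    joint parameter. The work takes place in the Banach algebra of absolutely convergent power
    series: [PS r f M] says that [f t h] is a power series in [h] whose coefficients are admissible
    functions of a parameter [t] (measurable ones, when [t] is to be integrated), and that its l1
    norm at radius [r] is at most [M t]. This norm is submultiplicative and behaves well under
    substitution, geometric series, [ln (1 + g)] and integration in [t], so estimates on complex
    neighbourhoods become estimates of majorants over real parameters.

    The complex hypotheses enter through [PS_of_complex]: a function analytic on a closed complex
    polydisc of radius [s] and bounded there by [B] has, by Cauchy's estimates, a majorant
    [2 ^+ m * B] at radius [s / 2]. Since analyticity only gives local expansions,
    [polydisc_extension] first proves that the series at the centre reaches the whole polydisc;
    averages over roots of unity play the part of contour integrals. In this way [ratio_bounded]
    (tail condition and continuity) bounds the ratios [q(z|j) / q(z|I)] at the base point, and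
    [PS_ratio] (equicontinuity) makes their variation arbitrarily small, uniformly in [z].

    The probabilistic core is a backward recursion. The density of later observations given the
    present hidden state is a vector [betaq], and an older observation acts on it by a positive
    matrix. After division by [q(z|I)], the entries of this matrix at the base point lie between
    [c * s z j] and [s z j], so the induced averaging kernel dominates [c] times a probability
    vector independent of the row (Doeblin). The vector matters only up to a scalar, and the scalar
    is chosen to absorb that common part. What remains is linear of norm [1 - c], plus a
    perturbation of norm [c / 32]. Hence the relative deviation from the base point keeps norm at
    most [1 / 8] ([PS_dev]), and the influence of the newest observation decays like
    [(1 - c / 2) ^+ n] in the majorant norm ([contraction]). So the conditional density of the
    oldest observation given the [n] later ones is [q(z|I) * exp G_n], with [G_n] uniformly
    majorised ([PS_log_ratio]) and its dependence on the newest observation majorised by a multiple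
    of [(1 - c / 2) ^+ n] ([PS_log_ratio_step]).

    By the chain rule the block entropy is [- \sum_k (a + gain k)], where [a] averages [ln q(z|I)]
    and [gain n] is the integral of the joint density times [G_n] ([dens_entropy]). The majorant of
    the density of [n] letters has integral at most a constant times [(1 + c / 4) ^+ n] once the
    radius is small, because transition rows and densities at the base point have total mass 1. As
    [(1 + c / 4) * (1 - c / 2) < 1], the differences of [gain] are summable in the majorant norm,
    the limit is a power series ([gain_limit]), and Cesaro means identify the entropy rate
    ([entropy_rate_limit]). The stationary vector is a power series by a Neumann series
    ([PS_stationary]). *)

(** * Unordered sums and absolute bounds *)

Section NetSums.
Variable K : numFieldType.
Implicit Types (I J : choiceType).

Definition abs_bound J (u : J -> K) (M : K) : Prop :=
  forall F : {fset J}, \sum_(j <- F) `|u j| <= M.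

(** Convergence of the net of finite partial sums: regrouping along fibres and reindexing need no
    choice of an order, and real and complex families are treated at once. *)
Definition sums J (u : J -> K) (s : K) : Prop :=
  forall e : K, 0 < e -> exists F0 : {fset J}, forall F : {fset J},
    (F0 `<=` F)%fset -> `|s - \sum_(j <- F) u j| <= e.

Lemma abs_bound_ge0 J (u : J -> K) M : abs_bound u M -> 0 <= M.
Proof. by move=> /(_ fset0); rewrite big_seq_fset0. Qed.

Lemma abs_bound_le J (u : J -> K) M M' : M <= M' -> abs_bound u M -> abs_bound u M'.
Proof. by move=> MM' uM F; exact: le_trans (uM F) MM'. Qed.

Lemma abs_bound_term J (u : J -> K) M j : abs_bound u M -> `|u j| <= M.
Proof. by move=> /(_ [fset j]%fset); rewrite big_seq_fset1. Qed.

Lemma abs_bound_dom J (u v : J -> K) M :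
  (forall j, `|u j| <= `|v j|) -> abs_bound v M -> abs_bound u M.
Proof. by move=> uv vM F; apply: le_trans (vM F); apply: ler_sum. Qed.

Lemma abs_bound_seq J (u : J -> K) M (r : seq J) :
  uniq r -> abs_bound u M -> \sum_(j <- r) `|u j| <= M.
Proof.
move=> ur /(_ [fset j in r]%fset); rewrite (perm_big r) //.
by apply: uniq_perm => // j; rewrite !inE.
Qed.

Lemma sums_unique J (u : J -> K) s t : sums u s -> sums u t -> s = t.
Proof.
move=> us ut; apply/eqP; rewrite -subr_eq0 -normr_eq0; apply/negPn/negP => st0.
have st : 0 < `|s - t| / 4 by rewrite divr_gt0// lt_def st0 normr_ge0.
have [F1 F1P] := us _ st; have [F2 F2P] := ut _ st.
have := lerD (F1P _ (fsubsetUl F1 F2)) (F2P _ (fsubsetUr F1 F2)).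
set x := \sum_(_ <- _) _; rewrite (distrC t) => h.
have := le_trans (ler_normD (s - x) (x - t)) h.
rewrite addrA subrK => {}h.
have : `|s - t| <= `|s - t| / 2 by apply: le_trans h _; rewrite le_eqVlt; apply/orP; left; apply/eqP; field.
rewrite ler_pdivlMr// -[leRHS]mulr1 ler_pM2l ?lt_def ?st0 ?normr_ge0//.
by rewrite (ler_nat _ 2 1).
Qed.

Lemma sums_ext J (u v : J -> K) s : u =1 v -> sums u s -> sums v s.
Proof.
move=> uv us e e0; have [F0 F0P] := us e e0; exists F0 => F /F0P.
by under eq_bigr do rewrite uv.
Qed.

Lemma sumsD J (u v : J -> K) s t :
  sums u s -> sums v t -> sums (fun j => u j + v j) (s + t).
Proof.
move=> us vt e e0; have e2 : 0 < e / 2 by rewrite divr_gt0.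
have [F1 F1P] := us _ e2; have [F2 F2P] := vt _ e2.
exists (F1 `|` F2)%fset => F FF; rewrite big_split/= opprD addrACA.
rewrite (le_trans (ler_normD _ _))// [leRHS](splitr e) lerD//.
- by apply/F1P/(fsubset_trans _ FF)/fsubsetUl.
- by apply/F2P/(fsubset_trans _ FF)/fsubsetUr.
Qed.

Lemma sumsZ J (a : K) (u : J -> K) s : sums u s -> sums (fun j => a * u j) (a * s).
Proof.
move=> us e e0.
have e1 : 0 < e / (`|a| + 1) by rewrite divr_gt0// ltr_wpDl.
have [F0 F0P] := us _ e1; exists F0 => F /F0P.
rewrite -mulr_sumr -mulrBr normrM ler_pdivlMr ?ltr_wpDl// => h.
by apply: le_trans h; rewrite mulrC ler_wpM2l// lerDl.
Qed.

Lemma sumsB J (u v : J -> K) s t :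
  sums u s -> sums v t -> sums (fun j => u j - v j) (s - t).
Proof.
move=> us vt; rewrite -mulN1r; apply: (@sums_ext _ (fun j => u j + (-1) * v j)).
  by move=> j; rewrite mulN1r.
exact: sumsD us (sumsZ _ vt).
Qed.

Lemma sums_fin J (u : J -> K) (F0 : {fset J}) :
  (forall j, j \notin F0 -> u j = 0) -> sums u (\sum_(j <- F0) u j).
Proof.
move=> u0 e e0; exists F0 => F FF; rewrite (big_fset_incl _ FF).
  by rewrite subrr normr0 ltW.
by move=> j _ /u0.
Qed.

Lemma sums0 J (u : J -> K) : (forall j, u j = 0) -> sums u 0.
Proof.
move=> u0; have := @sums_fin _ u fset0 (fun j _ => u0 j).
by rewrite big_seq_fset0.
Qed.

Lemma sums_norm_le J (u : J -> K) s M : abs_bound u M -> sums u s -> `|s| <= M.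
Proof.
move=> uM us; apply/ler_addgt0Pr => e e0; have [F0 /(_ _ (fsubset_refl _)) h] := us e e0.
rewrite -(subrK (\sum_(j <- F0) u j) s) (le_trans (ler_normD _ _))// addrC lerD//.
by apply: le_trans (uM F0); exact: ler_norm_sum.
Qed.

(* The sum of the family [v] of the fibre sums of [u] along [p]. *)
Lemma sums_fibres I J (u : J -> K) (p : J -> I) (v : I -> K) s :
  (forall i, sums (fun j => if p j == i then u j else 0) (v i)) ->
  sums u s -> sums v s.
Proof.
move=> uv us e e0; have e2 : 0 < e / 2 by rewrite divr_gt0.
have [F0 F0P] := us _ e2; exists (p @` F0)%fset => I' pI'.
(* Half of [e] pays for the total, the other half is shared among the fibres; the [+ 1] guards
   against an empty [I']. *)
pose d := e / 2 / (#|` I'| + 1)%:R.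
have d0 : 0 < d by rewrite divr_gt0// ltr0n addn1.
have /choice[G GP] : forall i, exists F1 : {fset J}, forall F : {fset J}, (F1 `<=` F)%fset ->
    `|v i - \sum_(j <- F) (if p j == i then u j else 0)| <= d.
  by move=> i; exact: uv.
(* One finite set for both purposes: it contains [F0], and over each [i] in [I'] it contains the
   part of [G i] lying over [i]. *)
pose F := [fset j in (F0 `|` \bigcup_(i <- I') G i)%fset | p j \in I']%fset.
have F0F : (F0 `<=` F)%fset.
  apply/fsubsetP => j jF0; rewrite !inE jF0/=.
  by apply: (fsubsetP pI'); apply/imfsetP; exists j.
have -> : s - \sum_(i <- I') v i =
    (s - \sum_(j <- F) u j) - \sum_(i <- I') (v i - \sum_(j <- F) (if p j == i then u j else 0)).
  rewrite sumrB opprB addrA; congr (_ - _).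
  rewrite (_ : \sum_(j <- F) u j = \sum_(i <- I') \sum_(j <- F) (if p j == i then u j else 0)).
    by rewrite subrK.
  rewrite exchange_big/= big_seq_cond [RHS]big_seq_cond; apply: eq_bigr => j.
  rewrite andbT !inE => /andP[_ pjI].
  rewrite (big_fsetD1 _ pjI)/= eqxx big1_seq ?addr0// => i.
  by rewrite !inE eq_sym => /andP[_ /andP[/negbTE -> _]].
rewrite (le_trans (ler_normB _ _))// [leRHS](splitr e) lerD ?F0P//.
rewrite (le_trans (ler_norm_sum _ _ _))//.
apply: (@le_trans _ _ (\sum_(i <- I') d)).
  rewrite big_seq [leRHS]big_seq; apply: ler_sum => i iI'.
  pose Fi := (F `|` G i)%fset.
  rewrite (_ : \sum_(j <- F) _ = \sum_(j <- Fi) (if p j == i then u j else 0)).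
    exact/GP/fsubsetUr.
  apply: big_fset_incl; first exact: fsubsetUl.
  move=> j + jF; rewrite in_fsetU (negbTE jF)/= => jG; case: ifPn => // /eqP pj.
  move: jF; rewrite !inE pj iI' andbT negb_or => /andP[_ /negP[]].
  exact: (fsubsetP (bigfcup_sup _ iI' isT)).
rewrite big_const_seq count_predT iter_addr_0 /d -[leLHS]mulr_natr -mulrA -[leRHS]mulr1.
rewrite ler_pM2l// ler_pdivrMl ?ltr0n ?addn1// mulr1 ler_nat; exact: leqnSn.
Qed.



Lemma fset_preimage I J (f : I -> J) (F : {fset J}) :
  injective f -> exists G : {fset I}, forall i, (i \in G) = (f i \in F).
Proof.
move=> fI; pose g j := if pselect (exists i, f i = j) is left h then Some (sval (cid h)) else None.
have gf i : g (f i) = Some i.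
  by rewrite /g; case: pselect => [h|[]]; [case: cid => /= i' /fI ->|exists i].
exists [fset i in pmap g F]%fset => i; rewrite !inE mem_pmap.
apply/mapP/idP => [[j jF]|iF]; last by exists (f i).
rewrite /g; case: pselect => // h [->]; by case: cid => /= ? ->.
Qed.

Lemma sums_inj I J (f : I -> J) (u : J -> K) s :
  injective f -> (forall j, u j != 0 -> exists i, f i = j) ->
  sums (u \o f) s -> sums u s.
Proof.
move=> fI fu us e e0; have [F0 F0P] := us e e0.
exists (f @` F0)%fset => F FF; have [F1 F1P] := fset_preimage F fI.
have F01 : (F0 `<=` F1)%fset.
  apply/fsubsetP => i iF0; rewrite F1P; apply: (fsubsetP FF).
  by apply/imfsetP; exists i.
have := F0P F1 F01; rewrite (_ : \sum_(j <- F1) _ = \sum_(j <- (f @` F1)%fset) u j).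
  rewrite (@big_fset_incl _ _ _ _ (f @` F1)%fset F)//.
    by apply/fsubsetP => j /imfsetP[i /= + ->]; rewrite F1P.
  move=> j jF jF1; apply/eqP/negPn/negP => /fu[i ij]; move/negP: jF1; apply.
  by apply/imfsetP; exists i => //=; rewrite F1P ij.
by rewrite big_imfset/=// => i i' _ _ /fI.
Qed.

Lemma abs_bound_inj I J (f : I -> J) (u : J -> K) M :
  injective f -> abs_bound u M -> abs_bound (u \o f) M.
Proof.
move=> fI uM F; have := uM (f @` F)%fset.
by rewrite big_imfset/=// => i i' _ _ /fI.
Qed.

Lemma abs_bound_inj_ext I J (f : I -> J) (u : J -> K) M :
  injective f -> (forall j, u j != 0 -> exists i, f i = j) ->
  abs_bound (u \o f) M -> abs_bound u M.
Proof.
move=> fI fu uM F.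
have [G GP] := fset_preimage F fI; apply: le_trans (uM G).
rewrite (_ : \sum_(j <- G) _ = \sum_(j <- (f @` G)%fset) `|u j|); last first.
  by rewrite big_imfset/=// => i i' _ _ /fI.
rewrite (@big_fset_incl _ _ _ _ (f @` G)%fset F)//.
  by apply/fsubsetP => j /imfsetP[i /= + ->]; rewrite GP.
move=> j jF jF1; apply/eqP; rewrite normr_eq0; apply/negPn/negP => /fu[i ij]; move/negP: jF1; apply.
by apply/imfsetP; exists i => //=; rewrite GP ij.
Qed.

End NetSums.

(** * Completeness of the reals and the complex numbers *)

Definition sum_complete (K : numFieldType) : Prop :=
  forall (J : choiceType) (u : J -> K) M, abs_bound u M -> exists s, sums u s.

Lemma sum_complete_real (R : realType) : sum_complete R.
Proof.
have pos (J : choiceType) (u : J -> R) M : (forall j, 0 <= u j) -> abs_bound u M ->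
    exists s, sums u s.
  move=> u0 uM; pose S := [set x | exists F : {fset J}, x = \sum_(j <- F) u j].
  have Snorm (F : {fset J}) : \sum_(j <- F) `|u j| = \sum_(j <- F) u j.
    by apply: eq_bigr => j _; rewrite ger0_norm.
  have hS : has_sup S.
    split; first by exists (\sum_(j <- fset0) u j); exists fset0.
    by exists M => _ [F ->]; rewrite -Snorm.
  exists (sup S) => e e0; have [_ [F0 ->] h] := sup_adherent e0 hS.
  exists F0 => F FF; rewrite ger0_norm; last first.
    by rewrite subr_ge0; apply: ub_le_sup; [exact: hS.2|exists F].
  rewrite lerBlDr -lerBlDl (le_trans (ltW h))//.
  rewrite (big_fsetID _ (mem F0) F)/= (_ : [fset x in F | x \in F0]%fset = F0).
    by rewrite lerDl sumr_ge0.
  apply/fsetP => j; rewrite !inE/=; apply/andP/idP; first by case.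
  by move=> jF0; split => //; apply: (fsubsetP FF).
move=> J u M uM.
have [s1 us1] : exists s, sums (fun j => Num.max (u j) 0) s.
  apply: (@pos _ _ M); first by move=> j; rewrite le_max lexx orbT.
  apply: abs_bound_dom uM => j; rewrite /Num.max; case: ifP => //.
  by rewrite normr0.
have [s2 us2] : exists s, sums (fun j => Num.max (- u j) 0) s.
  apply: (@pos _ _ M); first by move=> j; rewrite le_max lexx orbT.
  apply: abs_bound_dom uM => j; rewrite /Num.max; case: ifP => //; first by rewrite normr0.
  by rewrite normrN.
exists (s1 - s2); apply: sums_ext (sumsB us1 us2) => j.
rewrite /Num.max oppr_lt0; case: (ltrgtP (u j) 0) => [_|_|->]; lra.
Qed.

Local Open Scope complex_scope.

Lemma sum_complete_complex (R : realType) : sum_complete R[i].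
Proof.
move=> J u M uM.
have leRe (x : R[i]) : (`|complex.Re x|%:C <= `|x|)%R by exact: normc_ge_Re.
have leIm (x : R[i]) : (`|complex.Im x|%:C <= `|x|)%R.
  have := leRe (x * 'i); rewrite ReiNIm normrN normrM.
  by rewrite (normc_def 'i)/= expr0n expr1n add0r sqrtr1 mulr1.
have bnd (p : R[i] -> R) : (forall x, `|p x|%:C <= `|x|) ->
    abs_bound (p \o u) (complex.Re M).
  move=> pP F; have : \sum_(j <- F) `|p (u j)|%:C <= M.
    by apply: le_trans (uM F); apply: ler_sum => j _; exact: pP.
  by rewrite -rmorph_sum lecE => /andP[_].
have [s1 s1P] := sum_complete_real (bnd _ leRe).
have [s2 s2P] := sum_complete_real (bnd _ leIm).
exists (s1%:C + 'i * s2%:C) => e e0.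
have eE : e = (complex.Re e)%:C by rewrite RRe_real// gtr0_real.
have e2 : 0 < complex.Re e / 2 by rewrite divr_gt0// -ltcR -eE.
have [F1 F1P] := s1P _ e2; have [F2 F2P] := s2P _ e2.
exists (F1 `|` F2)%fset => F FF.
have -> : s1%:C + 'i * s2%:C - \sum_(j <- F) u j =
    (s1 - \sum_(j <- F) complex.Re (u j))%:C + 'i * (s2 - \sum_(j <- F) complex.Im (u j))%:C.
  rewrite !rmorphB/= !rmorph_sum/= mulrBr mulr_sumr addrACA -opprD -big_split/=.
  by congr (_ - _); apply: eq_bigr => j _; exact: complexE.
have nC (x : R) : `|x%:C| = `|x|%:C by rewrite normc_def/= expr0n addr0 sqrtr_sqr.
rewrite (le_trans (ler_normD _ _))// normrM.
rewrite (normc_def 'i)/= expr0n expr1n add0r sqrtr1 mul1r eE !nC -rmorphD lecR.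
rewrite [leRHS](splitr (complex.Re e)) lerD//.
- by apply/F1P/(fsubset_trans _ FF)/fsubsetUl.
- by apply/F2P/(fsubset_trans _ FF)/fsubsetUr.
Qed.

(** * Fubini for unordered sums *)

Section DoubleSums.
Variable K : numFieldType.
Hypothesis hK : sum_complete K.
Implicit Types (I J : choiceType).

(** Completeness supplies some sum, and [sums_fibres] with uniqueness forces it to be [s]. The
    absolute bound is what makes this converse regrouping valid. *)
Lemma sums_total I J (u : J -> K) (p : J -> I) (v : I -> K) s M :
  abs_bound u M ->
  (forall i, sums (fun j => if p j == i then u j else 0) (v i)) ->
  sums v s -> sums u s.
Proof.
move=> uM uv vs; have [s' us'] := hK uM.
by rewrite (sums_unique vs (sums_fibres uv us')).
Qed.

Lemma pair_inj I J (i : I) : injective (fun j : J => (i, j)).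
Proof. by move=> j j' []. Qed.

Lemma abs_bound_pair I J (u : I * J -> K) (m : I -> K) M :
  (forall i, abs_bound (fun j => u (i, j)) (m i)) -> abs_bound m M -> abs_bound u M.
Proof.
move=> um mM F; apply: le_trans (mM (fst @` F)%fset).
have -> : \sum_(x <- F) `|u x| =
    \sum_(i <- (fst @` F)%fset) \sum_(x <- F) `|if x.1 == i then u x else 0|.
  rewrite exchange_big/= big_seq [RHS]big_seq; apply: eq_bigr => x xF.
  have x1F : x.1 \in (fst @` F)%fset by apply/imfsetP; exists x.
  rewrite (big_fsetD1 _ x1F)/= eqxx big1_seq ?addr0// => i.
  by rewrite !inE eq_sym => /andP[_ /andP[/negbTE -> _]]; rewrite normr0.
apply: ler_sum => i _; rewrite (ger0_norm (abs_bound_ge0 (um i))).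
apply: (abs_bound_inj_ext (@pair_inj I J i)).
  move=> [i' j]/=; case: ifPn => [/eqP <- _|]; first by exists j.
  by rewrite eqxx.
by move=> G; rewrite /= eqxx; exact: um.
Qed.

Lemma sums_pair I J (u : I * J -> K) (v : I -> K) s M : abs_bound u M ->
  (forall i, sums (fun j => u (i, j)) (v i)) -> sums v s -> sums u s.
Proof.
move=> uM uv; apply: (@sums_total _ _ _ fst _ _ M) => // i.
apply: (sums_inj (@pair_inj I J i)).
  move=> [i' j]/=; case: ifPn => [/eqP <- _|]; first by exists j.
  by rewrite eqxx.
by rewrite /comp /= eqxx.
Qed.

Lemma abs_bound_mul I J (u : I -> K) (v : J -> K) A B :
  abs_bound u A -> abs_bound v B -> abs_bound (fun x => u x.1 * v x.2) (A * B).
Proof.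
move=> uA vB; have B0 := abs_bound_ge0 vB.
apply: (@abs_bound_pair _ _ _ (fun i => `|u i| * B)).
  move=> i F /=; under eq_bigr do rewrite normrM.
  by rewrite -mulr_sumr ler_wpM2l.
move=> F; under eq_bigr do rewrite normrM normr_id (ger0_norm B0).
by rewrite -mulr_suml ler_wpM2r.
Qed.

Lemma sums_mul I J (u : I -> K) (v : J -> K) A B s t :
  abs_bound u A -> abs_bound v B -> sums u s -> sums v t ->
  sums (fun x => u x.1 * v x.2) (s * t).
Proof.
move=> uA vB us vt; apply: (@sums_pair _ _ _ (fun i => u i * t) _ (A * B)).
- exact: abs_bound_mul.
- by move=> i /=; exact: sumsZ.
- by rewrite mulrC; apply: sums_ext (sumsZ t us) => i; rewrite mulrC.
Qed.

End DoubleSums.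

(** * The algebra of power series with parameters and majorants *)

(** The parameter values together with the coefficient functions that are allowed. Closure under
    products suffices, because adding two series only lists the terms of both. Completeness of [K]
    travels along so that the closure lemmas have it at hand. *)
Record coefSpace (K : numFieldType) := CoefSpace {
  csort :> Type ;
  adm : (csort -> K) -> Prop ;
  adm_cst : forall k, adm (fun=> k) ;
  adm_mul : forall f g, adm f -> adm g -> adm (fun t => f t * g t) ;
  adm_complete : sum_complete K }.

Section PowerSeries.
Variables (K : numFieldType) (X : coefSpace K).
Local Notation T := (csort X).

Definition mdeg m (a : {ffun 'I_m -> nat}) : nat := \sum_i a i.

Definition polydisc m (r : K) (h : 'rV[K]_m) : Prop := forall i, `|h 0 i| <= r.

Lemma monomial_le m r (h : 'rV[K]_m) a : polydisc r h ->
  `|monomial_at h a| <= r ^+ mdeg a.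
Proof.
move=> hr; rewrite /monomial_at normr_prod /mdeg -prodrXr; apply: ler_prod => i _.
by rewrite normrX exprn_ge0//= ; apply: lerXn2r; rewrite ?nnegrE// (le_trans _ (hr i)).
Qed.

(* Repetitions among the multi-indices [a n] are allowed. *)
Definition PS m (r : K) (f : T -> 'rV[K]_m -> K) (M : T -> K) : Prop :=
  exists (a : nat -> {ffun 'I_m -> nat}) (c : nat -> T -> K),
    (forall n, adm (c n)) /\
    forall t, abs_bound (fun n => c n t * r ^+ mdeg (a n)) (M t) /\
      forall h, polydisc r h ->
        sums (fun n => c n t * monomial_at h (a n)) (f t h).

Lemma PS_intro (J : countType) m (r : K) (f : T -> 'rV[K]_m -> K) (M : T -> K)
    (a : J -> {ffun 'I_m -> nat}) (c : J -> T -> K) :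
  (forall j, adm (c j)) ->
  (forall t, abs_bound (fun j => c j t * r ^+ mdeg (a j)) (M t)) ->
  (forall t h, polydisc r h ->
     sums (fun j => c j t * monomial_at h (a j)) (f t h)) -> PS r f M.
Proof.
move=> ac cM cf.
(* Integers that encode no index carry the coefficient 0. *)
pose a' n := if pickle_inv n is Some j then a j else [ffun=> 0%N].
pose c' n := if @pickle_inv J n is Some j then c j else fun=> 0.
have nz (g : {ffun 'I_m -> nat} -> K) (t : T) (n : nat) : c' n t * g (a' n) != 0 -> exists j : J, choice.pickle j = n.
  rewrite /c'; have := @pickle_invK J n; case: pickle_inv => /= [j|]; last by rewrite mul0r eqxx.
  by move=> jn _; exists j.
have pI := pcan_inj (@pickleK_inv J).
exists a', c'; split.
  by move=> n; rewrite /c'; case: pickle_inv => // *; exact: adm_cst.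
move=> t; split.
  apply: (abs_bound_inj_ext pI); first exact: (nz (fun a => r ^+ mdeg a)).
  by move=> F; rewrite /= /a' /c'; under eq_bigr do rewrite pickleK_inv; exact: cM.
move=> h hr; apply: (sums_inj pI); first exact: nz.
by apply: sums_ext (cf t h hr) => j /=; rewrite /a' /c' pickleK_inv.
Qed.

Variable m : nat.
Implicit Types (f g : T -> 'rV[K]_m -> K) (M : T -> K).

Lemma PS_bound r f M t h : PS r f M -> polydisc r h -> `|f t h| <= M t.
Proof.
move=> [a [c [_ /(_ t)[cM cf]]]] hr; apply: sums_norm_le (cf _ hr).
apply: abs_bound_dom cM => n; rewrite !normrM ler_wpM2l//.
have hn := monomial_le (a n) hr.
by rewrite (le_trans hn)// ger0_norm// (le_trans _ hn).
Qed.

Lemma PS_ge0 r f M t : PS r f M -> 0 <= M t.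
Proof. by move=> [a [c [_ /(_ t)[/abs_bound_ge0]]]]. Qed.

Lemma PS_ext r f g M : (forall t h, polydisc r h -> f t h = g t h) ->
  PS r f M -> PS r g M.
Proof.
move=> fg [a [c [ac cM]]]; exists a, c; split => // t; split; first exact: (cM t).1.
by move=> h hr; rewrite -fg//; exact: (cM t).2.
Qed.

Lemma PS_le r f M M' : (forall t, M t <= M' t) -> PS r f M -> PS r f M'.
Proof.
move=> MM [a [c [ac cM]]]; exists a, c; split => // t; split; last exact: (cM t).2.
exact: abs_bound_le (MM t) (cM t).1.
Qed.

Lemma PS_shrink r r' f M : 0 <= r' -> r' <= r -> PS r f M -> PS r' f M.
Proof.
move=> r0 rr [a [c [ac cM]]]; exists a, c; split => // t; split.
  apply: abs_bound_dom (cM t).1 => n; rewrite !normrM ler_wpM2l// !normrX.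
  by apply: lerXn2r; rewrite ?nnegrE// !ger0_norm// (le_trans r0).
by move=> h hr; apply: (cM t).2 => i; exact: le_trans (hr i) rr.
Qed.

Lemma monomial_at0 (h : 'rV[K]_m) : monomial_at h [ffun=> 0%N] = 1.
Proof. by rewrite /monomial_at big1// => i _; rewrite ffunE expr0. Qed.

Lemma mdeg0 : mdeg ([ffun=> 0%N] : {ffun 'I_m -> nat}) = 0%N.
Proof. by rewrite /mdeg big1// => i _; rewrite ffunE. Qed.

Lemma abs_bound_unit (u : unit -> K) (M : K) : `|u tt| <= M -> abs_bound u M.
Proof.
move=> uM F; have FF : (F `<=` [fset tt])%fset by apply/fsubsetP => -[]; rewrite inE.
apply: le_trans uM; have -> : `|u tt| = \sum_(j <- [fset tt]%fset) `|u j| by rewrite big_seq_fset1.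
rewrite [leRHS](big_fsetID _ (mem F))/= (_ : [fset x in [fset tt] | x \in F]%fset = F).
  by rewrite lerDl sumr_ge0.
by apply/fsetP => -[]; rewrite !inE.
Qed.

Lemma sums_unit (u : unit -> K) : sums u (u tt).
Proof.
have -> : u tt = \sum_(j <- [fset tt]%fset) u j by rewrite big_seq_fset1.
by apply: sums_fin => -[]; rewrite inE.
Qed.

Lemma PS_monomial1 (g : T -> K) (a : {ffun 'I_m -> nat}) r :
  adm g -> PS r (fun t h => g t * monomial_at h a) (fun t => `|g t| * `|r ^+ mdeg a|).
Proof.
move=> ag; apply: (@PS_intro _ _ _ _ _ (fun=> a) (fun _ : unit => g)) => // t.
  by apply: abs_bound_unit; rewrite normrM.
by move=> h _; exact: sums_unit.
Qed.

Lemma PS_adm (g : T -> K) r : adm g -> PS r (fun t (h : 'rV[K]_m) => g t) (fun t => `|g t|).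
Proof.
move=> /(PS_monomial1 [ffun=> 0%N] r) P.
apply: PS_ext (PS_le _ P) => [t h _|t]; first by rewrite monomial_at0 mulr1.
by rewrite mdeg0 expr0 normr1 mulr1.
Qed.

Lemma PS_cst (k : K) r : PS r (fun t (h : 'rV[K]_m) => k) (fun t => `|k|).
Proof. exact/PS_adm/adm_cst. Qed.

(** Flattening the double family of terms: a bound on the sum of the norms bounds all the terms
    together, so the regrouped series converges. Finite sums, substitution, inversion and logarithm
    all go through this lemma. *)
Lemma PS_series (I : countType) r (f_ : I -> T -> 'rV[K]_m -> K) (M_ : I -> T -> K) f M :
  (forall i, PS r (f_ i) (M_ i)) ->
  (forall t, abs_bound (fun i => M_ i t) (M t)) ->
  (forall t h, polydisc r h -> sums (fun i => f_ i t h) (f t h)) -> PS r f M.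
Proof.
move=> /choice[a /choice[c cP]] MM ff.
have cM t : abs_bound (fun x : I * nat => c x.1 x.2 t * r ^+ mdeg (a x.1 x.2)) (M t).
  by apply: abs_bound_pair (MM t) => i; exact: ((cP i).2 t).1.
apply: (@PS_intro _ _ _ _ _ (fun x => a x.1 x.2) (fun x : I * nat => c x.1 x.2)) => //.
  by move=> x; exact: (cP x.1).1.
move=> t h hr; apply: (sums_pair (@adm_complete _ X) _ _ (ff t h hr)).
  apply: abs_bound_dom (cM t) => x; rewrite !normrM ler_wpM2l//.
  have hn := monomial_le (a x.1 x.2) hr.
  by rewrite (le_trans hn)// ger0_norm// (le_trans _ hn).
by move=> i /=; exact: ((cP i).2 t).2.
Qed.

Lemma PS_sum (I : finType) (P : pred I) r (f_ : I -> T -> 'rV[K]_m -> K) (M_ : I -> T -> K) :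
  (forall i, P i -> PS r (f_ i) (M_ i)) ->
  PS r (fun t h => \sum_(i | P i) f_ i t h) (fun t => \sum_(i | P i) M_ i t).
Proof.
move=> fM.
apply: (@PS_series I r (fun i t h => if P i then f_ i t h else 0) (fun i t => if P i then M_ i t else 0)).
- move=> i; case Pi : (P i); first exact: fM.
  by apply: PS_le (PS_cst 0 r) => t; rewrite normr0.
- move=> t F; apply: (@le_trans _ _ (\sum_i `|if P i then M_ i t else 0|)); last first.
    rewrite [leRHS]big_mkcond/=; apply: ler_sum => i _; case: ifPn => [Pi|_]; last by rewrite normr0.
    by rewrite ger0_norm//; apply: PS_ge0 (fM i Pi).
  rewrite [leRHS](bigID (fun i => i \in F))/=.
  have -> : \sum_(i | i \in F) `|if P i then M_ i t else 0| = \sum_(i <- F) `|if P i then M_ i t else 0|.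
    rewrite -big_filter; apply: perm_big; apply: uniq_perm; rewrite ?filter_uniq ?index_enum_uniq ?fset_uniq// => i.
    by rewrite mem_filter mem_index_enum andbT.
  by rewrite lerDl sumr_ge0.
- move=> t h hr; set u := fun i => _.
  have := @sums_fin _ _ u [fset i | i : I]%fset.
  have -> : \sum_(j <- [fset i | i : I]%fset) u j = \sum_(i | P i) f_ i t h.
    rewrite [RHS]big_mkcond/=.
    apply: perm_big; apply: uniq_perm; rewrite ?index_enum_uniq ?fset_uniq// => i.
    by rewrite mem_index_enum; apply/imfsetP; exists i.
  by apply => i /negP[]; apply/imfsetP; exists i.
Qed.

Lemma PS_add r f g M N : PS r f M -> PS r g N ->
  PS r (fun t h => f t h + g t h) (fun t => M t + N t).
Proof.
move=> fM gN.
have := @PS_sum _ predT r (fun b : bool => if b then f else g) (fun b : bool => if b then M else N).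
move=> /(_ (fun b => if b return (_ -> PS r (if b then f else g) (if b then M else N)) then fun=> fM else fun=> gN)).
move=> P; apply: PS_ext (PS_le _ P) => [t h _|t]; by rewrite big_bool.
Qed.

(** The Cauchy product. Exponents repeat in the list of products, which spares the sums of
    coefficients. *)
Lemma PS_mul r f g M N : PS r f M -> PS r g N ->
  PS r (fun t h => f t h * g t h) (fun t => M t * N t).
Proof.
move=> [a [c [ac cM]]] [b [d [ad dN]]].
have mD (h : 'rV[K]_m) (x y : {ffun 'I_m -> nat}) : monomial_at h [ffun i : 'I_m => x i + y i]%N = monomial_at h x * monomial_at h y :> K.
  by rewrite /monomial_at -big_split; apply: eq_bigr => i _; rewrite ffunE exprD.
have dD (x y : {ffun 'I_m -> nat}) : mdeg [ffun i : 'I_m => x i + y i]%N = (mdeg x + mdeg y)%N.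
  by rewrite /mdeg -big_split; apply: eq_bigr => i _; rewrite ffunE.
apply: (@PS_intro _ _ _ _ _ (fun x => [ffun i : 'I_m => a x.1 i + b x.2 i]%N)
  (fun x : nat * nat => fun t => c x.1 t * d x.2 t)).
- by move=> x; exact: adm_mul.
- move=> t; apply: abs_bound_dom (abs_bound_mul (cM t).1 (dN t).1) => x.
  by rewrite dD exprD mulrACA.
- move=> t h hr.
  have bd (k : nat -> T -> K) (e : nat -> {ffun 'I_m -> nat}) L :
      abs_bound (fun n => k n t * r ^+ mdeg (e n)) L ->
      abs_bound (fun n => k n t * monomial_at h (e n)) L.
    apply: abs_bound_dom => n; rewrite !normrM ler_wpM2l//.
    have hn := monomial_le (e n) hr.
    by rewrite (le_trans hn)// ger0_norm// (le_trans _ hn).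
  have := sums_mul (@adm_complete _ X) (bd _ _ _ (cM t).1) (bd _ _ _ (dN t).1)
    ((cM t).2 h hr) ((dN t).2 h hr).
  by apply: sums_ext => x; rewrite mD mulrACA.
Qed.

Lemma PS_scale (k : T -> K) r f M : adm k -> PS r f M ->
  PS r (fun t h => k t * f t h) (fun t => `|k t| * M t).
Proof. by move=> ak; apply: PS_mul; exact: PS_adm. Qed.

Lemma PS_opp r f M : PS r f M -> PS r (fun t h => - f t h) M.
Proof.
move=> /(PS_scale (@adm_cst _ X (-1))) P.
apply: PS_ext (PS_le _ P) => [t h _|t]; first by rewrite mulN1r.
by rewrite normrN1 mul1r.
Qed.

Lemma PS_sub r f g M N : PS r f M -> PS r g N ->
  PS r (fun t h => f t h - g t h) (fun t => M t + N t).
Proof. by move=> fM /PS_opp; exact: PS_add. Qed.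

Lemma PS_exp r f M n : PS r f M -> PS r (fun t h => f t h ^+ n) (fun t => M t ^+ n).
Proof.
move=> fM; elim: n => [|n IH].
  by apply: PS_le (PS_cst 1 r) => t; rewrite normr1 expr0.
apply: PS_ext (PS_le _ (PS_mul fM IH)) => [t h _|t]; by rewrite exprS.
Qed.

Lemma PS_prod (I : finType) r (f_ : I -> T -> 'rV[K]_m -> K) (M_ : I -> T -> K) :
  (forall i, PS r (f_ i) (M_ i)) ->
  PS r (fun t h => \prod_i f_ i t h) (fun t => \prod_i M_ i t).
Proof.
move=> fM; suff H (s : seq I) : PS r (fun t h => \prod_(i <- s) f_ i t h) (fun t => \prod_(i <- s) M_ i t).
  have := H (index_enum I); by apply.
elim: s => [|i s IH].
  apply: PS_ext (PS_le _ (PS_cst 1 r)) => [t h _|t]; first by rewrite big_nil.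
  by rewrite normr1 big_nil.
apply: PS_ext (PS_le _ (PS_mul (fM i) IH)) => [t h _|t]; by rewrite big_cons.
Qed.

Lemma PS_coord i r : 0 <= r -> PS r (fun t (h : 'rV[K]_m) => h 0 i) (fun t => r).
Proof.
move=> r0; have := PS_monomial1 [ffun j => (i == j) : nat] r (@adm_cst _ X 1).
move=> P; apply: PS_ext (PS_le _ P) => [t h _|t].
  rewrite mul1r /monomial_at (bigD1 i)//= ffunE eqxx expr1 big1 ?mulr1// => j ji.
  by rewrite ffunE eq_sym (negbTE ji) expr0.
rewrite normr1 mul1r (_ : mdeg _ = 1%N) ?expr1 ?ger0_norm//.
rewrite /mdeg (bigD1 i)//= ffunE eqxx big1 ?addn0// => j ji.
by rewrite ffunE eq_sym (negbTE ji).
Qed.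

(** The norm of the inner functions fits the radius of the outer series: each outer term keeps its
    size, and [PS_series] adds them up. *)
Lemma PS_subst n r r' (f : T -> 'rV[K]_n -> K) M (g : 'I_n -> T -> 'rV[K]_m -> K) :
  (forall i, PS r' (g i) (fun=> r)) -> PS r f M ->
  PS r' (fun t h => f t (\row_i g i t h)) M.
Proof.
move=> gr [a [c [ac cM]]].
apply: (@PS_series nat r' (fun k t h => c k t * monomial_at (\row_i g i t h) (a k))
   (fun k t => `|c k t| * r ^+ mdeg (a k))).
- move=> k; apply: PS_scale => //.
  have P := PS_prod (fun i => PS_exp (a k i) (gr i)).
  apply: PS_ext (PS_le _ P) => [t h _|t].
    by rewrite /monomial_at; apply: eq_bigr => i _; rewrite mxE.
  by rewrite /mdeg -prodrXr.
- by move=> t; apply: abs_bound_dom (cM t).1 => k; rewrite !normrM normr_id.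
- move=> t h hr; apply: (cM t).2 => i; rewrite mxE; exact: PS_bound (gr i) hr.
Qed.

Lemma sums_cst_coef (c : nat -> K) (a : nat -> {ffun 'I_m -> nat}) (s : K) :
  sums (fun n => c n * monomial_at 0 (a n)) s ->
  sums (fun n => if mdeg (a n) == 0%N then c n else 0) s.
Proof.
apply: sums_ext => n; case: ifPn => [/eqP a0|a0].
  rewrite /monomial_at big1 ?mulr1// => i _.
  suff -> : a n i = 0%N by rewrite expr0.
  by move/eqP: a0; rewrite /mdeg sum_nat_eq0 => /forallP/(_ i)/eqP.
have [i ai] : exists i, a n i != 0%N.
  apply/existsP; rewrite -negb_forall; apply: contra a0 => /forallP a0.
  by rewrite /mdeg sum_nat_eq0; apply/forallP => i; exact: a0.
by rewrite /monomial_at (bigD1 i)//= mxE expr0n (negbTE ai) mul0r mulr0.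
Qed.

(* Subtracting the value at 0 leaves only terms of positive degree, which gain the factor [k]. *)
Lemma PS_sub0 r k f M : 0 <= r -> 0 <= k -> k <= 1 -> PS r f M ->
  PS (k * r) (fun t h => f t h - f t 0) (fun t => k * M t).
Proof.
move=> r0 k0 k1 [a [c [ac cM]]].
exists a, (fun n => if mdeg (a n) == 0%N then fun=> 0 else c n); split.
  by move=> n; case: ifP => _ //; exact: adm_cst.
move=> t; split.
  move=> F; have := (cM t).1 F; have := abs_bound_ge0 (cM t).1 => M0 h.
  apply: (@le_trans _ _ (k * \sum_(n <- F) `|c n t * r ^+ mdeg (a n)|)).
    rewrite mulr_sumr; apply: ler_sum => n _; case: ifPn => [_|d0].
      by rewrite mul0r normr0 mulr_ge0.
    rewrite exprMn mulrCA normrM ler_wpM2r// normrX ger0_norm//.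
    by rewrite -(prednK (n := mdeg _)) ?lt0n// exprS ler_piMr// exprn_ile1.
  exact: ler_wpM2l.
move=> h hr; have hr' : polydisc r h by move=> i; rewrite (le_trans (hr i))// ler_piMl.
have z0 : polydisc r (0 : 'rV[K]_m) by move=> i; rewrite mxE normr0.
have := sumsB ((cM t).2 h hr') (sums_cst_coef ((cM t).2 0 z0)).
apply: sums_ext => n; case: ifPn => [/eqP a0|_]; last by rewrite subr0.
rewrite mul0r (_ : monomial_at h (a n) = 1) ?mulr1 ?subrr// /monomial_at big1// => i _.
suff -> : a n i = 0%N by rewrite expr0.
by move/eqP: a0; rewrite /mdeg sum_nat_eq0 => /forallP/(_ i)/eqP.
Qed.

End PowerSeries.

(** * From box sums to unordered sums: the link with [analytic_at] *)

Section Exhaustion.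
Variable K : numFieldType.
Hypothesis hK : sum_complete K.

(** Under an absolute bound the sum exists, so it can be read off along any one sequence of finite
    sets that absorbs every index. Boxes and initial segments are the instances. *)
Lemma sums_exhaust (J : choiceType) (u : J -> K) M s (G : nat -> {fset J}) :
  abs_bound u M ->
  (forall j, exists N, forall n, (N <= n)%N -> j \in G n) ->
  (forall e, 0 < e -> exists N, forall n, (N <= n)%N -> `|s - \sum_(j <- G n) u j| <= e) ->
  sums u s.
Proof.
move=> uM GP Gs; have [s' us'] := hK uM; suff -> : s = s' by [].
have Gsub (F : {fset J}) : exists N, forall n, (N <= n)%N -> (F `<=` G n)%fset.
  have [N NP] := choice GP.
  exists (\max_(j <- F) N j) => n Nn; apply/fsubsetP => j jF; apply: NP.
  by apply: leq_trans Nn; rewrite (big_fsetD1 _ jF)/= leq_maxl.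
apply/eqP; rewrite -subr_eq0 -normr_eq0; apply/negPn/negP => d0.
have d4 : 0 < `|s - s'| / 4 by rewrite divr_gt0// lt_def d0 normr_ge0.
have [F0 F0P] := us' _ d4; have [N1 N1P] := Gsub F0; have [N2 N2P] := Gs _ d4.
have h1 := F0P _ (N1P _ (leq_maxl N1 N2)); have h2 := N2P _ (leq_maxr N1 N2).
move: h1; rewrite distrC => h1; have := le_trans (ler_normD _ _) (lerD h2 h1).
rewrite addrA subrK => h.
have : `|s - s'| <= `|s - s'| / 2 by apply: le_trans h _; rewrite le_eqVlt; apply/orP; left; apply/eqP; field.
rewrite ler_pdivlMr// -[leRHS]mulr1 ler_pM2l ?lt_def ?d0 ?normr_ge0//.
by rewrite (ler_nat _ 2 1).
Qed.

Lemma sums_partial (J : choiceType) (u : J -> K) s (G : nat -> {fset J}) :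
  sums u s ->
  (forall j, exists N, forall n, (N <= n)%N -> j \in G n) ->
  forall e, 0 < e -> exists N, forall n, (N <= n)%N -> `|s - \sum_(j <- G n) u j| <= e.
Proof.
move=> us GP e e0; have [F0 F0P] := us _ e0.
have [N NP] := choice GP.
exists (\max_(j <- F0) N j) => n Nn; apply: F0P; apply/fsubsetP => j jF; apply: NP.
by apply: leq_trans Nn; rewrite (big_fsetD1 _ jF)/= leq_maxl.
Qed.

Lemma abs_bound_fibres (I J : choiceType) (u : J -> K) (p : J -> I) (v : I -> K) M :
  abs_bound u M ->
  (forall i, sums (fun j => if p j == i then u j else 0) (v i)) -> abs_bound v M.
Proof.
move=> uM uv I'; pose w i := if i \in I' then `|v i| / v i else 0.
have w1 i : `|w i| <= 1.
  rewrite /w; case: ifP => _; last by rewrite normr0 ler01.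
  rewrite normrM normfV normr_id; have [->|v0] := eqVneq (v i) 0; first by rewrite normr0 mul0r ler01.
  by rewrite divff ?normr_eq0.
have wuM : abs_bound (fun j => w (p j) * u j) M.
  by apply: abs_bound_dom uM => j; rewrite normrM ler_piMl.
have [s ss] := hK wuM.
have ws : sums (fun i => w i * v i) s.
  apply: (sums_fibres (p := p)) ss => i; apply: sums_ext (sumsZ (w i) (uv i)) => j.
  by case: eqP => [->|_]; rewrite ?mulr0.
have := @sums_fin _ _ (fun i => w i * v i) I'.
move=> /(_ _)/(sums_unique ws) sE; have := sums_norm_le wuM ss.
rewrite sE; last by move=> i iI; rewrite /w (negbTE iI) mul0r.
rewrite (_ : \sum_(i <- I') w i * v i = \sum_(i <- I') `|v i|).
  by rewrite ger0_norm// sumr_ge0.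
rewrite big_seq [RHS]big_seq; apply: eq_bigr => i iI; rewrite /w iI.
by have [->|v0] := eqVneq (v i) 0; [rewrite mulr0 normr0|rewrite divfK].
Qed.

End Exhaustion.

Section Boxes.
Variables (K : numFieldType) (m : nat).

Definition box_inj N (a : {ffun 'I_m -> 'I_N}) : {ffun 'I_m -> nat} :=
  [ffun i => nat_of_ord (a i)].

Definition box N : {fset {ffun 'I_m -> nat}} := [fset x in codom (@box_inj N)]%fset.

Lemma box_sumE (F : {ffun 'I_m -> nat} -> K) N : box_sum F N = \sum_(a <- box N) F a.
Proof.
rewrite /box_sum -(big_map (@box_inj N) xpredT F).
apply: perm_big; apply: uniq_perm; rewrite ?fset_uniq//.
  rewrite map_inj_uniq ?index_enum_uniq// => a b /ffunP ab; apply/ffunP => i.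
  by have := ab i; rewrite !ffunE; exact: val_inj.
move=> a; rewrite !inE; apply/mapP/codomP => [[b _ ->]|[b ->]]; exists b => //.
by rewrite mem_index_enum.
Qed.

Lemma mem_box N (a : {ffun 'I_m -> nat}) : (forall i, (a i < N)%N) -> a \in box N.
Proof.
move=> aN; rewrite !inE; apply/codomP; exists [ffun i => Ordinal (aN i)].
by apply/ffunP => i; rewrite !ffunE.
Qed.

Lemma box_exhaust (a : {ffun 'I_m -> nat}) :
  exists N, forall n, (N <= n)%N -> a \in box n.
Proof.
exists (mdeg a).+1 => n an; apply: mem_box => i; apply: leq_trans an.
by rewrite ltnS /mdeg (bigD1 i)//= leq_addr.
Qed.

Hypothesis hK : sum_complete K.

(** Halving the radius passes from the open to the closed polydisc, and the bound that [analytic_at]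
    grants at the vector with all coordinates [r] is the majorant. *)
Lemma analytic_at_sums (f : 'rV[K]_m -> K) x : analytic_at f x ->
  exists (c : {ffun 'I_m -> nat} -> K) (r : K) M, [/\ 0 < r,
    abs_bound (fun a => c a * r ^+ mdeg a) M &
    forall h, polydisc r h -> sums (fun a => c a * monomial_at h a) (f (x + h))].
Proof.
move=> [c [r0 r0_gt0 cP]]; pose r := r0 / 2.
have r_gt0 : 0 < r by rewrite divr_gt0.
have rr0 : r < r0 by rewrite ltr_pdivrMr// ltr_pMr// ltr1n.
have [|[M cM] _] := cP (\row_i r).
  by move=> i; rewrite mxE gtr0_norm.
have bM : abs_bound (fun a => c a * r ^+ mdeg a) M.
  move=> F; have [N FN] : exists N, (F `<=` box N)%fset.
    have [N NP] := choice box_exhaust.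
    exists (\max_(j <- F) N j); apply/fsubsetP => j jF; apply: NP.
    by rewrite (big_fsetD1 _ jF)/= leq_maxl.
  apply: le_trans (cM N); rewrite box_sumE.
  rewrite [leRHS](big_fsetID _ (mem F))/= (_ : [fset x in box N | x \in F]%fset = F).
    rewrite (_ : \sum_(j <- F) _ = \sum_(a <- F) `|c a * monomial_at (\row__ r) a|) ?lerDl ?sumr_ge0//.
    apply: eq_bigr => a _; congr `|_ * _|; rewrite /monomial_at /mdeg -prodrXr.
    by apply: eq_bigr => i _; rewrite mxE.
  move: (box N) FN => B FN; apply/fsetP => j; rewrite !inE/=; apply/andP/idP; first by case.
  by move=> jF0; split => //; apply: (fsubsetP FN).
exists c, r, M; split => // h hr.
have [|_ cv] := cP h; first by move=> i; exact: le_lt_trans (hr i) rr0.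
apply: (sums_exhaust hK (M := M) _ box_exhaust).
  apply: abs_bound_dom bM => a; rewrite !normrM ler_wpM2l//.
  by rewrite (le_trans (monomial_le a hr))// ger0_norm// exprn_ge0// ltW.
move=> e e0; move/cvgrPdist_le : cv => /(_ e e0)[N _ NP]; exists N => n Nn.
by have := NP n Nn; rewrite box_sumE.
Qed.

Lemma sums_analytic_at (f : 'rV[K]_m -> K) x (c : {ffun 'I_m -> nat} -> K) (r : K) M :
  0 < r -> abs_bound (fun a => c a * r ^+ mdeg a) M ->
  (forall h, polydisc r h -> sums (fun a => c a * monomial_at h a) (f (x + h))) ->
  analytic_at f x.
Proof.
move=> r0 cM cf; exists c; exists r => // h hr.
have hr' : polydisc r h by move=> i; exact/ltW.
split.
  exists M => N; rewrite box_sumE; apply: le_trans (cM (box N)).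
  apply: ler_sum => a _; rewrite !normrM ler_wpM2l//.
  by rewrite (le_trans (monomial_le a hr'))// ger0_norm// exprn_ge0// ltW.
apply/cvgrPdist_le => e e0; have [N NP] := sums_partial (cf h hr') box_exhaust e0.
by exists N => // n Nn /=; rewrite box_sumE; exact: NP.
Qed.

End Boxes.

(** * Fixed parameters, recentring and geometric series *)

(** Over a one-point parameter space, [PS] speaks of ordinary power series. *)
Definition trivSpace (K : numFieldType) (hK : sum_complete K) : coefSpace K :=
  @CoefSpace K unit (fun=> True) (fun=> Logic.I) (fun _ _ _ _ => Logic.I) hK.

Section PowerSeriesClosure.
Variables (K : numFieldType) (X : coefSpace K) (m : nat).
Local Notation T := (csort X).

(** Terms with equal exponents are collected for one fixed [t]; nothing is claimed on how the
    collected coefficients depend on [t]. *)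
Lemma PS_reduced r (f : T -> 'rV[K]_m -> K) M t : 0 < r -> PS r f M ->
  exists c : {ffun 'I_m -> nat} -> K, abs_bound (fun a => c a * r ^+ mdeg a) (M t) /\
    forall h, polydisc r h -> sums (fun a => c a * monomial_at h a) (f t h).
Proof.
move=> r0 [a [c [_ /(_ t)[cM cf]]]].
have hK := @adm_complete _ X.
have rn n : r ^+ n != 0 by rewrite expf_neq0// gt_eqF.
(* The weight [r ^+ mdeg b] is summed together with the coefficients so that [M t] bounds the
   family; it is divided out below. *)
have /choice[d dP] : forall b, exists d,
    sums (fun n => if a n == b then c n t * r ^+ mdeg (a n) else 0) d.
  move=> b; apply: (hK _ _ (M t)); apply: abs_bound_dom cM => n.
  by case: ifP => // _; rewrite normr0.
exists (fun b => d b / r ^+ mdeg b); split.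
  by apply: (abs_bound_fibres hK cM (p := a)) => b; rewrite divfK.
move=> h hr; apply: (sums_fibres (p := a)) (cf h hr) => b.
rewrite mulrAC -mulrA mulrC; apply: sums_ext (sumsZ (monomial_at h b / r ^+ mdeg b) (dP b)) => n.
by case: eqP => [->|_]; rewrite ?mulr0// mulrCA divfK.
Qed.

Lemma PS_analytic_at r (f : T -> 'rV[K]_m -> K) M (t : T) (F : 'rV[K]_m -> K) x :
  0 < r -> PS r f M -> (forall h, polydisc r h -> F (x + h) = f t h) -> analytic_at F x.
Proof.
move=> r0 fM fF; have [c [cM cf]] := PS_reduced t r0 fM.
by apply: (sums_analytic_at r0 cM) => h hr; rewrite fF//; exact: cf.
Qed.

Lemma PS_recenter r r' (f : T -> 'rV[K]_m -> K) M (x : 'rV[K]_m) :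
  0 <= r' -> (forall i, `|x 0 i| + r' <= r) -> PS r f M ->
  PS r' (fun t h => f t (x + h)) M.
Proof.
move=> r0 xr fM.
have P i : PS r' (fun (t : T) h => x 0 i + h 0 i) (fun=> r).
  by apply: PS_le (PS_add (PS_cst X m (x 0 i) r') (PS_coord X i r0)) => t.
apply: PS_ext (PS_subst P fM) => t h _; congr (f t _).
by apply/rowP => i; rewrite !mxE.
Qed.

Lemma PS_of_analytic (f : 'rV[K]_m -> K) x : analytic_at f x ->
  exists r M, [/\ 0 < r, 0 <= M & PS r (fun (_ : T) h => f (x + h)) (fun=> M)].
Proof.
move=> /(analytic_at_sums (@adm_complete _ X))[c [r [M [r0 cM cf]]]].
exists r, M; split => //; first exact: abs_bound_ge0 cM.
apply: (@PS_intro _ _ _ _ _ _ _ id (fun a _ => c a)) => //.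
by move=> a; exact: adm_cst.
Qed.

Lemma geometric_sums (k y : K) : 0 <= k -> k < 1 -> `|y| <= k ->
  abs_bound (fun n => k ^+ n) (1 - k)^-1 /\ sums (fun n => y ^+ n) (1 - y)^-1.
Proof.
move=> k0 k1 yk.
have kb : abs_bound (fun n => k ^+ n) (1 - k)^-1.
  move=> F; have [N FN] : exists N, forall n, n \in F -> (n < N)%N.
    by exists (\max_(j <- F) j).+1 => n nF; rewrite ltnS (big_fsetD1 _ nF)/= leq_maxl.
  apply: (@le_trans _ _ (\sum_(i < N) k ^+ i)).
    rewrite (eq_bigr (fun n => k ^+ n)); last by move=> n _; rewrite ger0_norm// exprn_ge0.
    rewrite -(big_mkord xpredT (fun i => k ^+ i)) [leRHS](bigID (fun i => i \in F))/=.
    rewrite (_ : \sum_(i <- F) _ = \sum_(0 <= i < N | i \in F) k ^+ i).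
      by rewrite lerDl sumr_ge0// => i _; rewrite exprn_ge0.
    rewrite -[RHS]big_filter; apply: perm_big; apply: uniq_perm.
    - exact: fset_uniq.
    - by rewrite filter_uniq// iota_uniq.
    move=> i; rewrite mem_filter mem_index_iota/=; apply/idP/andP => [iF|[]//].
    by split=> //; exact: FN.
  have k1' : 0 < 1 - k by rewrite subr_gt0.
  rewrite -[leRHS]mul1r ler_pdivlMr// mulrC -opprB mulNr -subrX1 opprB.
  by rewrite lerBlDr lerDl exprn_ge0.
split => //.
have y1 : 1 - y != 0.
  by rewrite subr_eq0; apply: contraTneq yk => <-; rewrite normr1 lt_geF.
have yb : abs_bound (fun n => y ^+ n) (1 - k)^-1.
  apply: abs_bound_dom kb => n; rewrite !normrX (ger0_norm k0).
  by apply: lerXn2r; rewrite ?nnegrE.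
have [s ss] := @adm_complete _ X _ _ _ yb.
suff -> : (1 - y)^-1 = s by [].
(* A shift of the index yields [s = 1 + y * s], which identifies the sum. *)
have h1 : sums (fun n => if n == 0%N then 0 else y ^+ n) (y * s).
  apply: (@sums_inj _ _ _ S) => [i j []//|[|n]|]; rewrite ?eqxx//.
    by move=> _; exists n.
  by apply: sums_ext (sumsZ y ss) => n; rewrite /= exprS.
pose d (n : nat) := if n == 0%N then 1 : K else 0.
have h2 : sums d 1.
  have -> : 1 = \sum_(n <- [fset 0%N]%fset) d n by rewrite big_seq_fset1.
  by apply: sums_fin => n; rewrite inE /d => /negbTE ->.
have h3 : sums (fun n => y ^+ n) (1 + y * s).
  apply: sums_ext (sumsD h2 h1) => -[|n] /=; first by rewrite expr0 addr0.
  by rewrite add0r.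
have E := sums_unique ss h3.
apply: (mulfI y1); rewrite mulfV// mulrBl mul1r {1}E addrK//.
Qed.

Lemma PS_inv1m r k (g : T -> 'rV[K]_m -> K) : 0 <= k -> k < 1 ->
  PS r g (fun=> k) -> PS r (fun t h => (1 - g t h)^-1) (fun=> (1 - k)^-1).
Proof.
move=> k0 k1 gk.
apply: (@PS_series _ _ _ nat r (fun n t h => g t h ^+ n) (fun n _ => k ^+ n)).
- by move=> n; exact: PS_exp gk.
- by move=> t; apply: (@geometric_sums k k _ _ _).1 => //; rewrite ger0_norm.
- by move=> t h hr; apply: (geometric_sums k0 k1 _).2; exact: PS_bound gk hr.
Qed.

Lemma PS_inv1p r k (g : T -> 'rV[K]_m -> K) : 0 <= k -> k < 1 ->
  PS r g (fun=> k) -> PS r (fun t h => (1 + g t h)^-1) (fun=> (1 - k)^-1).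
Proof.
move=> k0 k1 /PS_opp gk.
by apply: PS_ext (PS_inv1m k0 k1 gk) => t h _; rewrite opprK.
Qed.

End PowerSeriesClosure.

(** * Cauchy estimates by averages over roots of unity *)

Section Cauchy.
Variable K : numClosedFieldType.
Hypothesis hK : sum_complete K.

Lemma primitive_root_exists N : (0 < N)%N -> exists w : K, N.-primitive_root w.
Proof.
move=> N0; have [r rE] := closed_field_poly_normal ('X^N - 1 : {poly K}).
rewrite (monicP _) ?monicXnsubC// scale1r in rE.
have rN1 : all N.-unity_root r by apply/allP => z; rewrite -root_prod_XsubC -rE.
have szr : (N < (size r).+1)%N.
  by rewrite -(size_prod_XsubC r id) -rE size_XnsubC.
have [|z zP zr] := hasP (cyclic.has_prim_root N0 rN1 _ szr); last by exists z.
by rewrite -separable_prod_XsubC -rE separable_Xn_sub_1// pnatr_eq0 -lt0n.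
Qed.

Lemma norm_primitive_root N (w : K) : (0 < N)%N -> N.-primitive_root w -> `|w| = 1.
Proof.
move=> N0 /prim_expr_order wN; apply/eqP; rewrite -(@pexpr_eq1 _ _ N)//.
by rewrite -normrX wN normr1.
Qed.

Lemma root_orthogonality N (w : K) a b : N.-primitive_root w -> (a < N)%N -> (b < N)%N ->
  \sum_(j < N) w ^+ (j * a) * w ^- (j * b) = if a == b then N%:R else 0.
Proof.
move=> wP aN bN; have N0 := prim_order_gt0 wP.
have w0 : w != 0 by rewrite -normr_eq0 (norm_primitive_root N0 wP) oner_eq0.
have -> : \sum_(j < N) w ^+ (j * a) * w ^- (j * b) = \sum_(j < N) (w ^+ a / w ^+ b) ^+ j.
  by apply: eq_bigr => j _; rewrite expr_div_n -!exprM ![(_ * j)%N]mulnC.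
have [->|ab] := eqVneq a b.
  rewrite divff ?expf_neq0//; under eq_bigr do rewrite expr1n.
  by rewrite sumr_const card_ord.
set q := w ^+ a / w ^+ b.
have q1 : q - 1 != 0.
  rewrite subr_eq0; apply: contra ab => /eqP q1.
  have : w ^+ a == w ^+ b by rewrite -(divfK (expf_neq0 b w0) (w ^+ a)) -/q q1 mul1r.
  by rewrite (eq_prim_root_expr wP) !modn_small.
apply: (mulfI q1); rewrite -subrX1 mulr0 /q expr_div_n -!exprM ![(_ * N)%N]mulnC !exprM.
by rewrite (prim_expr_order wP) !expr1n divr1 subrr.
Qed.

(** Averaging over the [N]-th roots of unity isolates one coefficient of a polynomial with [N]
    terms; this finite Fourier inversion replaces the Cauchy integral. *)
Lemma poly_cauchy N (d : nat -> K) (r B : K) k : (k < N)%N -> 0 < r ->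
  (forall t, `|t| = r -> `|\sum_(n < N) d n * t ^+ n| <= B) -> `|d k| * r ^+ k <= B.
Proof.
move=> kN r0 dB; have N0 : (0 < N)%N by apply: leq_ltn_trans kN.
have [w wP] := primitive_root_exists N0.
have w1 := norm_primitive_root N0 wP.
have E : d k * r ^+ k * N%:R = \sum_(j < N) (\sum_(n < N) d n * (r * w ^+ j) ^+ n) * w ^- (j * k).
  transitivity (\sum_(n < N) d n * r ^+ n * (if nat_of_ord n == k then N%:R else 0)).
    rewrite (bigD1 (Ordinal kN))//= eqxx big1 ?addr0// => i ik.
    by rewrite (_ : nat_of_ord i == k = false) ?mulr0//; apply: contraNF ik => /eqP ik; exact/eqP/val_inj.
  under eq_bigr => n _ do rewrite -(root_orthogonality wP (ltn_ord n) kN) mulr_sumr.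
  rewrite exchange_big; apply: eq_bigr => j _; rewrite mulr_suml; apply: eq_bigr => n _.
  by rewrite exprMn -exprM !mulrA.
have NK : 0 < N%:R :> K by rewrite ltr0n.
rewrite -(ler_pM2r NK) -[X in _ * X](ger0_norm (ltW NK)) -[X in _ * X * _](ger0_norm (exprn_ge0 k (ltW r0))).
rewrite -!normrM E (le_trans (ler_norm_sum _ _ _))//.
apply: (@le_trans _ _ (\sum_(j < N) B)); last by rewrite sumr_const card_ord mulr_natr.
apply: ler_sum => j _; rewrite normrM normfV normrX w1 expr1n invr1 mulr1.
by apply: dB; rewrite normrM normrX w1 expr1n mulr1 gtr0_norm.
Qed.

(** The same average, taken in every variable. *)
Lemma torus_cauchy m N (c : {ffun 'I_m -> 'I_N} -> K) (B : K) b :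
  (forall u : 'rV[K]_m, (forall i, `|u 0 i| = 1) ->
     `|\sum_a c a * \prod_i u 0 i ^+ a i| <= B) -> `|c b| <= B.
Proof.
(* Positivity of [N] is drawn from an entry of [b], so the case without variables stands apart. *)
move=> cB; have [m0|m0] := posnP m.
  have u : 'rV[K]_m := 0.
  have := cB 0; rewrite (bigD1 b)//= [X in _ + X]big1 ?addr0.
    rewrite big1 ?mulr1; first by apply=> i; move: (ltn_ord i); rewrite {2}m0.
    by move=> i _; move: (ltn_ord i); rewrite {2}m0.
  move=> a /eqP ab; exfalso; apply: ab; apply/ffunP => i.
  by move: (ltn_ord i); rewrite {2}m0.
have N0 : (0 < N)%N by apply: leq_ltn_trans (ltn_ord (b (Ordinal m0))).
have [w wP] := primitive_root_exists N0.
have w1 := norm_primitive_root N0 wP.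
pose u (f : {ffun 'I_m -> 'I_N}) := \row_i w ^+ f i.
have E : c b * N%:R ^+ m =
    \sum_(f : {ffun 'I_m -> 'I_N}) (\sum_a c a * \prod_i u f 0 i ^+ a i) * \prod_i w ^- (f i * b i).
  transitivity (\sum_a c a * \prod_(i < m) (if nat_of_ord (a i) == b i then N%:R else 0 : K)).
    rewrite (bigD1 b)//= [X in _ + X]big1 ?addr0.
      by under eq_bigr do rewrite eqxx; rewrite prodr_const card_ord.
    move=> a ab; have [i ai] : exists i, a i != b i.
      by apply/existsP; rewrite -negb_forall; apply: contra ab => /forallP ab; apply/eqP/ffunP => i; exact/eqP.
    by rewrite (bigD1 i)//= (negbTE (ai : nat_of_ord _ != _)) mul0r mulr0.
  under eq_bigr => a _ do [under eq_bigr => i _ do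
    rewrite -(root_orthogonality wP (ltn_ord (a i)) (ltn_ord (b i))); rewrite bigA_distr_bigA mulr_sumr].
  rewrite exchange_big; apply: eq_bigr => f _; rewrite mulr_suml; apply: eq_bigr => a _.
  rewrite -mulrA -big_split/=; congr (_ * _); apply: eq_bigr => i _.
  by rewrite mxE -exprM.
have NK : 0 < N%:R ^+ m :> K by rewrite exprn_gt0// ltr0n.
rewrite -(ler_pM2r NK) -[X in _ * X](ger0_norm (ltW NK)) -normrM E (le_trans (ler_norm_sum _ _ _))//.
apply: (@le_trans _ _ (\sum_(f : {ffun 'I_m -> 'I_N}) B)).
  apply: ler_sum => f _; rewrite normrM (_ : `|\prod_i _| = 1) ?mulr1.
    by apply: cB => i; rewrite mxE normrX w1 expr1n.
  rewrite normr_prod big1// => i _.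
  by rewrite normfV normrX w1 expr1n invr1.
by rewrite sumr_const card_ffun !card_ord -[leLHS]mulr_natr natrX.
Qed.

Lemma tail_bound (J : choiceType) (u : J -> K) M e : abs_bound u M -> 0 < e ->
  exists F0 : {fset J}, abs_bound (fun j => if j \in F0 then 0 else u j) e.
Proof.
move=> uM e0; have uM' : abs_bound (fun j => `|u j|) M by apply: abs_bound_dom uM => j; rewrite normr_id.
have [s ss] := hK uM'; have e2 : 0 < e / 2 by rewrite divr_gt0.
have [F0 F0P] := ss _ e2; exists F0 => F.
have h1 := F0P _ (fsubset_refl F0); have h2 := F0P _ (fsubsetUl F0 F).
pose S G := \sum_(j <- G : {fset J}) `|u j|.
have : `| - S F0 + S (F0 `|` F)%fset | <= e.
  rewrite distrC in h2; rewrite [leRHS](splitr e).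
  apply: le_trans (lerD h1 h2); rewrite -/(S _) -/(S (_ `|` _)%fset).
  rewrite (_ : - S F0 + S (F0 `|` F)%fset = s - S F0 + (S (F0 `|` F)%fset - s)); last by ring.
  exact: ler_normD.
rewrite /S.
rewrite (big_fsetID _ (mem F0) (F0 `|` F)%fset)/=.
rewrite (_ : [fset x in (F0 `|` F)%fset | x \in F0]%fset = F0); last first.
  by apply/fsetP => j; rewrite !inE/=; case: (j \in F0); rewrite ?andbF ?andbT.
rewrite addKr => h; apply: le_trans (le_trans (real_ler_norm _) h); last first.
  by rewrite realE sumr_ge0.
rewrite [leRHS](_ : _ = \sum_(x <- [fset x in (F0 `|` F)%fset | x \notin F0]%fset) `|if x \in F0 then 0 else u x|); last first.
  by rewrite big_seq [RHS]big_seq; apply: eq_bigr => j; rewrite !inE => /andP[_ /negbTE ->].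
rewrite (big_fsetID _ (mem F0) F)/= big1_seq ?add0r; last first.
  by move=> j; rewrite !inE /= => /andP[_ ->]; rewrite normr0.
rewrite (_ : [fset x in (F0 `|` F)%fset | x \notin F0]%fset = [fset x in F | x \notin F0]%fset)//.
by apply/fsetP => j; rewrite !inE/=; case: (j \in F0); rewrite ?andbF ?andbT.
Qed.

(** A tail of norm [e] is cut off, and [poly_cauchy] applies to the remaining polynomial with the
    bound [B + e]. *)
Lemma cauchy_estimate (d : nat -> K) (r L B : K) k : 0 < r ->
  abs_bound (fun n => d n * r ^+ n) L ->
  (forall t s, `|t| = r -> sums (fun n => d n * t ^+ n) s -> `|s| <= B) ->
  `|d k| * r ^+ k <= B.
Proof.
move=> r0 dL dB; apply/ler_addgt0Pr => e e0.
have [F0 F0P] := tail_bound dL e0.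
have [N [kN FN]] : exists N, (k < N)%N /\ forall n, n \in F0 -> (n < N)%N.
  exists (maxn k (\max_(n <- F0) n)).+1; split; first by rewrite ltnS leq_maxl.
  by move=> n nF; rewrite ltnS leq_max (big_fsetD1 _ nF)/= leq_maxl orbT.
apply: (@poly_cauchy N) => //.
move=> t tr; have dt : abs_bound (fun n => d n * t ^+ n) L.
  by apply: abs_bound_dom dL => n; rewrite !normrM !normrX tr (gtr0_norm r0).
have [s ss] := hK dt.
pose v n := if (n < N)%N then 0 else d n * t ^+ n.
have vb : abs_bound v e.
  apply: abs_bound_dom F0P => n; rewrite /v; case: ltnP => nN; first by rewrite normr0.
  case: ifPn => nF; last by rewrite !normrM !normrX tr (gtr0_norm r0).
  by move: nN; rewrite leqNgt FN.
pose F := [fset n in iota 0 N]%fset.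
pose w n := if (n < N)%N then d n * t ^+ n else 0.
have ws : sums w (\sum_(n < N) d n * t ^+ n).
  rewrite (_ : \sum_(n < N) _ = \sum_(n <- F) w n).
    by apply: sums_fin => n; rewrite /w !inE mem_iota leq0n /= => /negbTE ->.
  rewrite -(big_mkord xpredT (fun n => d n * t ^+ n)).
  rewrite big_nat_cond [RHS](_ : _ = \sum_(0 <= n < N) w n).
    by rewrite [RHS]big_nat_cond; apply: eq_bigr => n /andP[/andP[_ nN] _]; rewrite /w nN.
  apply: perm_big; apply: uniq_perm; rewrite ?fset_uniq ?iota_uniq// => n.
  by rewrite !inE mem_index_iota mem_iota.
have vs : sums v (s - \sum_(n < N) d n * t ^+ n).
  by apply: sums_ext (sumsB ss ws) => n; rewrite /v /w; case: ifP; rewrite ?subrr ?subr0.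
have := sums_norm_le vb vs; rewrite distrC => h.
rewrite -[X in `|X|](subrK s) (le_trans (ler_normD _ _))// addrC lerD//.
exact: dB tr ss.
Qed.

End Cauchy.

(** * Enlarging the disc of convergence in one variable *)

Section NatFamilies.
Variable K : numFieldType.
Implicit Types u : nat -> K.

Lemma sum_ord_fset u N : \sum_(k < N) u k = \sum_(k <- [fset k in iota 0 N]%fset) u k.
Proof.
rewrite -(big_mkord xpredT u); apply: perm_big; apply: uniq_perm; rewrite ?fset_uniq ?iota_uniq// => n.
by rewrite !inE mem_index_iota mem_iota.
Qed.

Lemma sums_nat_fin u N : (forall k, (N <= k)%N -> u k = 0) -> sums u (\sum_(k < N) u k).
Proof.
move=> u0; rewrite sum_ord_fset; apply: sums_fin => k.
by rewrite !inE mem_iota leq0n add0n /= -leqNgt => /u0.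
Qed.

Lemma abs_bound_nat_fin u N : (forall k, (N <= k)%N -> u k = 0) ->
  abs_bound u (\sum_(k < N) `|u k|).
Proof.
move=> u0 F; rewrite (sum_ord_fset (fun k => `|u k|)).
pose G := [fset k in iota 0 N]%fset; rewrite -/G.
apply: (@le_trans _ _ (\sum_(k <- (F `|` G)%fset) `|u k|)).
  rewrite [leRHS](big_fsetID _ (mem F))/= (_ : [fset x in (F `|` G)%fset | x \in F]%fset = F).
    by rewrite lerDl sumr_ge0.
  by apply/fsetP => j; rewrite !inE/=; case: (j \in F); rewrite ?andbF ?andbT.
rewrite -(@big_fset_incl _ _ _ _ G (F `|` G)%fset)//; first exact: fsubsetUr.
move=> k _; rewrite !inE mem_iota leq0n add0n /= -leqNgt => /u0 ->.
by rewrite normr0.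
Qed.

End NatFamilies.

Section Extension.
Variable K : numClosedFieldType.
Hypothesis hK : sum_complete K.

(** Re-expansion around [w]: the pair [(n, k)] gives the contribution of [d n] to the new
    coefficient of degree [k]. *)
Definition retaylor (d : nat -> K) (w : K) (x : nat * nat) : K :=
  d x.1 * (w ^+ (x.1 - x.2) *+ 'C(x.1, x.2)).

Lemma retaylorE d w i k :
  retaylor d w ((i + k)%N, k) = d (i + k)%N * 'C(i + k, k)%:R * w ^+ i.
Proof. by rewrite /retaylor/= addnK mulrnAr -mulrA mulr_natl mulrnAr. Qed.

Lemma retaylor_sums d w t n :
  sums (fun k => retaylor d w (n, k) * t ^+ k) (d n * (w + t) ^+ n).
Proof.
have u0 k : (n.+1 <= k)%N -> retaylor d w (n, k) * t ^+ k = 0.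
  by move=> nk; rewrite /retaylor/= bin_small// mulr0n mulr0 mul0r.
rewrite (_ : _ * _ = \sum_(k < n.+1) retaylor d w (n, k : nat) * t ^+ k); first exact: sums_nat_fin u0.
rewrite exprDn mulr_sumr; apply: eq_bigr => k _.
by rewrite /retaylor/= !mulrnAr mulrnAl mulrA.
Qed.

Lemma retaylor_abs d w t n :
  abs_bound (fun k => retaylor d w (n, k) * t ^+ k) (`|d n| * (`|w| + `|t|) ^+ n).
Proof.
have u0 k : (n.+1 <= k)%N -> retaylor d w (n, k) * t ^+ k = 0.
  by move=> nk; rewrite /retaylor/= bin_small// mulr0n mulr0 mul0r.
apply: abs_bound_le (abs_bound_nat_fin u0).
rewrite exprDn mulr_sumr; apply: ler_sum => k _.
by rewrite /retaylor/= !normrM normrMn !normrX !mulrnAr mulrnAl mulrA.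
Qed.

Lemma retaylor_pair (d : nat -> K) rho L w t : abs_bound (fun n => d n * rho ^+ n) L ->
  `|w| + `|t| <= rho -> abs_bound (fun x => retaylor d w x * t ^+ x.2) L.
Proof.
move=> dL wt; apply: abs_bound_pair (abs_bound_dom _ dL) => [n|n]; first exact: retaylor_abs.
have wt0 : 0 <= (`|w| + `|t|) ^+ n by rewrite exprn_ge0 ?addr_ge0.
rewrite normrM normr_id (ger0_norm wt0) normrM ler_wpM2l//.
by rewrite normrX; apply: lerXn2r; rewrite ?nnegrE ?addr_ge0// ger0_norm// (le_trans _ wt) ?addr_ge0.
Qed.

Lemma retaylor_coef_abs (d : nat -> K) rho L w tau k : abs_bound (fun n => d n * rho ^+ n) L ->
  `|w| + tau <= rho -> 0 < tau -> abs_bound (fun n => retaylor d w (n, k)) (L / tau ^+ k).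
Proof.
move=> dL wt t0; have wt' : `|w| + `|tau| <= rho by rewrite (gtr0_norm t0).
have kI : injective (fun n : nat => (n, k)) by move=> i j [].
have P := abs_bound_inj kI (retaylor_pair dL wt').
move=> F; rewrite ler_pdivlMr ?exprn_gt0// mulr_suml; apply: le_trans (P F).
by apply: ler_sum => n _ /=; rewrite [leRHS]normrM [X in _ <= _ * X]ger0_norm// exprn_ge0// ltW.
Qed.

Lemma resum (d : nat -> K) rho L w t g s : abs_bound (fun n => d n * rho ^+ n) L ->
  `|w| + `|t| <= rho -> (forall k, sums (fun n => retaylor d w (n, k)) (g k)) ->
  sums (fun n => d n * (w + t) ^+ n) s -> sums (fun k => g k * t ^+ k) s.
Proof.
move=> dL wt gP ds; have P := retaylor_pair dL wt.
have S : sums (fun x => retaylor d w x * t ^+ x.2) s.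
  by apply: (sums_pair hK P) ds => n; exact: retaylor_sums.
apply: (sums_fibres (p := snd)) S => k.
apply: (@sums_inj _ _ _ (fun n : nat => (n, k))).
- by move=> i j [].
- by move=> [n k']/=; case: (eqVneq k' k) => [->|_]; [exists n|rewrite eqxx].
- by rewrite mulrC; apply: sums_ext (sumsZ (t ^+ k) (gP k)) => n; rewrite /= eqxx mulrC.
Qed.

(** The difference of the two series sums to 0 on a circle, so Cauchy's estimate holds with the
    bound 0. *)
Lemma series_uniq (d e : nat -> K) tau L L' (psi : K -> K) : 0 < tau ->
  abs_bound (fun n => d n * tau ^+ n) L -> abs_bound (fun n => e n * tau ^+ n) L' ->
  (forall t, `|t| <= tau -> sums (fun n => d n * t ^+ n) (psi t)) ->
  (forall t, `|t| <= tau -> sums (fun n => e n * t ^+ n) (psi t)) -> d =1 e.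
Proof.
move=> t0 dL eL dP eP k.
have bL : abs_bound (fun n => (d n - e n) * tau ^+ n) (L + L').
  move=> F; apply: le_trans (lerD (dL F) (eL F)); rewrite -big_split/=.
  by apply: ler_sum => n _; rewrite mulrBl ler_normB.
have h t s : `|t| = tau -> sums (fun n => (d n - e n) * t ^+ n) s -> `|s| <= 0.
  move=> tt ss; have tt' : `|t| <= tau by rewrite tt.
  have := sumsB (dP t tt') (eP t tt'); rewrite subrr => z.
  rewrite (sums_unique ss (sums_ext _ z)) ?normr0// => n; by rewrite mulrBl.
have := cauchy_estimate hK k t0 bL h.
by rewrite pmulr_lle0 ?exprn_gt0// normr_le0 subr_eq0 => /eqP.
Qed.

Variables (phi : K -> K) (s eta M : K).
Hypothesis eta0 : 0 < eta.
Hypothesis loc : forall w, `|w| <= s -> exists e, abs_bound (fun n => e n * eta ^+ n) M /\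
  forall t, `|t| <= eta -> sums (fun n => e n * t ^+ n) (phi (w + t)).

Definition good (d : nat -> K) rho := (exists L, abs_bound (fun n => d n * rho ^+ n) L) /\
  forall t, `|t| <= rho -> sums (fun n => d n * t ^+ n) (phi t).

Lemma good_le d rho rho' : 0 <= rho -> rho <= rho' -> good d rho' -> good d rho.
Proof.
move=> r0 rr [[L dL] dP]; split; last by move=> t tr; apply: dP; exact: le_trans rr.
exists L; apply: abs_bound_dom dL => n; rewrite !normrM ler_wpM2l// !normrX.
by apply: lerXn2r; rewrite ?nnegrE// !ger0_norm// (le_trans r0).
Qed.

(** The re-expansion at [w] is at first known to converge on radius [eta / 4] only. By uniqueness it
    is the local expansion granted by [loc], hence has radius [eta] and the uniform bound [M]. *)
Lemma good_retaylor d rho w : good d rho -> eta <= rho -> rho <= s ->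
  `|w| + eta / 4 <= rho ->
  exists g, [/\ forall k, sums (fun n => retaylor d w (n, k)) (g k),
    abs_bound (fun n => g n * eta ^+ n) M &
    forall t, `|t| <= eta -> sums (fun n => g n * t ^+ n) (phi (w + t))].
Proof.
move=> [[L dL] dP] er rs wr; have e4 : 0 < eta / 4 by rewrite divr_gt0.
have /choice[g gP] : forall k, exists g, sums (fun n => retaylor d w (n, k)) g.
  by move=> k; apply: (hK (retaylor_coef_abs _ dL wr e4)).
have ws : `|w| <= s by rewrite (le_trans _ rs)// (le_trans _ wr)// lerDl ltW.
have [e [eM eP]] := loc ws.
have ge : g =1 e.
  apply: (@series_uniq g e (eta / 4) L M (fun t => phi (w + t))) => //.
  - apply: (abs_bound_fibres hK (retaylor_pair (w := w) (t := eta / 4) dL _) (p := snd)).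
      by rewrite (gtr0_norm e4).
    move=> k; apply: (@sums_inj _ _ _ (fun n : nat => (n, k))).
    + by move=> i j [].
    + by move=> [n k']/=; case: (eqVneq k' k) => [->|_]; [exists n|rewrite eqxx].
    + by rewrite [g k * _]mulrC; apply: sums_ext (sumsZ ((eta / 4) ^+ k) (gP k)) => n; rewrite /= eqxx mulrC.
  - apply: abs_bound_dom eM => n; rewrite !normrM ler_wpM2l// !normrX.
    apply: lerXn2r; rewrite ?nnegrE// (gtr0_norm e4) (gtr0_norm eta0).
    by rewrite ler_pdivrMr// ler_peMr ?ler1n// ltW.
  - move=> t te; apply: (resum dL _ gP); first by rewrite (le_trans _ wr)// lerD2l.
    by apply: dP; rewrite (le_trans (ler_normD _ _))// (le_trans _ wr)// lerD2l.
  - move=> t te; apply: eP; rewrite (le_trans te)//.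
    by rewrite ler_pdivrMr// ler_peMr ?ler1n// ltW.
exists g; split => //.
  by apply: abs_bound_dom eM => n; rewrite ge.
by move=> t te; apply: sums_ext (eP t te) => n; rewrite ge.
Qed.

(** The [k]-th re-expansion coefficient is itself a power series in the centre [w], bounded by
    [M / eta ^+ k] on the circle of radius [rho - eta / 4]. Cauchy's estimate for that series bounds
    [d n]. *)
Lemma good_coef d rho n k : good d rho -> eta <= rho -> rho <= s -> (k <= n)%N ->
  `|d n| * 'C(n, k)%:R * (rho - eta / 4) ^+ (n - k) * eta ^+ k <= M.
Proof.
move=> gd er rs kn; have [[L dL] _] := gd.
have e4 : 0 < eta / 4 by rewrite divr_gt0.
have r1 : 0 < rho - eta / 4.
  rewrite subr_gt0; apply: lt_le_trans er; rewrite ltr_pdivrMr// ltr_pMr// (ltr_nat _ 1)//.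
have [r [rE rl]] : exists r, r = rho - eta / 4 /\ `|r| + eta / 4 <= rho.
  by exists (rho - eta / 4); rewrite gtr0_norm// subrK.
rewrite -rE in r1 *.
have ek : 0 < eta ^+ k by rewrite exprn_gt0.
rewrite -ler_pdivlMr//.
have dk : abs_bound (fun i => d (i + k)%N * 'C(i + k, k)%:R * r ^+ i) (L / (eta / 4) ^+ k).
  have := abs_bound_inj (@addIn k) (retaylor_coef_abs k dL rl e4).
  by apply: abs_bound_dom => i; rewrite /comp retaylorE.
have := cauchy_estimate hK (n - k) r1 dk (B := M / eta ^+ k).
rewrite (subnK kn) normrM normr_nat; apply => t s' tr ss.
have [|g [gP gM _]] := good_retaylor gd er rs (w := t); first by rewrite tr -(gtr0_norm r1).
have := abs_bound_term k gM; rewrite normrM normrX (gtr0_norm eta0) -ler_pdivlMr//.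
suff -> : s' = g k by [].
apply: sums_unique _ (gP k); apply: (@sums_inj _ _ _ (fun i => (i + k)%N)).
- exact: addIn.
- move=> j; have [jk|jk] := leqP k j; first by exists (j - k)%N; rewrite subnK.
  by rewrite /retaylor/= bin_small// mulr0n mulr0 eqxx.
- by apply: sums_ext ss => i; rewrite /comp retaylorE.
Qed.

(** Summing [good_coef] over [k] against [2 ^- k], the binomial formula bounds
    [|d n| * (rho + eta / 4) ^+ n] by [2 * M], whence absolute convergence at [rho + eta / 8]. The
    gain does not depend on [rho], so finitely many steps reach [s]. *)
Lemma good_step d rho : good d rho -> eta <= rho -> rho <= s -> good d (rho + eta / 8).
Proof.
move=> gd er rs; have [[L dL] dP] := gd.
have r0 : 0 < rho by exact: lt_le_trans er.
have e4 : 0 < eta / 4 by rewrite divr_gt0.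
have r1 : 0 < rho - eta / 4.
  by rewrite subr_gt0; apply: lt_le_trans er; rewrite ltr_pdivrMr// ltr_pMr// (ltr_nat _ 1).
have rE : rho - eta / 4 + eta / 2 = rho + eta / 4 by field.
have d2 n : `|d n| * (rho + eta / 4) ^+ n <= M * 2.
  rewrite -rE exprDn mulr_sumr.
  apply: (@le_trans _ _ (\sum_(k < n.+1) M * 2^-1 ^+ k)).
    apply: ler_sum => k _; have kn : (k <= n)%N by rewrite -ltnS.
    have := good_coef gd er rs kn => h.
    rewrite exprVn expr_div_n -[_ *+ 'C(n, k)]mulr_natr.
    have -> : `|d n| * ((rho - eta / 4) ^+ (n - k) * (eta ^+ k / 2 ^+ k) * 'C(n, k)%:R) =
      (`|d n| * 'C(n, k)%:R * (rho - eta / 4) ^+ (n - k) * eta ^+ k) / 2 ^+ k by ring.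
    by rewrite ler_wpM2r// invr_ge0 exprn_ge0.
  rewrite -mulr_sumr ler_wpM2l//.
    have [|e [eM _]] := loc (w := 0); last exact: abs_bound_ge0 eM.
    by rewrite normr0 (le_trans _ rs)// ltW.
  rewrite -(ler_pM2r (x := 2^-1)) ?invr_gt0// mulfV ?pnatr_eq0//.
  have := subrX1 (2^-1 : K) n.+1.
  have -> : 2^-1 - 1 = - 2^-1 :> K by field.
  rewrite mulNr => /(congr1 -%R); rewrite opprK mulrC => <-.
  by rewrite opprB gerBl exprn_ge0// invr_ge0.
have rq : 0 < rho + eta / 4 by rewrite addr_gt0.
have M2 : 0 <= M * 2 by apply: le_trans (d2 0%N); rewrite mulr_ge0// exprn_ge0// ltW.
pose q := (rho + eta / 8) / (rho + eta / 4).
have q0 : 0 <= q by rewrite divr_ge0 ?addr_ge0 ?ltW// ?divr_gt0.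
have q1 : q < 1.
  by rewrite ltr_pdivrMr// mul1r ltrD2l ltr_pM2l// ltf_pV2 ?posrE// ltr_nat.
have dq : abs_bound (fun n => d n * (rho + eta / 8) ^+ n) (M * 2 * (1 - q)^-1).
  have qn : `|q| <= q by rewrite ger0_norm.
  have [gb _] := geometric_sums (trivSpace hK) q0 q1 qn.
  move=> F; apply: (@le_trans _ _ (\sum_(n <- F) M * 2 * `|q ^+ n|)).
    apply: ler_sum => n _.
    have x0 : 0 <= (rho + eta / 8) ^+ n by rewrite exprn_ge0// addr_ge0 ?ltW// divr_gt0.
    have qn0 : 0 <= q ^+ n by rewrite exprn_ge0.
    rewrite normrM (ger0_norm x0) (ger0_norm qn0) /q expr_div_n.
    rewrite mulrA ler_pdivlMr ?exprn_gt0// mulrAC ler_wpM2r// exprn_ge0// addr_ge0 ?ltW// divr_gt0//.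
  by rewrite -mulr_sumr ler_wpM2l.
split; first by eexists; exact: dq.
move=> z zr.
have [zr1|zr1] := real_leP (normr_real z) (gtr0_real r1).
  by apply: dP; rewrite (le_trans zr1)// gerBl ltW.
have z0 : 0 < `|z| by exact: lt_trans zr1.
(* The point of modulus [rho - eta / 4] on the ray through [z]. It is at distance at most
   [3 / 8 * eta] from [z], so the expansion of [phi] at [w] reaches [z]. *)
pose w := z * ((rho - eta / 4) / `|z|).
have wn : `|w| = rho - eta / 4.
  have w0 : 0 <= (rho - eta / 4) / `|z| by rewrite divr_ge0 ?ltW.
  by rewrite /w normrM (ger0_norm w0) mulrC divfK// gt_eqF.
have tn : `|z - w| = `|z| - (rho - eta / 4).
  have -> : z - w = z * (1 - (rho - eta / 4) / `|z|) by rewrite /w; ring.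
  have w0 : 0 <= 1 - (rho - eta / 4) / `|z| by rewrite subr_ge0 ler_pdivrMr// mul1r ltW.
  rewrite normrM (ger0_norm w0).
  by rewrite mulrBr mulr1 mulrC divfK// gt_eqF.
have [|g [gP gM gs]] := good_retaylor gd er rs (w := w); first by rewrite wn subrK.
have re8 : 0 <= rho + eta / 8 by rewrite addr_ge0 ?ltW// divr_gt0.
have [S dS] : exists S, sums (fun n => d n * z ^+ n) S.
  apply: (hK (M := M * 2 * (1 - q)^-1)); apply: abs_bound_dom dq => n.
  rewrite !normrM ler_wpM2l// !normrX.
  by apply: lerXn2r; rewrite ?nnegrE// (ger0_norm re8).
have wz : w + (z - w) = z by rewrite addrC subrK.
have gS : sums (fun k => g k * (z - w) ^+ k) S.
  apply: (resum dq _ gP); last by rewrite wz.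
  by rewrite wn tn addrC subrK.
rewrite -wz -(sums_unique gS (gs (z - w) _)); first by rewrite wz.
rewrite tn lerBlDr (le_trans zr)// -subr_ge0.
rewrite (_ : _ - _ = eta * (5 / 8)); last by field.
by rewrite mulr_ge0 ?ltW// divr_gt0.
Qed.

Lemma good_all d : good d eta -> eta <= s -> (exists k : nat, s <= eta + eta / 8 * k%:R) -> good d s.
Proof.
move=> gd es [k sk]; have s0 : 0 <= s by rewrite (le_trans _ es)// ltW.
suff H j rho : 0 <= rho -> rho <= s -> rho <= eta + eta / 8 * j%:R -> good d rho by exact: (H k).
elim: j rho => [|j IH] rho r0 rs.
  by rewrite mulr0 addr0 => re; exact: good_le gd.
pose rho0 := eta + eta / 8 * j%:R.
have e8 : 0 <= eta / 8 by rewrite divr_ge0 ?ltW.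
have r00 : 0 <= rho0 by rewrite addr_ge0 ?(ltW eta0)// mulr_ge0.
move=> rj; have [r1|r1] := real_leP (ger0_real r0) (ger0_real r00); first exact: IH.
have rs0 : rho0 <= s by rewrite (le_trans (ltW r1)).
apply: good_le r0 _ (good_step (IH _ r00 rs0 (lexx _)) _ rs0).
  by rewrite (le_trans rj)// /rho0 -addrA lerD2l -[j.+1%:R]natr1 mulrDr mulr1.
by rewrite /rho0 lerDl mulr_ge0.
Qed.

Lemma good_cauchy d B k : 0 < s -> good d s -> (forall t, `|t| <= s -> `|phi t| <= B) ->
  `|d k| * s ^+ k <= B.
Proof.
move=> s0 [[L dL] dP] fB; apply: (cauchy_estimate hK k s0 dL) => t S ts dS.
have ts' : `|t| <= s by rewrite ts.
by rewrite (sums_unique dS (dP t ts')); exact: fB.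
Qed.

End Extension.

(** * Multi-index geometric series and restriction to complex lines *)

Section MultiGeometric.
Variables (K : numFieldType) (m : nat).

Lemma fset_sub_box (F : {fset {ffun 'I_m -> nat}}) : exists N, (F `<=` box m N)%fset.
Proof.
have [N NP] := choice (@box_exhaust m).
exists (\max_(j <- F) N j); apply/fsubsetP => j jF; apply: NP.
by rewrite (big_fsetD1 _ jF)/= leq_maxl.
Qed.

Lemma geometric_multi (q : K) : 0 <= q -> q < 1 ->
  abs_bound (fun a : {ffun 'I_m -> nat} => q ^+ mdeg a) ((1 - q)^-1 ^+ m).
Proof.
move=> q0 q1 F; have [N FN] := fset_sub_box F.
apply: (@le_trans _ _ (\sum_(a <- box m N) q ^+ mdeg a)).
  move: (box m N) FN => B FN.
  rewrite [leRHS](big_fsetID _ (mem F))/= (_ : [fset x in B | x \in F]%fset = F).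
    rewrite (_ : \sum_(j <- F) `|_| = \sum_(a <- F) q ^+ mdeg a) ?lerDl ?sumr_ge0//.
      by move=> a _; rewrite exprn_ge0.
    by apply: eq_bigr => a _; rewrite ger0_norm// exprn_ge0.
  apply/fsetP => j; rewrite !inE/=; apply/andP/idP; first by case.
  by move=> jF0; split => //; apply: (fsubsetP FN).
rewrite -box_sumE /box_sum.
have -> : \sum_(a : {ffun 'I_m -> 'I_N}) q ^+ mdeg [ffun i => nat_of_ord (a i)] =
    \prod_(i < m) \sum_(j < N) q ^+ j.
  rewrite bigA_distr_bigA; apply: eq_bigr => a _.
  by rewrite /mdeg -prodrXr; apply: eq_bigr => i _; rewrite ffunE.
rewrite prodr_const card_ord; apply: lerXn2r; rewrite ?nnegrE.
- by rewrite sumr_ge0// => i _; rewrite exprn_ge0.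
- by rewrite invr_ge0 subr_ge0 ltW.
have k1' : 0 < 1 - q by rewrite subr_gt0.
rewrite -[leRHS]mul1r ler_pdivlMr// mulrC -opprB mulNr -subrX1 opprB.
by rewrite lerBlDr lerDl exprn_ge0.
Qed.

Lemma monomialZ (t : K) (u : 'rV[K]_m) a :
  monomial_at (t *: u) a = t ^+ mdeg a * monomial_at u a.
Proof.
rewrite /monomial_at /mdeg -prodrXr -big_split/=; apply: eq_bigr => i _.
by rewrite mxE exprMn.
Qed.

(** On the line of multiples of [u], the homogeneous parts become the coefficients of a series in
    one variable, with the same majorant. *)
Lemma slice_abs (c : {ffun 'I_m -> nat} -> K) eta M (u : 'rV[K]_m) (e : nat -> K) :
  sum_complete K -> abs_bound (fun a => c a * eta ^+ mdeg a) M -> polydisc 1 u ->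
  (forall k, sums (fun a => if mdeg a == k then c a * monomial_at u a else 0) (e k)) ->
  abs_bound (fun k => e k * eta ^+ k) M.
Proof.
move=> hK cM u1 eP.
have cM' : abs_bound (fun a => c a * monomial_at u a * eta ^+ mdeg a) M.
  apply: abs_bound_dom cM => a; rewrite !normrM ler_wpM2r// ler_piMr//.
  by rewrite (le_trans (monomial_le a u1))// expr1n.
apply: (abs_bound_fibres hK cM' (p := @mdeg m)) => k; rewrite mulrC.
apply: sums_ext (sumsZ (eta ^+ k) (eP k)) => a.
by case: eqP => [->|_]; rewrite ?mulr0// mulrC.
Qed.

Lemma slice_sums (c : {ffun 'I_m -> nat} -> K) (u : 'rV[K]_m) (e : nat -> K) t S :
  (forall k, sums (fun a => if mdeg a == k then c a * monomial_at u a else 0) (e k)) ->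
  sums (fun a => c a * monomial_at (t *: u) a) S -> sums (fun k => e k * t ^+ k) S.
Proof.
move=> eP; apply: (sums_fibres (p := @mdeg m)) => k; rewrite mulrC.
apply: sums_ext (sumsZ (t ^+ k) (eP k)) => a.
by case: eqP => [<-|_]; rewrite ?mulr0// monomialZ mulrCA.
Qed.

End MultiGeometric.

(** * A single expansion on a closed complex polydisc *)

Section Compactness.
Variable R : realType.

Lemma uniform_box n (s : R) (P : nat -> 'rV[R]_n -> Prop) :
  (forall y : 'rV[R]_n, (forall i, `|y 0 i| <= s) -> exists e N, 0 < e /\
     forall k (y' : 'rV[R]_n), (N <= k)%N -> (forall i, `|y 0 i - y' 0 i| < e) -> P k y') ->
  exists N, forall k (y : 'rV[R]_n), (N <= k)%N -> (forall i, `|y 0 i| <= s) -> P k y.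
Proof.
move=> loc; have cA : compact [set v : 'rV[R]_n | forall i, `[- s, s]%classic (v ord0 i)].
  by apply: (@rV_compact R n (fun=> `[- s, s]%classic)) => i; exact: segment_compact.
move/compact_near_coveringP : cA => /(_ nat \oo P _)[].
  move=> y ys; have [|e [N [e0 eN]]] := loc y.
    by move=> i; have := ys i; rewrite /= in_itv/= ler_norml.
  exists (ball y e, [set k | (N <= k)%N]); first split => /=.
  - exact: nbhsx_ballx.
  - by exists N.
  - move=> [y' k] /= [yy' Nk]; apply: eN => // i.
    by case: yy' => _ /(_ ord0 i).
move=> N _ NP; exists N => k y Nk ys; apply: (NP k Nk) => i /=.
by rewrite in_itv/= -ler_norml.
Qed.

End Compactness.

Local Open Scope complex_scope.

Section ComplexPolydisc.
Variable R : realType.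
Local Notation C := R[i].
Let hC := @sum_complete_complex R.
Let XC := trivSpace hC.

Lemma normCR (x : R) : `|x%:C| = `|x|%:C :> C.
Proof. by rewrite normc_def/= expr0n addr0 sqrtr_sqr. Qed.

Lemma normC_Re (z : C) : `|complex.Re z|%:C <= `|z|.
Proof. exact: normc_ge_Re. Qed.

Lemma normCi : `|'i%C| = 1 :> C.
Proof. by rewrite (normc_def 'i)/= expr0n expr1n add0r sqrtr1. Qed.

Lemma normC_Im (z : C) : `|complex.Im z|%:C <= `|z|.
Proof. by have := normC_Re (z * 'i); rewrite ReiNIm normrN normrM normCi mulr1. Qed.

Lemma real_part (x : C) : 0 <= x -> exists r : R, x = r%:C.
Proof. by move=> x0; exists (complex.Re x); rewrite RRe_real// ger0_real. Qed.

(** Real coordinates on complex space, in which [uniform_box] provides compactness. *)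
Definition complex_of_pair m (y : 'rV[R]_(m + m)) : 'rV[C]_m :=
  \row_i ((y 0 (lshift m i))%:C + 'i%C * (y 0 (rshift m i))%:C).

Lemma complex_of_pair_surj m (h : 'rV[C]_m) (s : R) : polydisc s%:C h ->
  exists2 y : 'rV[R]_(m + m), (forall i, `|y 0 i| <= s) & complex_of_pair y = h.
Proof.
move=> hs; exists (row_mx (\row_i complex.Re (h 0 i)) (\row_i complex.Im (h 0 i))).
  move=> i; rewrite -lecR; rewrite mxE; case: fintype.split => j; rewrite mxE.
  - by rewrite (le_trans (normC_Re _)).
  - by rewrite (le_trans (normC_Im _)).
by apply/rowP => i; rewrite mxE row_mxEl row_mxEr !mxE -complexE.
Qed.

Lemma complex_of_pair_dist m (y y' : 'rV[R]_(m + m)) (e : R) :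
  (forall i, `|y 0 i - y' 0 i| < e) ->
  forall i, `|complex_of_pair y' 0 i - complex_of_pair y 0 i| <= (e * 2)%:C.
Proof.
move=> yy i; rewrite !mxE.
have -> : forall a b c d : R, a%:C + 'i%C * b%:C - (c%:C + 'i%C * d%:C) =
    - ((c - a)%:C + 'i%C * (d - b)%:C).
  by move=> a b c d; rewrite !rmorphB/=; ring.
rewrite normrN (le_trans (ler_normD _ _))// normrM normCi mul1r !normCR -rmorphD/= lecR.
by rewrite mulrDr mulr1 lerD// ltW.
Qed.

Section Uniform.
Variables (m : nat) (G : 'rV[C]_m -> C) (s : R).
Hypothesis s0 : 0 < s.
Hypothesis Gan : forall h, polydisc s%:C h -> analytic_at G h.

Lemma locally_uniform : exists (eta : R) (M : C), 0 < eta /\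
  forall h, polydisc s%:C h -> PS (X := XC) eta%:C (fun _ k => G (h + k)) (fun=> M).
Proof.
(* Radius [1 / (n + 1)] and bound [n] are tied to one integer; growing [n] weakens the claim, as
   [uniform_box] requires. *)
pose P n y := polydisc s%:C (complex_of_pair y) ->
  PS (X := XC) (n.+1%:R^-1)%:C (fun _ k => G (complex_of_pair y + k)) (fun=> n%:R).
have [|N NP] := @uniform_box R (m + m) s P; last first.
  exists N.+1%:R^-1, N%:R; split; first by rewrite invr_gt0 ltr0n.
  by move=> h hs; have [y ys yh] := complex_of_pair_surj hs; rewrite -yh; apply: NP => //; rewrite yh.
move=> y ys; have [Dy|] := pselect (polydisc s%:C (complex_of_pair y)); last first.
  move=> /existsNP[i /negP]; rewrite -real_ltNge ?normr_real//; last first.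
    by rewrite complex_real.
  have [d dE] := real_part (normr_ge0 (complex_of_pair y 0 i)).
  (* A point of the cube outside the polydisc has a whole neighbourhood outside: moduli move by at
     most [(d - s) / 2]. *)
  rewrite dE ltcR => sd; exists ((d - s) / 4), 0%N; split; first by rewrite divr_gt0// subr_gt0.
  move=> k y' _ yy' Dy'; exfalso.
  have := Dy' i; apply/negP; rewrite -real_ltNge ?normr_real ?complex_real//.
  have := complex_of_pair_dist yy' i => h.
  have : d%:C <= `|complex_of_pair y' 0 i| + ((d - s) / 4 * 2)%:C.
    by rewrite -dE -lerBlDl; apply: le_trans h; rewrite distrC; exact: lerB_dist.
  rewrite -lerBlDr -rmorphB/= => h2; apply: lt_le_trans h2.
  rewrite ltcR; lra.
have [r [M [r0 M0 GM]]] := PS_of_analytic XC (Gan Dy).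
have [r' rE] := real_part (ltW r0); rewrite rE in r0 GM.
have [M' ME] := real_part M0; rewrite ME in GM.
rewrite ltcR in r0.
exists (r' / 4), (maxn (Num.truncn (2 / r')).+1 (Num.truncn M').+1); split; first by rewrite divr_gt0.
move=> k y' Nk yy' Dy'.
have kr : k.+1%:R^-1 <= r' / 2.
  rewrite -(invrK (r' / 2)) lef_pV2 ?posrE ?ltr0n ?invr_gt0 ?divr_gt0// invf_div.
  have := truncnS_gt (2 / r') => /ltW/le_trans; apply.
  rewrite ler_nat; apply: leq_trans (leqnSn _); apply: leq_trans Nk; exact: leq_maxl.
have Mk : M' <= k%:R.
  have := truncnS_gt M' => /ltW/le_trans; apply.
  by rewrite ler_nat; apply: leq_trans Nk; exact: leq_maxr.
have := @PS_recenter _ XC m r'%:C (k.+1%:R^-1)%:C _ _ (complex_of_pair y' - complex_of_pair y) _ _ GM.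
move=> P1; have {}P1 := P1 _ _; apply: PS_ext (PS_le _ (P1 _ _)).
- by move=> t h _; rewrite addrA [_ + (_ - _)]addrC subrK.
- by move=> t; rewrite -(rmorph_nat (real_complex R)) lecR.
- by rewrite ler0c invr_ge0.
- move=> i; rewrite !mxE -[X in `|X|]/(_ - _).
  have := complex_of_pair_dist yy' i; rewrite !mxE => h.
  apply: (@le_trans _ _ ((r' / 4 * 2)%:C + (r' / 2)%:C)); first by rewrite lerD// lecR.
  by rewrite -rmorphD/= lecR; lra.
Qed.

(** Along each complex line through 0, the uniform local expansions let [good_all] carry the series
    at 0 up to radius [s]. A single coefficient is then estimated by two averages, over a circle for
    the homogeneous part of its degree and over the torus inside that part. On a smaller polydisc
    the ratio [r / s] makes the full series absolutely convergent. *)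
Lemma polydisc_extension : exists c : {ffun 'I_m -> nat} -> C,
  [/\ forall B, (forall h, polydisc s%:C h -> `|G h| <= B) -> forall a, `|c a| * s%:C ^+ mdeg a <= B,
      exists B, forall h, polydisc s%:C h -> `|G h| <= B &
      forall (r : R) h, 0 < r -> r < s -> polydisc r%:C h -> sums (fun a => c a * monomial_at h a) (G h)].
Proof.
have [eta0 [M [eta00 loc0]]] := locally_uniform.
pose eta := Num.min eta0 s.
have eta_gt0 : 0 < eta by rewrite lt_min eta00.
have etas : eta <= s by rewrite ge_min lexx orbT.
have loc h : polydisc s%:C h -> PS (X := XC) eta%:C (fun _ k => G (h + k)) (fun=> M).
  by move=> /loc0; apply: PS_shrink; rewrite ?ler0c ?lecR ?(ltW eta_gt0)// ge_min lexx.
have eC : 0 < eta%:C :> C by rewrite ltcR.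
have sC : 0 < s%:C :> C by rewrite ltcR.
have z0 : polydisc s%:C (0 : 'rV[C]_m) by move=> i; rewrite mxE normr0 ltW.
have Gb h : polydisc s%:C h -> `|G h| <= M.
  move=> hs; have := PS_bound (h := 0) (tt : csort XC) (loc h hs).
  rewrite addr0; apply => i; by rewrite mxE normr0 ltW.
have [c [cM cP]] := PS_reduced (tt : csort XC) eC (loc 0 z0).
(* Exponents of degree [k] lie in the box of side [k + 1], so the homogeneous part is a polynomial
   in [u], to which [torus_cauchy] applies. *)
have deg_fin (u : 'rV[C]_m) k : sums (fun a => if mdeg a == k then c a * monomial_at u a else 0)
    (\sum_(a : {ffun 'I_m -> 'I_k.+1}) (if mdeg [ffun i => nat_of_ord (a i)] == k then c [ffun i => nat_of_ord (a i)] else 0) * \prod_i u 0 i ^+ a i).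
  set v := fun a => _.
  have -> : \sum_(a : {ffun 'I_m -> 'I_k.+1}) (if mdeg [ffun i => nat_of_ord (a i)] == k then c [ffun i => nat_of_ord (a i)] else 0) * \prod_i u 0 i ^+ a i = box_sum v k.+1.
    apply: eq_bigr => a _; rewrite /v; case: ifP => _; last by rewrite mul0r.
    by congr (_ * _); apply: eq_bigr => i _; rewrite ffunE.
  rewrite box_sumE; apply: sums_fin => a ak; rewrite /v; case: eqP => // mk.
  exfalso; move/negP: ak; apply; apply: mem_box => i; rewrite ltnS -mk.
  by rewrite /mdeg (bigD1 i)//= leq_addr.
pose e (u : 'rV[C]_m) (k : nat) := \sum_(a : {ffun 'I_m -> 'I_k.+1}) (if mdeg [ffun i => nat_of_ord (a i)] == k then c [ffun i => nat_of_ord (a i)] else 0) * \prod_i u 0 i ^+ a i : C.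
have arch : exists k : nat, s%:C <= eta%:C + eta%:C / 8 * k%:R :> C.
  exists (Num.truncn (s / (eta / 8))).+1.
  have e8 : 0 < eta / 8 by rewrite divr_gt0.
  have := truncnS_gt (s / (eta / 8)); rewrite ltr_pdivrMr// => h.
  move: (Num.truncn _).+1 h => n h.
  have E8 : 8 = 8%:C :> C by rewrite rmorph_nat.
  have En : n%:R = n%:R%:C :> C by rewrite rmorph_nat.
  rewrite E8 En -fmorphV -!rmorphM -rmorphD lecR.
  by rewrite mulrC (le_trans (ltW h))// lerDr ltW.
have slice_good u : polydisc 1 u -> good (fun t => G (t *: u)) (e u) s%:C.
  move=> u1; apply: (good_all hC (M := M) eC _ _ _ arch); last by rewrite lecR.
    move=> w ws; have wu : polydisc s%:C (w *: u).
      by move=> i; rewrite mxE normrM (le_trans _ ws)// ler_piMr.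
    have [c' [cM' cP']] := PS_reduced (tt : csort XC) eC (loc _ wu).
    have /choice[e' eP'] : forall k, exists z, sums (fun a => if mdeg a == k then c' a * monomial_at u a else 0) z.
      move=> k; apply: (hC (M := M / eta%:C ^+ k)) => F.
      rewrite ler_pdivlMr ?exprn_gt0// mulr_suml; apply: le_trans (cM' F); apply: ler_sum => a _.
      case: eqP => [<-|_]; last by rewrite normr0 mul0r.
      rewrite !normrM normrX (gtr0_norm eC) ler_wpM2r ?exprn_ge0 ?(ltW eC)//.
      by rewrite ler_piMr// (le_trans (monomial_le a u1))// expr1n.
    exists e'; split; first exact: slice_abs hC cM' u1 eP'.
    move=> t te; apply: slice_sums eP' _; rewrite scalerDl; apply: cP' => i.
    by rewrite mxE normrM (le_trans _ te)// ler_piMr.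
  split; first by exists M; apply: slice_abs hC cM u1 (deg_fin u).
  move=> t te; apply: slice_sums (deg_fin u) _.
  have := cP (t *: u); rewrite add0r; apply => i.
  by rewrite mxE normrM (le_trans _ te)// ler_piMr.
have cB B : (forall h, polydisc s%:C h -> `|G h| <= B) -> forall a, `|c a| * s%:C ^+ mdeg a <= B.
  move=> GB a; rewrite -ler_pdivlMr ?exprn_gt0//.
  have aN i : (a i < (mdeg a).+1)%N by rewrite ltnS /mdeg (bigD1 i)//= leq_addr.
  pose b : {ffun 'I_m -> 'I_(mdeg a).+1} := [ffun i => Ordinal (aN i)].
  have ba : [ffun i => nat_of_ord (b i)] = a by apply/ffunP => i; rewrite !ffunE.
  have := @torus_cauchy _ m (mdeg a).+1 (fun x => if mdeg [ffun i => nat_of_ord (x i)] == mdeg a then c [ffun i => nat_of_ord (x i)] else 0) (B / s%:C ^+ mdeg a) b.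
  rewrite ba eqxx; apply => u u1.
  rewrite ler_pdivlMr ?exprn_gt0//.
  have u1' : polydisc 1 u by move=> i; rewrite u1.
  apply: (good_cauchy hC (B := B) (mdeg a) sC (slice_good u u1')).
  move=> t ts; apply: GB => i; rewrite mxE normrM (le_trans _ ts)// ler_piMr//.
exists c; split => //; first by exists M.
move=> r h r0 rs hr; pose u := (r%:C)^-1 *: h.
have rC : 0 < r%:C :> C by rewrite ltcR.
have hu : h = r%:C *: u by rewrite scalerA mulfV ?scale1r// gt_eqF.
have u1 : polydisc 1 u.
  by move=> i; rewrite mxE normrM normfV (gtr0_norm rC) mulrC ler_pdivrMr// mul1r.
have [_ gs] := slice_good u u1.
have cs : exists S, sums (fun a => c a * monomial_at h a) S.
  pose q := r%:C / s%:C : C.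
  have q0 : 0 <= q by rewrite divr_ge0 ?ltW.
  have q1 : q < 1 by rewrite ltr_pdivrMr// mul1r ltcR.
  have M0 : 0 <= M by apply: le_trans (Gb 0 z0).
  apply: (hC (M := M * (1 - q)^-1 ^+ m)) => F.
  apply: (@le_trans _ _ (\sum_(a <- F) M * `|q ^+ mdeg a|)); last first.
    by rewrite -mulr_sumr ler_wpM2l//; exact: geometric_multi.
  apply: ler_sum => a _; rewrite normrM (ger0_norm (exprn_ge0 _ q0)) /q expr_div_n mulrA.
  rewrite ler_pdivlMr ?exprn_gt0// mulrAC.
  apply: ler_pM => //; first by rewrite mulr_ge0 ?exprn_ge0 ?(ltW sC).
    exact: cB.
  exact: monomial_le.
have [S cS] := cs; suff -> : G h = S by [].
rewrite {1}hu in cS; have := slice_sums (deg_fin u) cS => eS.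
rewrite {1}hu; apply: (sums_unique (gs _ _) eS).
by rewrite (gtr0_norm rC) lecR ltW.
Qed.

End Uniform.
End ComplexPolydisc.

(** * Measurable coefficients and integration of power series *)

Section MeasurableFunctions.
Context d (T : measurableType d) (R : realType).
Implicit Types f : T -> R.

Lemma measurable_inv f : measurable_fun setT f -> measurable_fun setT (fun t => (f t)^-1).
Proof.
move=> mf.
(* At a zero of [f] this formula gives 0, in agreement with the convention for the inverse of 0. *)
have -> : (fun t => (f t)^-1) = (fun t => f t * expR (- ln (f t * f t))).
  apply/funext => t; have [->|f0] := eqVneq (f t) 0; first by rewrite invr0 mul0r.
  have f2 : 0 < f t * f t by rewrite -expr2 exprn_even_gt0.
  by rewrite expRN lnK ?posrE//; field.
apply: measurable_funM => //; apply: measurableT_comp (@measurable_expR R) _.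
apply: measurableT_comp (@oppr_measurable R _) _.
by apply: measurableT_comp (@measurable_ln R) _; exact: measurable_funM.
Qed.

Lemma measurable_div (f g : T -> R) : measurable_fun setT f -> measurable_fun setT g ->
  measurable_fun setT (fun t => f t / g t).
Proof. by move=> mf mg; apply: measurable_funM => //; exact: measurable_inv. Qed.

Definition measSpace : coefSpace R := @CoefSpace R T (measurable_fun setT)
  (fun k => measurable_cst k) (fun f g => @measurable_funM _ _ _ _ f g)
  (@sum_complete_real R).

Lemma sums_cvg (u : nat -> R) s : sums u s -> \sum_(k < n) u k @[n --> \oo] --> s.
Proof.
move=> us; apply/cvgrPdist_le => e e0.
have GP (j : nat) : exists N, forall n, (N <= n)%N -> j \in [fset k in iota 0 n]%fset.
  by exists j.+1 => n jn; rewrite !inE mem_iota leq0n.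
have [N NP] := sums_partial us GP e0.
by exists N => // n Nn /=; rewrite sum_ord_fset; exact: NP.
Qed.

End MeasurableFunctions.

Section RealPowerSeries.
Context d (T : measurableType d) (R : realType) (m : nat).
Local Notation X := (measSpace T R).
Implicit Types (f : T -> 'rV[R]_m -> R) (M : T -> R).

Lemma PS_measurable r f M h : PS (X := X) r f M -> polydisc r h ->
  measurable_fun setT (fun t => f t h).
Proof.
move=> [a [c [ac cM]]] hr.
apply: (@measurable_fun_cvg _ _ _ _ (fun n t => \sum_(k < n) c k t * monomial_at h (a k))).
  move=> n; apply: measurable_sum => k.
  by apply: measurable_funM; [exact: ac|exact: measurable_cst].
by move=> t _; apply: (sums_cvg ((cM t).2 h hr)).
Qed.

(** The sum of the absolute values of the terms is the least majorant of the given expansion. As a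
    limit of finite sums it is measurable, whether or not [M] is. *)
Lemma PS_tight r f M : PS (X := X) r f M ->
  exists M', [/\ measurable_fun setT M', forall t, 0 <= M' t <= M t & PS (X := X) r f M'].
Proof.
move=> [a [c [ac cM]]].
pose u t n := \sum_(k < n) `|c k t * r ^+ mdeg (a k)|.
have uM t n : u t n <= M t.
  rewrite /u (sum_ord_fset (fun k => `|c k t * r ^+ mdeg (a k)|)); exact: (cM t).1.
have und t : {homo u t : n p / (n <= p)%N >-> n <= p}.
  move=> n p np; rewrite /u -(subnKC np) big_split_ord/= lerDl sumr_ge0//.
have ucv t : cvgn (u t).
  apply: nondecreasing_is_cvgn => //; exists (M t) => _ [n _ <-]; exact: uM.
exists (fun t => limn (u t)); split.
- apply: (@measurable_fun_cvg _ _ _ _ (fun n t => u t n)); last by move=> t _; exact: ucv.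
  move=> n; apply: measurable_sum => k; apply: measurableT_comp => //.
  by apply: measurable_funM; [exact: ac|exact: measurable_cst].
- move=> t; apply/andP; split.
    by apply: le_trans (nondecreasing_cvgn_le (und t) (ucv t) 0%N); rewrite /u big_ord0.
  by apply: limr_le; [exact: ucv|near=> n; exact: uM].
exists a, c; split => // t; split; last exact: (cM t).2.
move=> F; have [N FN] : exists N, forall n, n \in F -> (n < N)%N.
  by exists (\max_(j <- F) j).+1 => n nF; rewrite ltnS (big_fsetD1 _ nF)/= leq_maxl.
apply: le_trans (nondecreasing_cvgn_le (und t) (ucv t) N).
rewrite /u (sum_ord_fset (fun k => `|c k t * r ^+ mdeg (a k)|)).
set G := [fset k in iota 0 N]%fset.
rewrite [leRHS](big_fsetID _ (mem F))/= (_ : [fset x in G | x \in F]%fset = F).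
  by rewrite lerDl sumr_ge0.
apply/fsetP => j; rewrite !inE/=; apply/andP/idP; first by case.
by move=> jF; split => //; rewrite mem_iota leq0n FN.
Unshelve. all: by end_near. Qed.

End RealPowerSeries.

Lemma PS_param d1 d2 (T1 : measurableType d1) (T2 : measurableType d2) (R : realType) m
    (phi : T1 -> T2) r (f : T2 -> 'rV[R]_m -> R) M :
  measurable_fun setT phi -> PS (X := measSpace T2 R) r f M ->
  PS (X := measSpace T1 R) r (fun t => f (phi t)) (fun t => M (phi t)).
Proof.
move=> mphi [a [c [ac cM]]]; exists a, (fun n t => c n (phi t)); split => // n.
by apply: measurableT_comp (ac n) mphi.
Qed.

Section IntegralPowerSeries.
Context d (T : measurableType d) (R : realType) (mu : {measure set T -> \bar R}) (m : nat).
Local Notation X := (measSpace T R).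
Implicit Types (f : T -> 'rV[R]_m -> R) (M : T -> R).

(** For nonnegative functions the integral is a supremum over simple functions below, so
    monotonicity asks for no measurability. It serves for suprema over uncountable sets. *)
Lemma ge0_le_integral_lower (f g : T -> \bar R) :
  (forall x, 0 <= f x)%E -> (forall x, f x <= g x)%E ->
  (\int[mu]_x f x <= \int[mu]_x g x)%E.
Proof.
move=> f0 fg; have g0 x : (0 <= g x)%E by exact: le_trans (fg x).
rewrite !ge0_integralTE//; apply: le_ereal_sup => _ [h hf <-].
by exists h => // x; exact: le_trans (hf x) (fg x).
Qed.

Lemma integrable_bound (f : T -> R) M : measurable_fun setT f -> (forall t, `|f t| <= M t) ->
  mu.-integrable setT (EFin \o M) -> mu.-integrable setT (EFin \o f).
Proof.
move=> mf fM; apply: le_integrable => //.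
  exact/measurable_EFinP.
by move=> t _ /=; rewrite lee_fin (le_trans (fM t))// ler_norm.
Qed.

Lemma integrableM_cst (f : T -> R) (k : R) : mu.-integrable setT (EFin \o f) ->
  mu.-integrable setT (EFin \o (fun t => f t * k)).
Proof.
move=> /(integrableZl measurableT k).
by apply: eq_integrable => // t _ /=; rewrite -EFinM mulrC.
Qed.

Lemma Rintegral_sum (I : Type) (s : seq I) (f : I -> T -> R) :
  (forall i, mu.-integrable setT (EFin \o f i)) ->
  mu.-integrable setT (EFin \o (fun t => \sum_(i <- s) f i t)) /\
  \int[mu]_t (\sum_(i <- s) f i t) = \sum_(i <- s) \int[mu]_t f i t.
Proof.
move=> fi; elim: s => [|i s [IH1 IH2]].
  split; first by apply: eq_integrable (integrable0 _ _) => // t _ /=; rewrite big_nil.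
  rewrite big_nil; under eq_Rintegral do rewrite big_nil.
  by rewrite Rintegral_cst// mul0r.
have E : (fun t => \sum_(j <- i :: s) f j t) = (fun t => f i t + \sum_(j <- s) f j t).
  by apply/funext => t; rewrite big_cons.
rewrite E; split; last by rewrite big_cons -IH2 RintegralD.
by have := integrableD measurableT (fi i) IH1; apply: eq_integrable.
Qed.

(** The norms of the integrated coefficients add up to at most the integral of [M]; the sum of the
    series is the integral of the sums by dominated convergence, [M] dominating every partial
    sum. *)
Lemma PS_int (S : coefSpace R) r f M A : 0 < r -> mu.-integrable setT (EFin \o M) ->
  \int[mu]_t M t <= A -> PS (X := X) r f M ->
  PS (X := S) r (fun _ h => \int[mu]_t f t h) (fun=> A).
Proof.
move=> r0 iM MA fM; have [a [c [ac cM]]] := fM.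
have rn n : 0 < r ^+ n by rewrite exprn_gt0.
have cb k t : `|c k t| <= M t / r ^+ mdeg (a k).
  rewrite ler_pdivlMr// -[X in _ * X](gtr0_norm (rn _)) -normrM.
  exact: abs_bound_term (cM t).1.
have ic k : mu.-integrable setT (EFin \o c k).
  apply: integrable_bound (cb k) _; first exact: ac.
  exact: integrableM_cst.
have iabs k : mu.-integrable setT (EFin \o (fun t => `|c k t * r ^+ mdeg (a k)|)).
  exact: (integrable_norm (integrableM_cst _ (ic k))).
exists a, (fun k _ => \int[mu]_t c k t); split; first by move=> n; exact: adm_cst.
have bA : abs_bound (fun n => (\int[mu]_t c n t) * r ^+ mdeg (a n)) A.
  move=> F; apply: le_trans MA.
  apply: (@le_trans _ _ (\int[mu]_t (\sum_(k <- F) `|c k t * r ^+ mdeg (a k)|))); last first.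
    apply: le_Rintegral => //; first exact: (Rintegral_sum F iabs).1.
    by move=> t _; exact: (cM t).1.
  rewrite (Rintegral_sum F iabs).2; apply: ler_sum => k _.
  rewrite -RintegralZr//; apply: le_normr_Rintegral => //; exact: integrableM_cst.
move=> _; split => // h hr.
have GP (j : nat) : exists N, forall n, (N <= n)%N -> j \in [fset k in iota 0 n]%fset.
  by exists j.+1 => n jn; rewrite !inE mem_iota leq0n.
apply: (@sums_exhaust R (@sum_complete_real R) _ _ A _ _ _ GP).
  apply: abs_bound_dom bA => n; rewrite !normrM ler_wpM2l//.
  have hn := monomial_le (a n) hr; rewrite (le_trans hn)//; exact: ler_norm.
pose u n t := \sum_(k < n) c k t * monomial_at h (a k).
have iu n : mu.-integrable setT (EFin \o u n) /\
    \int[mu]_t u n t = \sum_(k < n) (\int[mu]_t c k t) * monomial_at h (a k).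
  have [i1 i2] := Rintegral_sum (index_enum 'I_n) (fun k : 'I_n => integrableM_cst (monomial_at h (a k)) (ic k)).
  split => //; rewrite i2; apply: eq_bigr => k _.
  exact: RintegralZr.
have mf := PS_measurable fM hr.
have iF : mu.-integrable setT (EFin \o (fun t => f t h)).
  by apply: integrable_bound iM => // t; exact: PS_bound fM hr.
have cv : (fun n => \int[mu]_t u n t) @ \oo --> \int[mu]_t f t h.
  apply: fine_cvg; rewrite fineK ?integrable_fin_num//.
  apply: (@dominated_cvg _ _ _ mu setT measurableT _ (EFin \o (fun t => f t h)) (EFin \o M)) => //.
  - by move=> n; exact: measurable_int (iu n).1.
  - move=> t _; apply: cvg_EFin; first by near=> n.
    exact: (sums_cvg ((cM t).2 h hr)).
  - move=> n t _ /=; rewrite lee_fin /u (le_trans (ler_norm_sum _ _ _))//.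
    rewrite (sum_ord_fset (fun k => `|c k t * monomial_at h (a k)|)).
    apply: le_trans ((cM t).1 _); apply: ler_sum => k _.
    rewrite !normrM ler_wpM2l// (le_trans (monomial_le _ hr))//; exact: ler_norm.
move=> e e0; move/cvgrPdist_le : cv => /(_ e e0)[N _ NP]; exists N => n Nn.
have := NP n Nn; rewrite (iu n).2.
by rewrite (sum_ord_fset (fun k => \int[mu]_t c k t * monomial_at h (a k))).
Unshelve. all: by end_near. Qed.

Lemma PS_integrable r f M h : mu.-integrable setT (EFin \o M) -> PS (X := X) r f M ->
  polydisc r h -> mu.-integrable setT (EFin \o (fun t => f t h)).
Proof.
move=> iM fM hr; apply: integrable_bound iM; first exact: PS_measurable fM hr.
by move=> t; exact: PS_bound fM hr.
Qed.

End IntegralPowerSeries.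

(** * The logarithmic series *)

Section Logarithm.
Variable R : realType.

(** Remainder of the Taylor polynomial of degree [N] of [ln (1 + x)]. Its derivative is the
    remainder of a geometric series. *)
Definition lnP (N : nat) (x : R) := ln (1 + x) - \sum_(n < N) (-1) ^+ n * x ^+ n.+1 / n.+1%:R.

Lemma lnP_derive N (x : R) : -1 < x -> is_derive x 1 (lnP N) ((- x) ^+ N / (1 + x)).
Proof.
move=> x1; have x10 : 0 < 1 + x by lra.
have D1 : is_derive x 1 (fun z : R => ln (1 + z)) ((1 + x)^-1).
  have := @is_derive1_comp R (@ln R) (fun z => 1 + z) x ((1 + x)^-1) 1 _ _.
  rewrite mulr1; apply; first exact: is_derive1_ln.
  by have := is_deriveD (is_derive_cst (1 : R) x 1) (is_derive_id x 1); rewrite add0r.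
have D2 (n : nat) : is_derive x 1 (fun z : R => (-1) ^+ n * z ^+ n.+1 / n.+1%:R) ((- x) ^+ n).
  have := @is_deriveZ R R R _ ((-1) ^+ n / n.+1%:R) x 1 _ (@is_deriveX R R id n.+1 x 1 1 (is_derive_id x 1)).
  move=> H; have E : (fun z : R => (-1) ^+ n * z ^+ n.+1 / n.+1%:R) =
      (((-1) ^+ n / n.+1%:R) \*: (id ^+ n.+1 : R -> R)).
    by apply/funext => z; rewrite exprfctE/= mulrAC.
  rewrite E; apply: is_derive_eq H _.
  rewrite /GRing.scale/= mulr1 (exprNn x n) mulrA; congr (_ * _).
  by rewrite divfK// pnatr_eq0.
have D3 := is_deriveB D1 (@is_derive_sum R R R N (fun n z => (-1) ^+ n * z ^+ n.+1 / n.+1%:R) x 1 _ (fun n => D2 n)).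
have -> : lnP N = (fun z : R => ln (1 + z)) - \sum_(n < N) (fun z : R => (-1) ^+ n * z ^+ n.+1 / n.+1%:R).
  by apply/funext => z; rewrite /lnP fctE; congr (_ - _); rewrite fct_sumE.
apply: is_derive_eq D3 _.
have xn : 1 + x != 0 by rewrite gt_eqF.
apply: (mulfI xn); rewrite mulrBr mulfV// [RHS]mulrC divfK//.
have := subrX1 (- x) N; rewrite (_ : - x - 1 = - (1 + x)); last by ring.
by rewrite mulNr => E; rewrite -[RHS](subrK 1) E addrC.
Qed.

(** Mean value theorem between 0 and [y], on either side of 0. *)
Lemma lnP_bound N (k y : R) : 0 <= k -> k < 1 -> `|y| <= k -> `|lnP N y| <= k ^+ N / (1 - k).
Proof.
move=> k0 k1 yk.
have lnP0 : lnP N 0 = 0.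
  rewrite /lnP addr0 ln1 big1 ?subr0// => n _.
  by rewrite expr0n/= mulr0 mul0r.
have k1' : 0 < 1 - k by rewrite subr_gt0.
have H (a b : R) : a <= b -> - k <= a -> b <= k -> `|b - a| <= 1 ->
    `|lnP N b - lnP N a| <= k ^+ N / (1 - k).
  move=> ab ka bk ba.
  have dF x : x \in `[a, b] -> is_derive x 1 (lnP N) ((- x) ^+ N / (1 + x)).
    by rewrite in_itv/= => /andP[ax xb]; apply: lnP_derive; apply: lt_le_trans ax; apply: lt_le_trans ka; rewrite ltrN2.
  have cF : {within `[a, b], continuous (lnP N)}.
    by apply: derivable_within_continuous => x /dF [].
  have dF' x : x \in `]a, b[ -> is_derive x 1 (lnP N) ((- x) ^+ N / (1 + x)).
    by rewrite in_itv/= => /andP[ax xb]; apply: dF; rewrite in_itv/= (ltW ax) (ltW xb).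
  have [c] := @MVT_segment R (lnP N) (fun x => (- x) ^+ N / (1 + x)) a b ab dF' cF.
  rewrite in_itv/= => /andP[ac cb] ->.
  have ck : `|c| <= k by rewrite ler_norml (le_trans ka ac) (le_trans cb bk).
  have c1 : 1 - k <= 1 + c by rewrite lerD2l (le_trans ka).
  have c10 : 0 < 1 + c by exact: lt_le_trans c1.
  rewrite !normrM normrX normrN normfV (gtr0_norm c10).
  apply: (@le_trans _ _ (`|c| ^+ N / (1 + c))).
    by rewrite ler_piMr// mulr_ge0// ?exprn_ge0// invr_ge0 ltW.
  apply: ler_pM; rewrite ?exprn_ge0 ?invr_ge0 ?(ltW c10)//.
    by apply: lerXn2r; rewrite ?nnegrE.
  by rewrite lef_pV2 ?posrE.
move: (yk); rewrite ler_norml => /andP[y1 y2].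
have [y0|y0] := leP 0 y.
  rewrite -[X in `|X|]subr0 -lnP0; apply: H => //; first lra.
  by rewrite subr0; lra.
rewrite -normrN (_ : - lnP N y = lnP N 0 - lnP N y); last by rewrite lnP0 sub0r.
by apply: H => //; rewrite ?(ltW y0)// sub0r normrN (le_trans yk)// ltW.
Qed.

Lemma ln_sums (k y : R) : 0 <= k -> k < 1 -> `|y| <= k ->
  abs_bound (fun n => k ^+ n.+1 / n.+1%:R) (k / (1 - k)) /\
  sums (fun n => (-1) ^+ n / n.+1%:R * y ^+ n.+1) (ln (1 + y)).
Proof.
move=> k0 k1 yk.
have kk : `|k| <= k by rewrite ger0_norm.
have [gb _] := geometric_sums (trivSpace (@sum_complete_real R)) k0 k1 kk.
have kb : abs_bound (fun n => k ^+ n.+1 / n.+1%:R) (k / (1 - k)).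
  move=> F; apply: (@le_trans _ _ (\sum_(n <- F) k * `|k ^+ n|)).
    apply: ler_sum => n _; rewrite exprS -mulrA normrM (ger0_norm k0) ler_wpM2l//.
    by rewrite normrM ler_piMr// ger0_norm ?invr_ge0// invf_le1 ?ltr0n// ler1n.
  by rewrite -mulr_sumr ler_wpM2l.
split => //.
have GP (j : nat) : exists N, forall n, (N <= n)%N -> j \in [fset k in iota 0 n]%fset.
  by exists j.+1 => n jn; rewrite !inE mem_iota leq0n.
apply: (sums_exhaust (@sum_complete_real R) _ GP (M := k / (1 - k))).
  apply: abs_bound_dom kb => n.
  rewrite 2!normrM normrX normrN1 expr1n mul1r mulrC normrM ler_wpM2r// !normrX.
  by apply: lerXn2r; rewrite ?nnegrE// (ger0_norm k0).
move=> e e0; have k1' : 0 < 1 - k by rewrite subr_gt0.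
have cv : (fun n => k ^+ n) @ \oo --> (0 : R) by apply: cvg_expr; rewrite ger0_norm.
have ek : 0 < e * (1 - k) by rewrite mulr_gt0.
have [N _ NP] := (cvgrPdist_le _ _).1 cv _ ek.
exists N => n Nn; rewrite -(sum_ord_fset (fun n => (-1) ^+ n / n.+1%:R * y ^+ n.+1)).
rewrite (_ : _ - _ = lnP n y); last first.
  by rewrite /lnP; congr (_ - _); apply: eq_bigr => i _; rewrite mulrAC.
apply: le_trans (lnP_bound n k0 k1 yk) _; rewrite ler_pdivrMr//.
by have := NP n Nn; rewrite sub0r normrN ger0_norm ?exprn_ge0.
Qed.

Lemma PS_ln (X : coefSpace R) m r k (g : X -> 'rV[R]_m -> R) : 0 <= k -> k < 1 ->
  PS r g (fun=> k) -> PS r (fun t h => ln (1 + g t h)) (fun=> k / (1 - k)).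
Proof.
move=> k0 k1 gk.
apply: (@PS_series _ X _ nat r (fun n t h => (-1) ^+ n / n.+1%:R * g t h ^+ n.+1)
  (fun n _ => n.+1%:R^-1 * k ^+ n.+1)).
- move=> n; apply: PS_le (PS_scale (@adm_cst _ X _) (PS_exp n.+1 gk)) => t.
  by rewrite normrM normrX normrN1 expr1n mul1r ger0_norm ?invr_ge0.
- move=> t; have kk : `|k| <= k by rewrite ger0_norm.
  by apply: abs_bound_dom (ln_sums k0 k1 kk).1 => n; rewrite mulrC.
- by move=> t h hr; apply: (ln_sums k0 k1 _).2; exact: PS_bound gk hr.
Qed.

End Logarithm.

(** * Measurability of Taylor coefficients *)

Section MeasurableCoefficients.
Context d (T : measurableType d) (R : realType).
Let hR := @sum_complete_real R.

(** Induction on [k]: once the terms of lower degree are removed, dividing by [x ^+ k] and letting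
    [x = 1 / (j + 1)] tend to 0 exhibits the coefficient as a pointwise limit of measurable
    functions. *)
Lemma measurable_series_coef (c : T -> nat -> R) (M : T -> R) (phi : T -> R -> R) :
  (forall t, abs_bound (c t) (M t)) ->
  (forall t x, `|x| <= 1 -> sums (fun n => c t n * x ^+ n) (phi t x)) ->
  (forall x, `|x| <= 1 -> measurable_fun setT (phi ^~ x)) ->
  forall k, measurable_fun setT (c ^~ k).
Proof.
move=> cM cP mphi k; elim/ltn_ind: k => k IH.
pose x (j : nat) : R := j.+1%:R^-1.
have x0 j : 0 < x j by rewrite invr_gt0 ltr0n.
have x1 j : `|x j| <= 1 by rewrite gtr0_norm// invf_le1 ?ltr0n// ler1n.
pose u j t := (phi t (x j) - \sum_(i < k) c t i * x j ^+ i) / x j ^+ k.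
apply: (@measurable_fun_cvg _ _ _ _ u).
  move=> j; apply: measurable_funM; last exact: measurable_cst.
  apply: measurable_funB; first exact: mphi.
  apply: measurable_sum => i; apply: measurable_funM; last exact: measurable_cst.
  exact: IH.
move=> t _.
have bnd j : `|c t k - u j t| <= x j * M t.
  have uE : u j t - c t k = (phi t (x j) - \sum_(i < k.+1) c t i * x j ^+ i) / x j ^+ k.
    by rewrite big_ord_recr/= opprD addrA mulrBl -/(u j t) mulfK// expf_neq0// gt_eqF.
  have xk : 0 < x j ^+ k by rewrite exprn_gt0.
  rewrite distrC uE normrM normfV (gtr0_norm xk).
  rewrite ler_pdivrMr ?exprn_gt0// mulrAC -exprS mulrC.
  have w0 i : (k.+1 <= i)%N -> (if (i < k.+1)%N then c t i * x j ^+ i else 0) = 0.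
    by move=> ki; rewrite ltnNge ki.
  have s1 := sums_nat_fin w0.
  have -> : \sum_(i < k.+1) c t i * x j ^+ i = \sum_(i < k.+1) (if (i < k.+1)%N then c t i * x j ^+ i else 0).
    by apply: eq_bigr => i _; rewrite ltn_ord.
  apply: sums_norm_le (sumsB (cP t _ (x1 j)) s1).
  move=> F; apply: (@le_trans _ _ (\sum_(i <- F) `|c t i| * x j ^+ k.+1)).
    apply: ler_sum => i _; case: ltnP => [_|ki].
      by rewrite subrr normr0 mulr_ge0// exprn_ge0// ltW.
    rewrite subr0 normrM ler_wpM2l// ger0_norm ?exprn_ge0 ?(ltW (x0 j))//.
    rewrite -(subnK ki) exprD ler_piMl ?exprn_ge0 ?(ltW (x0 j))// exprn_ile1 ?(ltW (x0 j))//.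
    by rewrite -(gtr0_norm (x0 j)).
  by rewrite -mulr_suml ler_wpM2r ?exprn_ge0 ?(ltW (x0 j))//; exact: cM.
apply/cvgrPdist_le => e e0.
have cv : (fun j => x j * M t) @ \oo --> (0 : R).
  rewrite -[X in _ --> X](mul0r (M t)); apply: cvgMl; exact: cvg_harmonic.
have [N _ NP] := (cvgrPdist_le _ _).1 cv _ e0; exists N => // n Nn /=.
apply: le_trans (bnd n) _; have := NP n Nn; rewrite sub0r normrN.
exact: le_trans (ler_norm _).
Qed.

(** Exponents are fixed one variable at a time. At stage [s] the sum runs over the exponents that
    agree with [a] in the first [s] variables; the passage to [s + 1] extracts a coefficient in one
    variable. *)
Lemma measurable_power_coef m (c : T -> {ffun 'I_m -> nat} -> R) (M : T -> R)
    (f : T -> 'rV[R]_m -> R) :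
  (forall t, abs_bound (c t) (M t)) ->
  (forall t h, polydisc 1 h -> sums (fun a => c t a * monomial_at h a) (f t h)) ->
  (forall h, polydisc 1 h -> measurable_fun setT (f ^~ h)) ->
  forall a, measurable_fun setT (c ^~ a).
Proof.
move=> cM cP mf a.
pose P s (b : {ffun 'I_m -> nat}) := [forall i : 'I_m, (i < s)%N ==> (b i == a i)].
pose u s t (h : 'rV[R]_m) b := if P s b then c t b * \prod_(i < m | (s <= i)%N) h 0 i ^+ b i else 0.
have uM s t h : polydisc 1 h -> abs_bound (u s t h) (M t).
  move=> h1; apply: abs_bound_dom (cM t) => b; rewrite /u; case: ifP => _; last by rewrite normr0.
  rewrite normrM ler_piMr// normr_prod prodr_ile1// => i _.
  by rewrite normr_ge0/= normrX exprn_ile1.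
have Q s : (s <= m)%N -> forall h, polydisc 1 h -> exists2 g, measurable_fun setT g &
    forall t, sums (u s t h) (g t).
  elim: s => [_ h h1|s IH sm h h1].
    exists (f ^~ h); first exact: mf.
    move=> t; apply: sums_ext (cP t h h1) => b; rewrite /u ifT//.
    by apply/forallP.
  pose i0 := Ordinal sm.
  pose hx x := \row_i (if i == i0 then x else h 0 i) : 'rV[R]_m.
  have hx1 x : `|x| <= 1 -> polydisc 1 (hx x).
    by move=> x1 i; rewrite mxE; case: ifP.
  have /choice[g gP] : forall x, exists g : T -> R, `|x| <= 1 ->
      measurable_fun setT g /\ forall t, sums (u s t (hx x)) (g t).
    move=> x; have [x1|_] := boolP (`|x| <= 1); last by exists (fun=> 0).
    by have [g mg gs] := IH (ltnW sm) (hx x) (hx1 x x1); exists g.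
  pose v t b := if P s b then c t b * \prod_(i < m | (s < i)%N) h 0 i ^+ b i else 0.
  have vM t : abs_bound (v t) (M t).
    apply: abs_bound_dom (cM t) => b; rewrite /v; case: ifP => _; last by rewrite normr0.
    rewrite normrM ler_piMr// normr_prod prodr_ile1// => i _.
    by rewrite normr_ge0/= normrX exprn_ile1.
  have /choice[e eP] : forall t, exists e : nat -> R, forall k,
      sums (fun b : {ffun 'I_m -> nat} => if b i0 == k then v t b else 0) (e k).
    move=> t; have /choice[e eP] : forall k, exists e,
        sums (fun b : {ffun 'I_m -> nat} => if b i0 == k then v t b else 0) e.
      move=> k; apply: (hR (M := M t)); apply: abs_bound_dom (vM t) => b.
      by case: ifP => // _; rewrite normr0.
    by exists e.
  have eM t : abs_bound (e t) (M t).
    exact: (abs_bound_fibres hR (vM t) (eP t)).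
  have ge t x : `|x| <= 1 -> sums (fun k => e t k * x ^+ k) (g x t).
    move=> x1; have [_ /(_ t)] := gP x x1; apply: (sums_fibres (p := fun b : {ffun 'I_m -> nat} => b i0)) => k.
    rewrite mulrC; apply: sums_ext (sumsZ (x ^+ k) (eP t k)) => b.
    case: eqP => [<-|_]; last by rewrite mulr0.
    rewrite /u /v; case: ifP => _; last by rewrite mulr0.
    have -> : \prod_(i < m | (s <= i)%N) hx x 0 i ^+ b i =
        x ^+ b i0 * \prod_(i < m | (s < i)%N) h 0 i ^+ b i.
      rewrite (bigD1 i0)//= mxE eqxx; congr (_ * _).
      apply: eq_big => [i|i /andP[_ ii0]]; last by rewrite mxE (negbTE ii0).
      by rewrite ltn_neqAle andbC; congr (_ && _); rewrite eq_sym.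
    by rewrite mulrCA.
  exists (e ^~ (a i0)).
    apply: (measurable_series_coef eM (phi := fun t x => g x t)) => [t x|x x1]; first exact: ge.
    exact: (gP x x1).1.
  move=> t; apply: sums_ext (eP t (a i0)) => b; rewrite /v /u.
  have -> : P s.+1 b = P s b && (b i0 == a i0).
    apply/forallP/andP => [H|[/forallP H ai] i].
      split; last by have := H i0; rewrite /= ltnSn.
      by apply/forallP => i; apply/implyP => iS; have := H i; rewrite ltnS (ltnW iS).
    apply/implyP; rewrite ltnS leq_eqVlt => /predU1P[iE|iS]; last by have := H i; rewrite iS.
    by have -> : i = i0 by exact: val_inj.
  by case: (P s b); case: (_ == _).
have h0 : polydisc 1 (0 : 'rV[R]_m) by move=> i; rewrite mxE normr0.
have [g mg gs] := Q m (leqnn m) 0 h0.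
suff -> : c ^~ a = g by [].
apply/funext => t; apply: (sums_unique _ (gs t)).
have um b : u m t 0 b = if b == a then c t b else 0.
  rewrite /u; have -> : P m b = (b == a).
    apply/forallP/eqP => [H|-> i]; last by apply/implyP.
    by apply/ffunP => i; apply/eqP; have := H i; rewrite ltn_ord.
  case: eqP => // _; rewrite big1 ?mulr1// => i; by rewrite leqNgt ltn_ord.
have := @sums_fin _ _ (u m t 0) [fset a]%fset; rewrite big_seq_fset1 um eqxx; apply => b.
by rewrite inE um => /negbTE ->.
Qed.

End MeasurableCoefficients.

Local Open Scope complex_scope.

(** * Real majorised series from complex extensions *)

Section RealFromComplex.
Variable R : realType.
Local Notation C := R[i].

Lemma sums_Re (J : choiceType) (u : J -> C) (s : C) :
  sums u s -> sums (fun j => complex.Re (u j)) (complex.Re s).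
Proof.
move=> us e e0; have [F0 F0P] := us e%:C (eq_ind_r is_true e0 (ltcR 0 e)).
exists F0 => F FF; have := F0P F FF; rewrite -lecR; apply: le_trans.
by rewrite -raddf_sum -raddfB; exact: normC_Re.
Qed.

Lemma monomial_toC m (h : 'rV[R]_m) a : monomial_at (toC h) a = (monomial_at h a)%:C.
Proof.
rewrite /monomial_at rmorph_prod; apply: eq_bigr => i _.
by rewrite mxE rmorphXn.
Qed.

Lemma Re_mulC (z : C) (x : R) : complex.Re (z * x%:C) = complex.Re z * x.
Proof. by case: z => a b /=; rewrite mulr0 subr0. Qed.

Lemma analytic_at_shift (K : numFieldType) m (f : 'rV[K]_m -> K) x h : sum_complete K ->
  analytic_at f (x + h) -> analytic_at (fun k => f (x + k)) h.
Proof.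
move=> hK /(analytic_at_sums hK)[c [r [M [r0 cM cP]]]].
by apply: (sums_analytic_at r0 cM) => k kr; rewrite addrA; exact: cP.
Qed.

Context d (T : measurableType d) (m : nat).

(** Cauchy's estimate with the supremum over the complex polydisc, summed at half the radius, gives
    the factor [2 ^+ m]. Real parts make the coefficients real, and the values at real points make
    them measurable. The supremum is not known to be measurable in [t], so [M] comes from [PS_tight]
    and is compared with arbitrary upper bounds [B]. *)
Lemma PS_of_complex (f : T -> 'rV[R]_m -> R) (F : T -> 'rV[C]_m -> C) (x : 'rV[R]_m) (s : R) :
  0 < s ->
  (forall t h, polydisc s%:C h -> analytic_at (F t) (toC x + h)) ->
  (forall t (h : 'rV[R]_m), polydisc s h -> F t (toC x + toC h) = (f t h)%:C) ->
  (forall h : 'rV[R]_m, polydisc s h -> measurable_fun setT (f ^~ h)) ->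
  exists M : T -> R, [/\ measurable_fun setT M, forall t, 0 <= M t,
    forall t (B : R), (forall h, polydisc s%:C h -> `|F t (toC x + h)| <= B%:C) -> M t <= 2 ^+ m * B &
    PS (X := measSpace T R) (s / 2) f M].
Proof.
move=> s0 Fan Ff mf.
have hC := @sum_complete_complex R.
have := fun t => polydisc_extension s0 (fun h hs => analytic_at_shift hC (Fan t h hs)).
move=> /choice[c cP].
pose S t := sup [set complex.Re `|F t (toC x + h)| | h in polydisc s%:C].
have normE (z : C) : `|z| = (complex.Re `|z|)%:C.
  by rewrite RRe_real// normr_real.
have hS t : has_sup [set complex.Re `|F t (toC x + h)| | h in polydisc s%:C].
  split; first by exists (complex.Re `|F t (toC x + 0)|), 0 => // i; rewrite mxE normr0 ler0c ltW.
  have [_ [B BP] _] := cP t; exists (complex.Re B) => _ [h hs <-].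
  by have := BP h hs; rewrite lecE => /andP[_].
have SP t h : polydisc s%:C h -> `|F t (toC x + h)| <= (S t)%:C.
  move=> hs; rewrite normE lecR; apply: ub_le_sup; first exact: (hS t).2.
  by exists h.
have SB t B : (forall h, polydisc s%:C h -> `|F t (toC x + h)| <= B%:C) -> S t <= B.
  move=> FB; apply: ge_sup; first exact: (hS t).1.
  by move=> _ [h hs <-]; have := FB h hs; rewrite normE lecR.
pose c' t a := complex.Re (c t a).
have c'S t a : `|c' t a| * s ^+ mdeg a <= S t.
  have [/(_ _ (SP t)) /(_ a) + _ _] := cP t.
  rewrite -rmorphXn normE -rmorphM lecR; apply: le_trans.
  by rewrite ler_wpM2r ?exprn_ge0 ?(ltW s0)// -lecR -normE normC_Re.
have c'M t : abs_bound (fun a => c' t a * (s / 2) ^+ mdeg a) (2 ^+ m * S t).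
  have := @geometric_multi R m 2^-1 _ _; rewrite (_ : 1 - 2^-1 = 2^-1); last by field.
  rewrite invrK => G F0.
  have S0 : 0 <= S t by apply: le_trans (c'S t [ffun=> 0%N]); rewrite mulr_ge0// exprn_ge0// ltW.
  apply: (@le_trans _ _ (\sum_(a <- F0) S t * `|2^-1 ^+ mdeg a|)).
    apply: ler_sum => a _; rewrite exprMn mulrA normrM ler_wpM2r//.
    by rewrite normrM [X in _ * X]ger0_norm ?exprn_ge0 ?(ltW s0).
  by rewrite -mulr_sumr mulrC ler_wpM2r// G// ?invr_ge0// invf_lt1// ltr1n.
have c'P t (h : 'rV[R]_m) : polydisc (s / 2) h -> sums (fun a => c' t a * monomial_at h a) (f t h).
  move=> hs; have s2 : s / 2 < s by rewrite ltr_pdivrMr// ltr_pMr// ltr1n.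
  have hs' : polydisc (s / 2)%:C (toC h) by move=> i; rewrite mxE normCR lecR; exact: hs.
  have s20 : 0 < s / 2 by rewrite divr_gt0.
  have [_ _ cs] := cP t; have := sums_Re (cs _ _ s20 s2 hs').
  rewrite Ff /=; last by move=> i; exact: le_trans (hs i) (ltW s2).
  by apply: sums_ext => a; rewrite monomial_toC Re_mulC.
have s20 : 0 < s / 2 by rewrite divr_gt0.
have half_le : s / 2 <= s by rewrite ler_pdivrMr// ler_peMr ?ler1n// ltW.
have mc a : measurable_fun setT (c' ^~ a).
  have mc2 := @measurable_power_coef _ T R m (fun t a => c' t a * (s / 2) ^+ mdeg a)
    (fun t => 2 ^+ m * S t) (fun t h => f t ((s / 2) *: h)) c'M.
  have -> : c' ^~ a = (fun t => c' t a * (s / 2) ^+ mdeg a * (s / 2) ^- mdeg a).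
    by apply/funext => t; rewrite mulfK// expf_neq0// gt_eqF.
  have hs2 (h : 'rV[R]_m) : polydisc 1 h -> polydisc (s / 2) ((s / 2) *: h).
    by move=> h1 i; rewrite mxE normrM (gtr0_norm s20) ler_piMr// ltW.
  apply: measurable_funM; last exact: measurable_cst.
  apply: mc2 => [t h h1|h h1].
    by apply: sums_ext (c'P t _ (hs2 _ h1)) => b; rewrite monomialZ mulrA.
  apply: mf => i; apply: le_trans (hs2 _ h1 i) _; exact: half_le.
have P : PS (X := measSpace T R) (s / 2) f (fun t => 2 ^+ m * S t).
  by apply: (@PS_intro _ (measSpace T R) _ _ _ _ _ id (fun a t => c' t a)) => //; exact: mc.
have [M [mM M0 PM]] := PS_tight P; exists M; split => //.
  by move=> t; have /andP[] := M0 t.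
move=> t B FB; have /andP[_ h] := M0 t; rewrite (le_trans h)//.
by rewrite ler_wpM2l ?exprn_ge0//; exact: SB.
Qed.

End RealFromComplex.

(** * Products and quotients of analytic functions *)

Section AnalyticQuotient.
Variables (K : numFieldType) (m : nat).
Hypothesis hK : sum_complete K.
Implicit Types (f g : 'rV[K]_m -> K).
Let X := trivSpace hK.

Lemma analytic_at_mul f g x : analytic_at f x -> analytic_at g x ->
  analytic_at (fun y => f y * g y) x.
Proof.
move=> /(PS_of_analytic X)[r1 [M1 [r10 _ P1]]] /(PS_of_analytic X)[r2 [M2 [r20 _ P2]]].
have [r [r0 rr1 rr2]] : exists r, [/\ 0 < r, r <= r1 & r <= r2].
  have [h|h] := real_leP (gtr0_real r10) (gtr0_real r20); first by exists r1.
  by exists r2; rewrite r20 (ltW h).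
have P := PS_mul (PS_shrink (ltW r0) rr1 P1) (PS_shrink (ltW r0) rr2 P2).
by apply: (PS_analytic_at (t := tt : X) r0 P) => h _.
Qed.

Lemma analytic_at_subc f (k : K) x : analytic_at f x -> analytic_at (fun y => f y - k) x.
Proof.
move=> /(PS_of_analytic X)[r [M [r0 _ P]]].
by apply: (PS_analytic_at (t := tt : X) r0 (PS_sub P (PS_cst X m k r))) => h _.
Qed.

Lemma analytic_at_inv f x : f x != 0 -> analytic_at f x -> analytic_at (fun y => (f y)^-1) x.
Proof.
move=> fx0 /(PS_of_analytic X)[r [M [r0 M0 P]]].
have fx : 0 < `|f x| by rewrite normr_gt0.
(* By [PS_sub0], shrinking the radius by [k] brings the norm of [(f (x + h) - f x) / f x] down to
   [1 / 2], where the geometric series applies. *)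
pose k := `|f x| / (2 * (M + `|f x|)).
have Mf : 0 < M + `|f x| by rewrite ltr_wpDl.
have k0 : 0 < k by rewrite divr_gt0// mulr_gt0.
have k1 : k <= 1.
  by rewrite ler_pdivrMr ?mulr_gt0// mul1r mulrDr addrC ler_wpDr ?mulr_ge0// ler_peMl// ler1n.
have P0 := PS_sub0 (ltW r0) (ltW k0) k1 P.
have P1 := PS_scale (X := X) (k := fun=> (f x)^-1) Logic.I P0.
have h2 : 0 <= 2^-1 :> K by rewrite invr_ge0.
have h21 : 2^-1 < 1 :> K by rewrite invf_lt1// ltr1n.
have P2 : PS (X := X) (k * r) (fun _ h => (f x)^-1 * (f (x + h) - f (x + 0))) (fun=> 2^-1).
  apply: PS_le P1 => _; rewrite normfV.
  rewrite (_ : _ * _ = 2^-1 * (M / (M + `|f x|))); last first.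
    by rewrite /k; field; rewrite !gt_eqF.
  by rewrite ler_piMr// ler_pdivrMr// mul1r lerDl.
have P3 := PS_mul (PS_cst X m (f x)^-1 (k * r)) (PS_inv1p h2 h21 P2).
apply: (PS_analytic_at (t := tt : X) _ P3); first by rewrite mulr_gt0.
move=> h _; rewrite addr0 -invfM mulrDr mulr1 mulrA mulfV// mul1r [f x + _]addrC subrK. by [].
Qed.

Lemma analytic_at_div f g x : g x != 0 -> analytic_at f x -> analytic_at g x ->
  analytic_at (fun y => f y / g y) x.
Proof. by move=> gx fa ga; apply: analytic_at_mul => //; exact: analytic_at_inv. Qed.

End AnalyticQuotient.

Local Open Scope complex_scope.

(** * Polydiscs inside Euclidean balls, and equicontinuity *)

Section Hypotheses.
Variables (R : realType) (m : nat) (x : 'rV[R]_m).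
Local Notation C := R[i].

Lemma normcE (z : C) : `|z| = (Normc.normc z)%:C.
Proof. by case: z => a b; rewrite normc_def. Qed.

Lemma polydisc_Cball (r : R) : 0 < r -> exists2 s0 : R, 0 < s0 &
  forall s h, s <= s0 -> polydisc s%:C h -> Cball x r (toC x + h).
Proof.
(* Even [m + 1] coordinates of this size have Euclidean norm at most [r / 2]; the successor keeps
   the denominator positive for [m = 0]. *)
move=> r0; exists (r / (2 * m.+1%:R)); first by rewrite divr_gt0// mulr_gt0// ltr0n.
move=> s h ss hs; rewrite /Cball/=.
have hn i : Normc.normc (h 0 i) <= r / (2 * m.+1%:R).
  by rewrite -lecR -normcE (le_trans (hs i))// lecR.
set s0 := r / _ in hn.
have s00 : 0 <= s0 by rewrite divr_ge0 ?(ltW r0)// mulr_ge0.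
apply: (@le_lt_trans _ _ (m.+1%:R * s0)); last first.
  have -> : m.+1%:R * s0 = r / 2.
    have : m.+1%:R != 0 :> R by rewrite pnatr_eq0.
    by rewrite /s0; move: m.+1%:R => N N0; field.
  by rewrite ltr_pdivrMr// ltr_pMr// ltr1n.
have N0 : 0 <= m.+1%:R * s0 by rewrite mulr_ge0.
rewrite -(ger0_norm N0) -sqrtr_sqr ler_wsqrtr//.
apply: (@le_trans _ _ (\sum_(i < m) s0 ^+ 2)).
  apply: ler_sum => i _; rewrite mxE addrAC subrr add0r.
  apply: lerXn2r; rewrite ?nnegrE// -ler0c -normcE//.
rewrite sumr_const card_ord [leRHS]exprMn -[leLHS]mulr_natl; apply: ler_wpM2r; first by rewrite exprn_ge0.
rewrite -natrX ler_nat; apply: (@leq_trans m.+1) => //.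
by rewrite leq_pmulr.
Qed.

Lemma equicontinuous_polydisc (f : R -> 'rV[C]_m -> C) (r : R) : 0 < r ->
  equicontinuous [set: R] (fun z (theta : subspace (Cball x r)) => f z theta) ->
  forall e : R, 0 < e -> exists2 s0 : R, 0 < s0 &
    forall s h z, s <= s0 -> polydisc s%:C h -> `|f z (toC x + h) - f z (toC x)| <= e%:C.
Proof.
move=> r0 ef e e0; have eC : 0 < e%:C :> C by rewrite ltcR.
have H0 := ef (toC x) _ (@entourage_ball _ C (PosNum eC)).
have xA : Cball x r (toC x).
  have [s s0 /(_ s 0 (lexx _))] := polydisc_Cball r0; rewrite addr0; apply => i.
  by rewrite mxE normr0 ler0c ltW.
have : within (Cball x r) (nbhs (toC x)) (fun y => forall z, [set: R] z -> ball (f z (toC x)) e%:C (f z y)).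
  by rewrite nbhs_subspace_in//; exact: H0.
move=> /nbhs_ballP[d /= d0 dP].
have [s1 s10 s1P] := polydisc_Cball r0.
have [d' dE] := real_part (ltW d0); rewrite dE ltcR in d0.
exists (Num.min (d' / 2) s1); first by rewrite lt_min s10 divr_gt0.
move=> s h z ss hs.
have hA : Cball x r (toC x + h) by apply: s1P hs; rewrite (le_trans ss)// ge_min lexx orbT.
have hb : ball (toC x) d (toC x + h).
  split; first by rewrite dE ltcR.
  move=> i j; rewrite (ord1 i) /ball/= dE.
  rewrite !mxE opprD addrA subrr sub0r normrN (le_lt_trans (hs j))// ltcR.
  by rewrite (le_lt_trans ss)// gt_min ltr_pdivrMr// ltr_pMr// ltr1n.
have := dP _ hb hA z Logic.I; rewrite /ball/= distrC; exact: ltW.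
Qed.

End Hypotheses.

Local Open Scope complex_scope.

Lemma open_polydisc (R : realType) m (Om : set 'rV[R]_m) (x : 'rV[R]_m) : open Om -> Om x ->
  exists2 s0 : R, 0 < s0 & forall s h, s <= s0 -> polydisc s h -> Om (x + h).
Proof.
move=> oO Ox; have /nbhs_ballP[d /= d0 dP] := open_nbhs_nbhs (conj oO Ox).
exists (d / 2); first by rewrite divr_gt0.
move=> s h ss hs; apply: dP; split => // i j; rewrite (ord1 i) /ball/=.
rewrite !mxE opprD addrA subrr sub0r normrN (le_lt_trans (hs j))// (le_lt_trans ss)//.
by rewrite ltr_pdivrMr// ltr_pMr// ltr1n.
Qed.

Lemma toCD (R : realType) m (x h : 'rV[R]_m) : toC (x + h) = toC x + toC h.
Proof. by apply/rowP => i; rewrite !mxE rmorphD. Qed.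

Lemma polydisc_toC (R : realType) m (s : R) (h : 'rV[R]_m) :
  polydisc s h -> polydisc s%:C (toC h).
Proof. by move=> hs i; rewrite mxE normCR lecR. Qed.

Lemma envelope_bound (R : realType) m (M s : R) (G : 'rV[R[i]]_m -> R[i]) (env : \bar R) :
  (0 <= env)%E ->
  (forall h, polydisc s%:C h -> ((Normc.normc (G h))%:E <= env)%E) ->
  (forall B : R, (forall h, polydisc s%:C h -> `|G h| <= B%:C) -> M <= 2 ^+ m * B) ->
  (M%:E <= (2 ^+ m)%:E * env)%E.
Proof.
case: env => [B| |] // _ GB MB.
  rewrite -EFinM lee_fin; apply: MB => h hs.
  by rewrite normcE lecR -lee_fin; exact: GB.
by rewrite gt0_muley ?leey// lte_fin exprn_gt0.
Qed.

(** * The channel densities as majorised power series *)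

Section ChannelInputs.
Variables (R : realType) (l m : nat) (Om : set 'rV[R]_m) (q : 'rV[R]_m -> R -> 'I_l -> R)
  (qC : 'rV[R[i]]_m -> R -> 'I_l -> R[i]) (x : 'rV[R]_m) (I : 'I_l).
Local Notation C := R[i].
Local Notation X := (measSpace (measurableTypeR R) R).
Local Notation mu := (@lebesgue_measure R).
Hypothesis oOm : open Om.
Hypothesis hq : forall theta y, Om theta -> probability_density (fun z => q theta z y).
Hypothesis Omx : Om x.
Hypothesis hb : forall y z, 0 < q x z y.
Variables (r2 : R).
Hypothesis r20 : 0 < r2.
Hypothesis qCan : forall y z, analytic_extension Om (Cball x r2)
  (fun theta => q theta z y) (fun theta => qC theta z y).

Lemma common_radius (r : R) : 0 < r -> exists2 s0 : R, 0 < s0 & forall s, s <= s0 ->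
  (forall h, polydisc s%:C h -> Cball x r (toC x + h)) /\
  (forall h, polydisc s h -> Om (x + h)).
Proof.
move=> r0; have [s1 s10 h1] := polydisc_Cball x r0; have [s2 s20 h2] := open_polydisc oOm Omx.
exists (Num.min s1 s2); first by rewrite lt_min s10.
move=> s; rewrite le_min => /andP[ss1 ss2]; split => h hs; first exact: h1 hs.
exact: h2 hs.
Qed.

Lemma qC_real y z s h : (forall h, polydisc s%:C h -> Cball x r2 (toC x + h)) ->
  (forall h, polydisc s h -> Om (x + h)) -> polydisc s h ->
  qC (toC x + toC h) z y = (q (x + h) z y)%:C.
Proof.
move=> hC hO hs; rewrite -toCD; apply: (qCan y z).2; first exact: hO.
by rewrite toCD; apply: hC; exact: polydisc_toC.
Qed.

Lemma polydisc0 (K : numFieldType) n (s : K) : 0 < s -> polydisc s (0 : 'rV[K]_n).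
Proof. by move=> s0 i; rewrite mxE normr0 ltW. Qed.

Lemma toC0 n : toC (0 : 'rV[R]_n) = 0.
Proof. by apply/rowP => i; rewrite !mxE. Qed.

Lemma qC_center y z : qC (toC x) z y = (q x z y)%:C.
Proof.
have [s s0 /(_ s (lexx _))[h1 h2]] := common_radius r20.
have := qC_real y z h1 h2 (polydisc0 s0).
by rewrite toC0 !addr0.
Qed.

Lemma PS_density : mu.-integrable setT (fun z => sup_envelope qC x r2 z) ->
  forall j, exists (s : R) (M : R -> R), [/\ 0 < s, measurable_fun setT (M : measurableTypeR R -> R),
    forall z, 0 <= M z, mu.-integrable setT (EFin \o M) &
    PS (X := X) s (fun z h => q (x + h) z j) M].
Proof.
move=> ienv j; have [s s0 /(_ s (lexx _))[h1 h2]] := common_radius r20.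
have [||| M [mM M0 MB MP]] := @PS_of_complex R _ (measurableTypeR R) m (fun z h => q (x + h) z j)
  (fun z theta => qC theta z j) x s s0.
- by move=> z h hs; apply: (qCan j z).1; exact: h1.
- by move=> z h hs; exact: qC_real h1 h2 hs.
- by move=> h hs; have [] := hq j (h2 h hs).
exists (s / 2), M; split => //; first by rewrite divr_gt0.
have i2 := integrableZl measurableT (2 ^+ m) ienv.
apply: le_integrable i2 => //; first exact/measurable_EFinP.
move=> z _ /=; rewrite (ger0_norm (M0 z)).
have ub h : polydisc s%:C h -> ((Normc.normc (qC (toC x + h) z j))%:E <= sup_envelope qC x r2 z)%E.
  by move=> hs; apply: ereal_sup_ubound; exists j => //; exists (toC x + h) => //; exact: h1.
have e0 : (0 <= sup_envelope qC x r2 z)%E.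
  have sC : 0 < s%:C :> C by rewrite ltcR.
  by apply: le_trans (ub 0 (polydisc0 sC)); rewrite lee_fin -ler0c -normcE.
rewrite gee0_abs; last by apply: mule_ge0 => //; rewrite lee_fin exprn_ge0.
apply: (@envelope_bound _ _ _ s (fun h => qC (toC x + h) z j)) => //.
exact: MB.
Qed.

Lemma PS_density_log (L : 'rV[C]_m -> R -> C) (r : R) : 0 < r ->
  (forall z, analytic_extension Om (Cball x r) (fun theta => ln (q theta z I)) (fun theta => L theta z)) ->
  (forall j, (\int[mu]_z ereal_sup [set (Normc.normc (qC theta z j * L theta z))%:E |
     theta in Cball x r] < +oo)%E) ->
  forall j, exists (s : R) (M : R -> R), [/\ 0 < s, measurable_fun setT (M : measurableTypeR R -> R),
    forall z, 0 <= M z, mu.-integrable setT (EFin \o M) &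
    PS (X := X) s (fun z h => q (x + h) z j * ln (q (x + h) z I)) M].
Proof.
move=> r0 Lan iL j.
have [s1 s10 h1] := common_radius r20; have [s2 s20 h2] := common_radius r0.
pose s := Num.min s1 s2.
have s0 : 0 < s by rewrite lt_min s10.
have [|hC hO] := h1 s; first by rewrite ge_min lexx.
have [|hC' _] := h2 s; first by rewrite ge_min lexx orbT.
have [||| M [mM M0 MB MP]] := @PS_of_complex R _ (measurableTypeR R) m
  (fun z h => q (x + h) z j * ln (q (x + h) z I))
  (fun z theta => qC theta z j * L theta z) x s s0.
- move=> z h hs; apply: (analytic_at_mul (@sum_complete_complex R)).
    by apply: (qCan j z).1; exact: hC.
  by apply: (Lan z).1; exact: hC'.
- move=> z h hs; rewrite (qC_real j z hC hO hs) rmorphM; congr (_ * _).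
  by rewrite -toCD; apply: (Lan z).2; [exact: hO|rewrite toCD; apply: hC'; exact: polydisc_toC].
- move=> h hs; have [m1 _ _] := hq j (hO h hs); have [m2 _ _] := hq I (hO h hs).
  by apply: measurable_funM => //; apply: measurableT_comp (@measurable_ln R) m2.
exists (s / 2), M; split => //; first by rewrite divr_gt0.
(* [N] lies below the supremum in the integrability hypothesis. That supremum is not known to be
   measurable, hence the comparison by [ge0_le_integral_lower]. *)
pose N z := M z * 2 ^- m.
have N0 z : 0 <= N z by rewrite mulr_ge0// invr_ge0 exprn_ge0.
have mN : measurable_fun setT (N : measurableTypeR R -> R).
  by apply: measurable_funM => //; exact: measurable_cst.
suff iN : mu.-integrable setT (EFin \o N).
  have -> : M = (fun z => N z * 2 ^+ m).
    by apply/funext => z; rewrite /N mulfVK// expf_neq0.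
  exact: integrableM_cst.
apply/integrableP; split; first exact/measurable_EFinP.
apply: le_lt_trans (iL j); apply: ge0_le_integral_lower => z /=; first by rewrite lee_fin.
rewrite (ger0_norm (N0 z)).
set env := ereal_sup _.
have ub h : polydisc s%:C h -> ((Normc.normc (qC (toC x + h) z j * L (toC x + h) z))%:E <= env)%E.
  by move=> hs; apply: ereal_sup_ubound; exists (toC x + h) => //; exact: hC'.
have e0 : (0 <= env)%E.
  have sC : 0 < s%:C :> C by rewrite ltcR.
  by apply: le_trans (ub 0 (polydisc0 sC)); rewrite lee_fin -ler0c -normcE.
have := @envelope_bound _ _ _ s (fun h => qC (toC x + h) z j * L (toC x + h) z) env e0 ub (MB z).
rewrite /N; case: env e0 ub => [B| |]// _ _; last by rewrite leey.
by rewrite -EFinM !lee_fin => h; rewrite ler_pdivrMr ?exprn_gt0// mulrC.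
Qed.

Lemma qC_ratio_center j z : qC (toC x) z j / qC (toC x) z I = (q x z j / q x z I)%:C.
Proof. by rewrite !qC_center fmorph_div. Qed.

Hypothesis hd1 : exists2 r : R, 0 < r & forall j, equicontinuous [set: R]
  (fun z (theta : subspace (Cball x r)) => qC theta z j / qC theta z I).

Lemma ratio_close j (e : R) : 0 < e -> exists2 s0 : R, 0 < s0 & forall s h z, s <= s0 ->
  polydisc s%:C h -> `|qC (toC x + h) z j / qC (toC x + h) z I - (q x z j / q x z I)%:C| <= e%:C.
Proof.
move=> e0; have [r r0 er] := hd1.
have [s0 s00 sP] := equicontinuous_polydisc r0 (er j) e0.
by exists s0 => // s h z ss hs; rewrite -qC_ratio_center; exact: sP hs.
Qed.

(** At [j = I] the ratio is 1 at the centre, whereas a zero of the denominator makes it 0 by the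
    convention on division; equicontinuity excludes such a jump. *)
Lemma qC_neq0 : exists2 s0 : R, 0 < s0 & forall s h z, s <= s0 -> polydisc s%:C h ->
  qC (toC x + h) z I != 0.
Proof.
have h2 : 0 < 2^-1 :> R by rewrite invr_gt0.
have [s0 s00 sP] := ratio_close I h2.
exists s0 => // s h z ss hs; apply/eqP => q0; have := sP s h z ss hs.
rewrite q0 mul0r sub0r normrN normCR lecR divff ?gt_eqF// normr1.
by rewrite leNgt invf_lt1 ?ltr1n.
Qed.

Lemma density_gt0 : exists2 s0 : R, 0 < s0 & forall s h z, s <= s0 -> polydisc s h ->
  0 < q (x + h) z I.
Proof.
have [s1 s10 h1] := qC_neq0; have [s2 s20 h2] := common_radius r20.
exists (Num.min s1 s2); first by rewrite lt_min s10.
move=> s h z; rewrite le_min => /andP[ss1 ss2] hs; have [hC hO] := h2 s ss2.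
have [_ q0 _] := hq I (hO h hs); rewrite lt_def q0 andbT.
have := h1 s (toC h) z ss1 (polydisc_toC hs).
by rewrite (qC_real I z hC hO hs); apply: contra => /eqP ->.
Qed.

(** Equicontinuity makes the complex variation of the ratio small uniformly in [z], which yields a
    constant majorant as small as desired. *)
Lemma PS_ratio j (e : R) : 0 < e -> exists2 s : R, 0 < s &
  PS (X := X) s (fun z h => q (x + h) z j / q (x + h) z I - q x z j / q x z I) (fun=> e).
Proof.
move=> e0; have e1 : 0 < e / 2 ^+ m by rewrite divr_gt0// exprn_gt0.
have [s1 s10 h1] := qC_neq0; have [s2 s20 h2] := common_radius r20.
have [s3 s30 h3] := ratio_close j e1.
pose s := Num.min s1 (Num.min s2 s3).
have s0 : 0 < s by rewrite !lt_min s10 s20.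
have ss1 : s <= s1 by rewrite ge_min lexx.
have ss2 : s <= s2 by rewrite !ge_min lexx orbT.
have ss3 : s <= s3 by rewrite !ge_min lexx !orbT.
have [hC hO] := h2 s ss2.
have [||| M [mM M0 MB MP]] := @PS_of_complex R _ (measurableTypeR R) m
  (fun z h => q (x + h) z j / q (x + h) z I - q x z j / q x z I)
  (fun z theta => qC theta z j / qC theta z I - (q x z j / q x z I)%:C) x s s0.
- move=> z h hs; have hK := @sum_complete_complex R.
  apply: analytic_at_subc => //; apply: analytic_at_div => //; first exact: h1 hs.
    by apply: (qCan j z).1; exact: hC.
  by apply: (qCan I z).1; exact: hC.
- by move=> z h hs; rewrite !(qC_real _ z hC hO hs) -fmorph_div -rmorphB.
- have mx y : measurable_fun setT ((q x)^~ y : measurableTypeR R -> R) by have [] := hq y Omx.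
  move=> h hs; have mh y : measurable_fun setT ((q (x + h))^~ y : measurableTypeR R -> R).
    by have [] := hq y (hO h hs).
  by apply: measurable_funB; exact: measurable_div.
exists (s / 2); first by rewrite divr_gt0.
apply: PS_le MP => z; have := MB z (e / 2 ^+ m).
rewrite [_ * (e / _)]mulrC divfK ?expf_neq0//; apply => h hs; exact: h3 hs.
Qed.

Hypothesis qcont : forall y, {within [set: R] `*` Cball x r2,
  continuous (fun zt : R * 'rV[C]_m => qC zt.2 zt.1 y)}.

Lemma density_continuous y : continuous (fun z => q x z y).
Proof.
move=> z; apply/cvgrPdist_le => e e0.
have xA : Cball x r2 (toC x).
  have [s s0 /(_ s (lexx _))[h1 h2]] := common_radius r20.
  by have := h1 0; rewrite addr0; apply; apply: polydisc0; rewrite ltcR.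
have := (subspace_continuousP _ _).1 (@qcont y) (z, toC x) (conj Logic.I xA).
have eC : 0 < e%:C :> C by rewrite ltcR.
have nb : nbhs (qC (toC x) z y) (ball (qC (toC x) z y) e%:C).
  exact: (@nbhsx_ballx _ C).
move=> /(_ _ nb)[[P Q]/= [nP nQ] PQ].
apply: filterS nP => w Pw; have := PQ (w, toC x) (conj Pw (nbhs_singleton nQ)) (conj Logic.I xA).
by rewrite /ball/= /from_subspace/= !qC_center -rmorphB normCR ltcR => /ltW.
Qed.

Hypothesis htail : exists2 r : R, 0 < r & forall e : R, 0 < e ->
  exists2 Sigma : set R, compact Sigma & forall z j theta, ~ Sigma z -> j != I -> Cball x r theta ->
    Normc.normc (qC theta z j / qC theta z I) <= e.

(** The tail condition with [e = 1] bounds the ratios off a compact set, on which continuity bounds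
    them. *)
Lemma ratio_bounded : exists2 A : R, 1 <= A & forall z j, q x z j / q x z I <= A.
Proof.
have [r r0 /(_ 1 ltr01)[S cS SP]] := htail.
have xA : Cball x r (toC x).
  have [s s0 /(_ s (lexx _))[h1 h2]] := common_radius r0.
  by have := h1 0; rewrite addr0; apply; apply: polydisc0; rewrite ltcR.
have /choice[A AP] : forall j, exists A, forall z, q x z j / q x z I <= A.
  move=> j.
  have cj : continuous (fun z => q x z j / q x z I).
    move=> z; apply: cvgM; first exact: density_continuous.
    by apply: cvgV; [rewrite gt_eqF|exact: density_continuous].
  have := continuous_compact (continuous_subspaceT cj) cS.
  move=> /compact_bounded[B [Br BP]].
  exists (Num.max 1 (B + 1)) => z; rewrite le_max.
  have [->|jI] := eqVneq j I; first by rewrite divff ?gt_eqF// lexx.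
  have [Sz|nSz] := pselect (S z).
    have := BP (B + 1); rewrite ltrDl ltr01 => /(_ isT (q x z j / q x z I)).
    move=> h; apply/orP; right; apply: le_trans (ler_norm _) (h _).
    by exists z.
  have := SP z j _ nSz jI xA; rewrite qC_ratio_center => h; apply/orP; left.
  by move: h; rewrite -lecR -normcE normCR lecR; apply: le_trans; exact: ler_norm.
exists (\sum_j `|A j| + 1); first by rewrite lerDr sumr_ge0.
move=> z j; rewrite (le_trans (AP j z))// (bigD1 j)//= -addrA.
by rewrite (le_trans (ler_norm _))// lerDl addr_ge0 ?sumr_ge0.
Qed.

End ChannelInputs.

(** * Tuples of observations *)

Section TupleMeasurability.
Variable R : realType.
Local Notation BR := (measurableTypeR R).

Lemma measurable_thead n : measurable_fun setT (fun w : n.+1.-tuple BR => thead w).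
Proof. exact: measurable_tnth. Qed.

Lemma measurable_tbehead n : measurable_fun setT (fun w : n.+1.-tuple BR => [tuple of behead w]).
Proof. exact: measurable_behead. Qed.

Lemma measurable_thead_comp n (f : BR -> R) : measurable_fun setT f ->
  measurable_fun setT (fun w : n.+1.-tuple BR => f (thead w)).
Proof. by move=> mf; exact: (measurableT_comp mf (@measurable_thead n)). Qed.

Lemma measurable_tbehead_comp n (f : n.-tuple BR -> R) : measurable_fun setT f ->
  measurable_fun setT (fun w : n.+1.-tuple BR => f [tuple of behead w]).
Proof. by move=> mf; exact: (measurableT_comp mf (@measurable_tbehead n)). Qed.

(** Tuples run from the oldest observation to the newest: this forgets the newest one, while
    [behead] forgets the oldest. *)
Definition tbelast n (w : n.+1.-tuple BR) : n.-tuple BR :=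
  [tuple tnth w (widen_ord (leqnSn n) i) | i < n].

Lemma measurable_tbelast n : measurable_fun setT (@tbelast n).
Proof.
apply/measurable_fun_tnthP => i; rewrite (_ : _ \o _ = fun w => tnth w (widen_ord (leqnSn n) i)).
  exact: measurable_tnth.
by apply/funext => w; rewrite /= tnth_mktuple.
Qed.

Lemma tbelast_cons n (w : n.+2.-tuple BR) :
  tbelast w = [tuple of thead w :: tbelast [tuple of behead w]].
Proof.
apply/eq_from_tnth => i; rewrite tnth_mktuple.
case: (unliftP ord0 i) => [j ->|->]; last by rewrite tnth0; congr tnth; exact: val_inj.
rewrite tnthS tnth_mktuple tnth_behead; congr tnth; apply: val_inj => /=.
by rewrite inordK// ltnS; exact: leq_trans (ltn_ord j) (leqnSn n).
Qed.

Lemma tuple_consE n (w : n.+1.-tuple BR) : (w : seq R) = thead w :: behead w.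
Proof. by case/tupleP: w => z w; rewrite theadE. Qed.

End TupleMeasurability.

Lemma PS_weighted (R : realType) (X : coefSpace R) (l m : nat) (r phi A : R)
    (a : 'I_l -> X -> R) (f : 'I_l -> X -> 'rV[R]_m -> R) : 0 <= phi ->
  (forall j, adm (a j)) -> (forall t, \sum_j `|a j t| <= A) ->
  (forall j, PS r (f j) (fun=> phi)) ->
  PS r (fun t h => \sum_j a j t * f j t h) (fun=> A * phi).
Proof.
move=> p0 ma aA fp; have P := PS_sum (P := predT) (fun j _ => PS_scale (ma j) (fp j)).
by apply: PS_le P => t; rewrite -mulr_suml ler_wpM2r.
Qed.

Lemma PS_lift (R : realType) (X X' : coefSpace R) (m : nat) (r M : R) (t0 : X)
    (f : 'rV[R]_m -> R) : PS (X := X) r (fun _ => f) (fun=> M) -> PS (X := X') r (fun _ => f) (fun=> M).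
Proof.
move=> [a [c [_ /(_ t0)cP]]]; exists a, (fun n _ => c n t0); split => // n.
exact: adm_cst.
Qed.

(** * Contraction of the normalised backward recursion *)

Section Filter.
Variables (R : realType) (l m : nat) (I : 'I_l).
Local Notation BR := (measurableTypeR R).
Variables (K : 'rV[R]_m -> R -> 'I_l -> 'I_l -> R) (s : R -> 'I_l -> R) (c C r : R).
Hypothesis c0 : 0 < c.
Hypothesis c1 : c <= 1.
Hypothesis r0 : 0 < r.
Hypothesis hKs : forall z i j, c * s z j <= K 0 z i j <= s z j.
Hypothesis hs : forall z j, 0 <= s z j <= C.
Hypothesis sI : forall z, s z I = 1.
Hypothesis ms : forall j, measurable_fun setT (s ^~ j : BR -> R).
Hypothesis mK : forall i j, measurable_fun setT ((fun z => K 0 z i j) : BR -> R).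
(** Since [beta0 w j / beta0 (z :: w) i <= c ^- 2], the [l] entries of a perturbation of this size
    weigh at most [c / 32] together. *)
Let d1 := c ^+ 3 / (32 * l%:R).
Hypothesis hK : forall i j, PS (X := measSpace BR R) r (fun z h => K h z i j - K 0 z i j) (fun=> d1).

(** Backward likelihoods at the base point: when [K] is the transition kernel weighted by ratios of
    channel densities, this is, up to a factor independent of [i], the density of [w] given the
    hidden state [i] just before it. *)
Fixpoint beta0 (w : seq R) : 'I_l -> R :=
  if w is z :: w' then fun i => \sum_j K 0 z i j * beta0 w' j else fun=> 1.

Let mass z w := \sum_j s z j * beta0 w j.
Let nu z w j := s z j * beta0 w j / mass z w.

(** The perturbed backward vector is [beta0 w * (1 + dev h w)], relevant only up to a scalar. The
    denominator spends this freedom: it contains [c] times the average of [dev] under [nu], which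
    cancels the part of the linear map common to all [i]. *)
Fixpoint dev (h : 'rV[R]_m) (w : seq R) : 'I_l -> R :=
  if w is z :: w' then fun i =>
    (\sum_j K h z i j * (beta0 w' j * (1 + dev h w' j))) /
      (beta0 w i * (1 + c * \sum_j nu z w' j * dev h w' j)) - 1
  else fun=> 0.

Definition nrm h z w := 1 + c * \sum_j nu z w j * dev h w j.
Definition pert h w j := beta0 w j * (1 + dev h w j).

(** Each entry for [z :: w] lies between [c * mass z w] and [mass z w], so one step suffices to make
    all entries comparable. *)
Lemma beta0_bounds w : (forall j, 0 < beta0 w j) /\ (forall i j, c * beta0 w j <= beta0 w i).
Proof.
elim: w => [|z w [IH1 IH2]] /=; first by split => // i j; rewrite mulr1.
have S0 : 0 < mass z w.
  rewrite /mass (bigD1 I)//= sI mul1r ltr_wpDr// sumr_ge0// => j _.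
  by rewrite mulr_ge0 ?(ltW (IH1 j))//; case/andP: (hs z j).
have lo i : c * mass z w <= \sum_j K 0 z i j * beta0 w j.
  rewrite /mass mulr_sumr; apply: ler_sum => j _; rewrite mulrA ler_wpM2r ?(ltW (IH1 j))//.
  by case/andP: (hKs z i j).
have hi i : \sum_j K 0 z i j * beta0 w j <= mass z w.
  apply: ler_sum => j _; rewrite ler_wpM2r ?(ltW (IH1 j))//.
  by case/andP: (hKs z i j).
split => [j|i j]; first by apply: lt_le_trans (lo j); rewrite mulr_gt0.
by apply: le_trans (lo i); rewrite ler_wpM2l ?(ltW c0).
Qed.

Lemma beta0_gt0 w j : 0 < beta0 w j. Proof. exact: (beta0_bounds w).1. Qed.

Lemma mass_gt0 z w : 0 < mass z w.
Proof.
rewrite /mass (bigD1 I)//= sI mul1r ltr_wpDr ?beta0_gt0// sumr_ge0// => j _.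
by rewrite mulr_ge0 ?(ltW (beta0_gt0 _ _))//; case/andP: (hs z j).
Qed.

Let W0 z w i j := K 0 z i j * beta0 w j / beta0 (z :: w) i.
Let E h z w i j := (K h z i j - K 0 z i j) * (beta0 w j / beta0 (z :: w) i).

Lemma beta0_ratio z w i j : 0 <= beta0 w j / beta0 (z :: w) i <= c ^- 2.
Proof.
have b0 := beta0_gt0 w j; have b1 := beta0_gt0 (z :: w) i.
have hb : c * beta0 w I <= beta0 (z :: w) i.
  rewrite /= (bigD1 I)//= ler_wpDr//.
    apply: sumr_ge0 => k _; rewrite mulr_ge0 ?(ltW (beta0_gt0 _ _))//.
    by case/andP: (hKs z i k) => h _; rewrite (le_trans _ h)// mulr_ge0 ?(ltW c0)//; case/andP: (hs z k).
  by rewrite ler_wpM2r ?(ltW (beta0_gt0 _ _))//; case/andP: (hKs z i I); rewrite sI mulr1.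
move: (beta0 (z :: w) i) b1 hb => b b1 hb.
apply/andP; split; first by rewrite divr_ge0 ?(ltW b0) ?(ltW b1).
rewrite ler_pdivrMr// mulrC ler_pdivlMr ?exprn_gt0//; apply: le_trans hb.
rewrite mulrC expr2 -mulrA ler_wpM2l ?(ltW c0)//; exact: (beta0_bounds w).2.
Qed.

Lemma W0_sum z w i : \sum_j W0 z w i j = 1.
Proof. by rewrite /W0 -mulr_suml divff// gt_eqF//; exact: (beta0_gt0 (z :: w) i). Qed.

Lemma nu_sum z w : \sum_j nu z w j = 1.
Proof. by rewrite /nu -mulr_suml divff// gt_eqF//; exact: mass_gt0. Qed.

Lemma nu_ge0 z w j : 0 <= nu z w j.
Proof.
rewrite /nu divr_ge0 ?(ltW (mass_gt0 _ _))// mulr_ge0 ?(ltW (beta0_gt0 _ _))//.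
by case/andP: (hs z j).
Qed.

(** Doeblin minorisation: all rows of the stochastic matrix [W0] dominate [c] times the same
    probability vector [nu]. *)
Lemma W0_nu z w i j : 0 <= W0 z w i j - c * nu z w j.
Proof.
rewrite subr_ge0 /W0 /nu.
have b1 := beta0_gt0 (z :: w) i; have S0 := mass_gt0 z w.
have sb : 0 <= s z j * beta0 w j by rewrite mulr_ge0 ?(ltW (beta0_gt0 _ _))//; case/andP: (hs z j).
have bm : beta0 (z :: w) i <= mass z w.
  apply: ler_sum => k _; rewrite ler_wpM2r ?(ltW (beta0_gt0 _ _))//.
  by case/andP: (hKs z i k).
apply: (@le_trans _ _ (c * (s z j * beta0 w j / beta0 (z :: w) i))).
  by apply: ler_wpM2l; [exact: ltW|apply: ler_wpM2l => //; rewrite lef_pV2 ?posrE].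
rewrite !mulrA; apply: ler_wpM2r; first by rewrite invr_ge0 ltW.
by rewrite ler_wpM2r ?(ltW (beta0_gt0 _ _))//; case/andP: (hKs z i j).
Qed.

Lemma W0_nu_sum z w i : \sum_j (W0 z w i j - c * nu z w j) = 1 - c.
Proof. by rewrite sumrB W0_sum -mulr_sumr nu_sum mulr1. Qed.

Lemma pert_cons h z w i : nrm h z w != 0 -> pert h (z :: w) i * nrm h z w = \sum_j K h z i j * pert h w j.
Proof.
move=> n0; rewrite /pert /= addrC subrK -/(nrm h z w).
by rewrite mulrA [X in X * nrm _ _ _]mulrC -mulrA -/(beta0 (z :: w) i); field;
  rewrite n0 -[X in X != 0]/(beta0 (z :: w) i) gt_eqF ?beta0_gt0.
Qed.

Lemma K_beta0 h z w i j : K h z i j * beta0 w j / beta0 (z :: w) i = W0 z w i j + E h z w i j.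
Proof. by rewrite /W0 /E -/(beta0 _); ring. Qed.

(** Up to division by [nrm] the recursion is affine; its unperturbed linear part has nonnegative
    entries with row sums [1 - c], because [nrm] has absorbed the common part. *)
Lemma dev_cons h z w i : nrm h z w != 0 -> dev h (z :: w) i =
  (\sum_j (W0 z w i j - c * nu z w j) * dev h w j +
   \sum_j E h z w i j * (1 + dev h w j)) / nrm h z w.
Proof.
move=> n0; have b0 : beta0 (z :: w) i != 0 by rewrite gt_eqF ?beta0_gt0.
have -> : dev h (z :: w) i = (\sum_j K h z i j * pert h w j) / beta0 (z :: w) i / nrm h z w - 1.
  by rewrite /= -/(beta0 (z :: w) i) invfM mulrA.
apply: (mulIf n0); rewrite divfK// mulrBl divfK// mul1r mulr_suml.
have -> : \sum_j K h z i j * pert h w j / beta0 (z :: w) i =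
    \sum_j W0 z w i j + \sum_j W0 z w i j * dev h w j + \sum_j E h z w i j * (1 + dev h w j).
  rewrite -!big_split/=; apply: eq_bigr => j _.
  have -> : K h z i j * pert h w j / beta0 (z :: w) i =
      K h z i j * beta0 w j / beta0 (z :: w) i * (1 + dev h w j) by rewrite /pert; ring.
  by rewrite K_beta0; ring.
rewrite W0_sum /nrm.
under [in RHS]eq_bigr do rewrite mulrBl.
rewrite sumrB mulr_sumr.
under [X in _ = _ - X + _]eq_bigr do rewrite -mulrA.
ring.
Qed.

Local Notation T n := (measSpace (n.-tuple BR) R).

Lemma measurable_beta0 n j : measurable_fun setT (fun w : n.-tuple BR => beta0 w j).
Proof.
elim: n j => [|n IH] i.
  rewrite (_ : (fun _ => _) = fun=> 1); first exact: measurable_cst.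
  by apply/funext => w; rewrite (tuple0 w).
rewrite (_ : (fun _ => _) = fun w : n.+1.-tuple BR =>
    \sum_j K 0 (thead w) i j * beta0 [tuple of behead w] j).
  apply: measurable_sum => j; apply: measurable_funM.
    exact: (measurable_thead_comp (mK i j)).
  exact: (measurable_tbehead_comp (IH j)).
by apply/funext => w; rewrite [in LHS]tuple_consE.
Qed.

Lemma measurable_nu n j :
  measurable_fun setT (fun w : n.+1.-tuple BR => nu (thead w) [tuple of behead w] j).
Proof.
have ms' k : measurable_fun setT (fun w : n.+1.-tuple BR => s (thead w) k * beta0 [tuple of behead w] k).
  apply: measurable_funM; first exact: (measurable_thead_comp (ms k)).
  exact: (measurable_tbehead_comp (measurable_beta0 k)).
by apply: measurable_div; [exact: ms'|exact: measurable_sum].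
Qed.

Lemma measurable_beta0_cons n i :
  measurable_fun setT (fun w : n.+1.-tuple BR => beta0 (thead w :: [tuple of behead w]) i).
Proof.
rewrite (_ : (fun _ => _) = fun w : n.+1.-tuple BR => beta0 w i); first exact: measurable_beta0.
by apply/funext => w; rewrite [in RHS]tuple_consE.
Qed.

Lemma measurable_W0nu n i j : measurable_fun setT (fun w : n.+1.-tuple BR =>
  W0 (thead w) [tuple of behead w] i j - c * nu (thead w) [tuple of behead w] j).
Proof.
apply: measurable_funB; last first.
  by apply: measurable_funM; [exact: measurable_cst|exact: measurable_nu].
apply: measurable_div; last exact: measurable_beta0_cons.
apply: measurable_funM; first exact: (measurable_thead_comp (mK i j)).
exact: (measurable_tbehead_comp (measurable_beta0 j)).
Qed.

Lemma d1_ge0 : 0 <= d1.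
Proof. by rewrite divr_ge0 ?mulr_ge0 ?exprn_ge0// ltW. Qed.

Lemma d1E : l%:R * (d1 * c ^- 2) = c / 32.
Proof.
have l0 : l%:R != 0 :> R by rewrite pnatr_eq0 -lt0n; apply: leq_ltn_trans (ltn_ord I).
by rewrite /d1; field; rewrite l0 gt_eqF.
Qed.

Lemma PS_E n i j :
  PS (X := T n.+1) r (fun w h => E h (thead w) [tuple of behead w] i j) (fun=> d1 * c ^- 2).
Proof.
have mr : measurable_fun setT (fun w : n.+1.-tuple BR =>
    beta0 [tuple of behead w] j / beta0 (thead w :: [tuple of behead w]) i).
  apply: measurable_div; last exact: measurable_beta0_cons.
  exact: (measurable_tbehead_comp (measurable_beta0 j)).
have P := PS_mul (PS_param (@measurable_thead R n) (hK i j)) (PS_adm (X := T n.+1) m r mr).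
apply: PS_le P => w; rewrite ler_wpM2l ?d1_ge0//.
by have /andP[h1 h2] := beta0_ratio (thead w) [tuple of behead w] i j; rewrite ger0_norm.
Qed.

Lemma PS_nrm n : (forall j, PS (X := T n) r (fun w h => dev h w j) (fun=> 8^-1)) ->
  PS (X := T n.+1) r (fun w h => c * \sum_j nu (thead w) [tuple of behead w] j * dev h [tuple of behead w] j)
    (fun=> c / 8).
Proof.
move=> P.
have Pw := @PS_weighted R (T n.+1) l m r 8^-1 1 _ _ _ (@measurable_nu n) _
  (fun j => PS_param (@measurable_tbehead R n) (P j)).
apply: PS_le (PS_scale (X := T n.+1) (k := fun=> c) (measurable_cst _) (Pw _ _)) => [t|//|t].
- by rewrite gtr0_norm// mul1r.
- by under eq_bigr do rewrite ger0_norm ?nu_ge0//; rewrite nu_sum.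
Qed.

Lemma c8 : 0 <= c / 8 < 1.
Proof. by rewrite divr_ge0 ?(ltW c0)//= ltr_pdivrMr// mul1r (le_lt_trans c1)// ltr1n. Qed.

Lemma nrm_gt0 n (w : n.+1.-tuple BR) h :
  (forall j, PS (X := T n) r (fun w h => dev h w j) (fun=> 8^-1)) -> polydisc r h ->
  0 < nrm h (thead w) [tuple of behead w].
Proof.
move=> /PS_nrm P hr; have := PS_bound (X := T n.+1) w P hr.
rewrite /nrm; set y := c * _ => /ler_normlP[h1 _]; have /andP[_ h2] := c8.
by rewrite -ltrBlDl sub0r ltrNl (le_lt_trans h1).
Qed.

(** The ball of radius [1 / 8] is invariant: [((1 - c) / 8 + c / 32 * (9 / 8)) / (1 - c / 8) <= 1 /
    8]. *)
Lemma PS_dev n j : PS (X := T n) r (fun w h => dev h w j) (fun=> 8^-1).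
Proof.
elim: n j => [|n IH] i.
  apply: PS_ext (PS_le _ (PS_cst (T 0) m 0 r)) => [t h _|t]; first by rewrite (tuple0 t).
  by rewrite normr0 invr_ge0.
have /andP[c80 c81] := c8.
have PN := PS_inv1p c80 c81 (PS_nrm IH).
have PW := @PS_weighted R (T n.+1) l m r 8^-1 (1 - c) _ _ _ (measurable_W0nu i) _
  (fun j => PS_param (@measurable_tbehead R n) (IH j)).
have PE := PS_sum (P := predT) (fun j _ => PS_mul (PS_E n i j)
  (PS_add (PS_cst (T n.+1) m 1 r) (PS_param (@measurable_tbehead R n) (IH j)))).
have P := PS_mul (PS_add (PW _ _) PE) PN.
apply: PS_ext (PS_le _ (P _ _)) => [w h hr|w||w].
- have n0 := nrm_gt0 w IH hr.
  by rewrite [in RHS]tuple_consE dev_cons// gt_eqF.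
- rewrite sumr_const card_ord normr1 -[_ *+ l]mulr_natl mulrA d1E ler_pdivrMr ?subr_gt0//.
  have := c0; lra.
- by rewrite invr_ge0.
- by under eq_bigr do rewrite ger0_norm ?W0_nu//; rewrite W0_nu_sum.
Qed.

Lemma beta0_cons_ge z w i : c * beta0 w I <= beta0 (z :: w) i.
Proof.
rewrite /= (bigD1 I)//= ler_wpDr//; last first.
  by rewrite ler_wpM2r ?(ltW (beta0_gt0 _ _))//; case/andP: (hKs z i I); rewrite sI mulr1.
apply: sumr_ge0 => k _; rewrite mulr_ge0 ?(ltW (beta0_gt0 _ _))//.
by case/andP: (hKs z i k) => h _; rewrite (le_trans _ h)// mulr_ge0 ?(ltW c0)//; case/andP: (hs z k).
Qed.

Lemma K0_ge0 z i j : 0 <= K 0 z i j.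
Proof.
by case/andP: (hKs z i j) => h _; apply: le_trans h; rewrite mulr_ge0 ?(ltW c0)//; case/andP: (hs z j).
Qed.

Lemma K0_le z i j : K 0 z i j <= C.
Proof. by case/andP: (hKs z i j) => _ /le_trans; apply; case/andP: (hs z j). Qed.

Lemma behead1 (w : 1.-tuple BR) : behead w = [::].
Proof. by case: w => [[|a [|]]]. Qed.

Lemma beta0_tbelast n (w : n.+1.-tuple BR) i : c * beta0 (tbelast w) i <= beta0 w i.
Proof.
elim: n w i => [|n IH] w i.
  rewrite (tuple0 (tbelast w)) mulr1 tuple_consE.
  by have := beta0_cons_ge (thead w) (behead w) i; apply: le_trans; rewrite -[leLHS]mulr1 ler_wpM2l ?(ltW c0)// (behead1 w).
rewrite tbelast_cons [X in _ <= beta0 X i]tuple_consE /= mulr_sumr; apply: ler_sum => j _.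
by rewrite mulrCA ler_wpM2l ?K0_ge0//; exact: (IH [tuple of behead w]).
Qed.

Lemma thead_tbelast n (w : n.+2.-tuple BR) : thead (tbelast w) = thead w.
Proof. by rewrite tbelast_cons theadE. Qed.

Lemma behead_tbelast n (w : n.+2.-tuple BR) :
  [tuple of behead (tbelast w)] = tbelast [tuple of behead w].
Proof. by rewrite tbelast_cons; apply: val_inj. Qed.

Definition rate := 1 - c / 2.

(** In [contraction], [c / 8] comes from the correction [kap * dev], [1 - c] from the contracting
    part, [c / 32] from the perturbation and the denominator from [nrm]. *)
Lemma rate_bound : (c / 8 + (1 - c) + c / 32) / (1 - c / 8) <= rate.
Proof.
rewrite /rate ler_pdivrMr ?subr_gt0; last by have /andP[] := c8.
have := c0; have := sqr_ge0 c; rewrite expr2; lra.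
Qed.

(** Forgetting the newest observation changes the backward vector, up to the scalar [f], by a
    relative error of order [rate ^+ n]. The error propagates by the same linear map as [dev], and
    its part common to all [i] is moved into [f], so that only the contracting part acts. *)
Lemma contraction n : exists (f : n.+1.-tuple BR -> 'rV[R]_m -> R) (D : 'I_l -> n.+1.-tuple BR -> 'rV[R]_m -> R),
  (forall (w : n.+1.-tuple BR) h i, polydisc r h ->
    pert h w i = f w h * pert h (tbelast w) i + beta0 (tbelast w) i * D i w h) /\
  forall i, PS (X := T n.+1) r (D i) (fun=> l%:R * C * (9 / 8) * rate ^+ n).
Proof.
elim: n => [|n [f [D [fD PD]]]].
  (* With a single observation the whole vector counts as error; its norm is at most [9 / 8] times a
     row sum of [K], hence [l * C * (9 / 8)]. *)
  exists (fun _ _ => 0), (fun i (w : 1.-tuple BR) h => pert h w i); split => [w h i _|i].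
    by rewrite mul0r add0r (tuple0 (tbelast w)) mul1r.
  have := PS_mul (PS_adm (X := T 1) m r (measurable_beta0 i)) (PS_add (PS_cst (T 1) m 1 r) (PS_dev 1 i)).
  apply: PS_le => w; rewrite expr0 mulr1 normr1 ger0_norm ?(ltW (beta0_gt0 _ _))//.
  rewrite (_ : 1 + 8^-1 = 9 / 8); last by field.
  rewrite ler_wpM2r// tuple_consE /= (behead1 w)/=.
  apply: (@le_trans _ _ (\sum_(j < l) C)); first by apply: ler_sum => j _; rewrite mulr1 K0_le.
  by rewrite sumr_const card_ord mulr_natl.
set phi := l%:R * C * (9 / 8) * rate ^+ n in PD *.
have phi0 : 0 <= phi by exact: (PS_ge0 (X := T n.+1) [tuple of nseq n.+1 0] (PD I)).
pose x (w : n.+2.-tuple BR) := [tuple of behead w].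
(* The part of the propagated error common to all [i]. Put into [f] it multiplies [1 + dev], which
   leaves [- kap * dev] in the error. *)
pose kap (w : n.+2.-tuple BR) h := c * \sum_j nu (thead (tbelast w)) [tuple of behead (tbelast w)] j * D j (x w) h.
pose S1 i (w : n.+2.-tuple BR) h := \sum_j (W0 (thead (tbelast w)) [tuple of behead (tbelast w)] i j -
  c * nu (thead (tbelast w)) [tuple of behead (tbelast w)] j) * D j (x w) h.
pose S2 i (w : n.+2.-tuple BR) h := \sum_j E h (thead (tbelast w)) [tuple of behead (tbelast w)] i j * D j (x w) h.
pose N k h (w : k.+1.-tuple BR) := nrm h (thead w) [tuple of behead w].
exists (fun (w : n.+2.-tuple BR) h => (f (x w) h * N n h (tbelast w) + kap w h) / N n.+1 h w).
exists (fun i (w : n.+2.-tuple BR) h => (S1 i w h + S2 i w h - kap w h * dev h (tbelast w) i) / N n.+1 h w).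
have thw (w : n.+2.-tuple BR) : thead (tbelast w) = thead w by exact: thead_tbelast.
split => [w h i hr|i].
  have n1 : N n.+1 h w != 0 by rewrite gt_eqF//; apply: nrm_gt0 => // j; exact: PS_dev.
  have n2 : N n h (tbelast w) != 0.
    by rewrite gt_eqF//; apply: (nrm_gt0 (tbelast w)) => // j; exact: PS_dev.
  apply: (mulIf n1); 
  have e1 (a b k : R) : k != 0 -> a / k * b * k = a * b by move=> ?; field.
  have e2 (a b k : R) : k != 0 -> b * (a / k) * k = b * a by move=> ?; field.
  rewrite mulrDl e1// e2//.
  rewrite [in LHS]tuple_consE pert_cons//.
  have fx j : pert h (behead w) j = f (x w) h * pert h (behead (tbelast w)) j +
      beta0 (behead (tbelast w)) j * D j (x w) h.
    by have := fD (x w) h j hr; rewrite -behead_tbelast.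
  under eq_bigr do rewrite fx mulrDr mulrCA [X in _ + X]mulrA.
  rewrite big_split/= -mulr_sumr -(thw w).
  have eB (v : n.+1.-tuple BR) : N n h v != 0 ->
      pert h v i * N n h v = \sum_j K h (thead v) i j * pert h (behead v) j.
    by move=> ?; rewrite [X in pert h X i](tuple_consE v) pert_cons.
  have eS : beta0 (tbelast w) i * (kap w h + S1 i w h + S2 i w h) =
      \sum_j K h (thead (tbelast w)) i j * beta0 (behead (tbelast w)) j * D j (x w) h.
    rewrite /kap /S1 /S2 mulr_sumr -!big_split/= mulr_sumr; apply: eq_bigr => j _.
    have b0 := beta0_gt0 (tbelast w) i.
    have := K_beta0 h (thead (tbelast w)) (behead (tbelast w)) i j.
    rewrite -(tuple_consE (tbelast w)) => kE.
    have -> : K h (thead (tbelast w)) i j * beta0 (behead (tbelast w)) j =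
        (W0 (thead (tbelast w)) (behead (tbelast w)) i j + E h (thead (tbelast w)) (behead (tbelast w)) i j) *
          beta0 (tbelast w) i by rewrite -kE divfK// gt_eqF.
    move: (W0 _ _ _ _) (E _ _ _ _ _) (nu _ _ _) => a1 a2 a3; ring.
  rewrite -eS -eB// /pert; ring.
  have PDx j : PS (X := T n.+2) r (fun w h => D j (x w) h) (fun=> phi).
  exact: (PS_param (@measurable_tbehead R n.+1) (PD j)).
have mv := @measurable_tbelast R n.+1.
have Pk : PS (X := T n.+2) r kap (fun=> c * phi).
  have Pw := @PS_weighted R (T n.+2) l m r phi 1 _ _ phi0
    (fun j => measurableT_comp (@measurable_nu n j) mv) _ PDx.
  apply: PS_le (PS_scale (X := T n.+2) (k := fun=> c) (measurable_cst _) (Pw _)) => t.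
    by rewrite gtr0_norm// mul1r.
  by under eq_bigr do rewrite ger0_norm ?nu_ge0//; rewrite nu_sum.
have P1 : PS (X := T n.+2) r (S1 i) (fun=> (1 - c) * phi).
  apply: (@PS_weighted R (T n.+2) l m r phi (1 - c) _ _ phi0
    (fun j => measurableT_comp (@measurable_W0nu n i j) mv) _ PDx) => t.
  by under eq_bigr do rewrite ger0_norm ?W0_nu//; rewrite W0_nu_sum.
have P2 : PS (X := T n.+2) r (S2 i) (fun=> c / 32 * phi).
  apply: PS_le (PS_sum (P := predT) (fun j _ => PS_mul (PS_param mv (PS_E n i j)) (PDx j))) => t.
  by rewrite sumr_const card_ord -[_ *+ l]mulr_natl mulrA d1E.
have Pe := PS_param mv (PS_dev n.+1 i).
have /andP[c80 c81] := c8.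
have PN := PS_inv1p c80 c81 (PS_nrm (PS_dev n.+1)).
apply: PS_le (PS_mul (PS_sub (PS_add P1 P2) (PS_mul Pk Pe)) PN) => t.
rewrite exprSr [leRHS]mulrA -/phi mulrC.
have -> : (1 - c) * phi + c / 32 * phi + c * phi / 8 = phi * (c / 8 + (1 - c) + c / 32) by ring.
rewrite mulrCA ler_wpM2l//.
by have := rate_bound; rewrite mulrC.
Qed.

(** * Linear functionals of the backward vector *)

Section Functional.
Variables (a : 'rV[R]_m -> R -> 'I_l -> R) (u : R -> 'I_l -> R).
Hypothesis hau : forall z i, c * u z i <= a 0 z i <= u z i.
Hypothesis u0 : forall z i, 0 <= u z i.
Hypothesis uI : forall z, u z I = 1.
Hypothesis ma : forall i, measurable_fun setT ((fun z => a 0 z i) : BR -> R).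
(** Chosen so that the [l] entries of the perturbation of a functional weigh at most [1 / 8]
    together. *)
Let d2 := c ^+ 2 / (8 * l%:R).
Hypothesis PSa : forall i, PS (X := measSpace BR R) r (fun z h => a h z i - a 0 z i) (fun=> d2).

Definition lin h z w := \sum_i a h z i * pert h w i.
Definition lin0 z w := \sum_i a 0 z i * beta0 w i.
Definition dlin h z w := \sum_i a 0 z i * beta0 w i / lin0 z w * dev h w i +
  \sum_i (a h z i - a 0 z i) * (beta0 w i / lin0 z w) * (1 + dev h w i).

Lemma a0_ge0 z i : 0 <= a 0 z i.
Proof. by case/andP: (hau z i) => h _; apply: le_trans h; rewrite mulr_ge0 ?(ltW c0). Qed.

Lemma lin0_ge z w i : c ^+ 2 * beta0 w i <= lin0 z w.
Proof.
apply: (@le_trans _ _ (c * beta0 w I)).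
  by rewrite expr2 -mulrA ler_wpM2l ?(ltW c0)//; exact: (beta0_bounds w).2.
rewrite /lin0 (bigD1 I)//= ler_wpDr//.
  by apply: sumr_ge0 => j _; rewrite mulr_ge0 ?a0_ge0 ?(ltW (beta0_gt0 _ _)).
by rewrite ler_wpM2r ?(ltW (beta0_gt0 _ _))//; case/andP: (hau z I); rewrite uI mulr1.
Qed.

Lemma lin0_gt0 z w : 0 < lin0 z w.
Proof. by apply: lt_le_trans (lin0_ge z w I); rewrite mulr_gt0 ?exprn_gt0 ?beta0_gt0. Qed.

Lemma lin_dlin h z w : lin h z w = lin0 z w * (1 + dlin h z w).
Proof.
have L0 : lin0 z w != 0 by rewrite gt_eqF ?lin0_gt0.
rewrite mulrDr mulr1 /dlin mulrDr !mulr_sumr {1}/lin0 -!big_split/=; apply: eq_bigr => i _.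
by rewrite /pert; field.
Qed.

Lemma lin0_weights z w : \sum_i a 0 z i * beta0 w i / lin0 z w = 1.
Proof. by rewrite -mulr_suml divff// gt_eqF ?lin0_gt0. Qed.

Lemma lin0_ratio z w i : 0 <= beta0 w i / lin0 z w <= c ^- 2.
Proof.
have L0 := lin0_gt0 z w; rewrite divr_ge0 ?(ltW L0) ?(ltW (beta0_gt0 _ _))//=.
by rewrite ler_pdivrMr// ler_pdivlMl ?exprn_gt0// lin0_ge.
Qed.

Lemma measurable_lin0 n : measurable_fun setT (fun v : n.+1.-tuple BR => lin0 (thead v) (behead v)).
Proof.
apply: measurable_sum => i; apply: measurable_funM; first exact: (measurable_thead_comp (ma i)).
exact: (measurable_tbehead_comp (measurable_beta0 i)).
Qed.

Lemma measurable_lin0_weight n i : measurable_fun setT (fun v : n.+1.-tuple BR =>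
  a 0 (thead v) i * beta0 (behead v) i / lin0 (thead v) (behead v)).
Proof.
apply: measurable_div; last exact: measurable_lin0.
apply: measurable_funM; first exact: (measurable_thead_comp (ma i)).
exact: (measurable_tbehead_comp (measurable_beta0 i)).
Qed.

Lemma d2_ge0 : 0 <= d2.
Proof. by rewrite divr_ge0 ?mulr_ge0 ?exprn_ge0// ltW. Qed.

Lemma d2E : l%:R * (d2 * c ^- 2) = 8^-1.
Proof.
have l0 : l%:R != 0 :> R by rewrite pnatr_eq0 -lt0n; apply: leq_ltn_trans (ltn_ord I).
by rewrite /d2; field; rewrite l0 gt_eqF.
Qed.

Lemma PS_lin_err n i : PS (X := T n.+1) r (fun v h => (a h (thead v) i - a 0 (thead v) i) *
  (beta0 (behead v) i / lin0 (thead v) (behead v))) (fun=> d2 * c ^- 2).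
Proof.
have mr : measurable_fun setT (fun v : n.+1.-tuple BR => beta0 (behead v) i / lin0 (thead v) (behead v)).
  apply: measurable_div; last exact: measurable_lin0.
  exact: (measurable_tbehead_comp (measurable_beta0 i)).
have P := PS_mul (PS_param (@measurable_thead R n) (PSa i)) (PS_adm (X := T n.+1) m r mr).
apply: PS_le P => w; rewrite ler_wpM2l ?d2_ge0//.
by have /andP[h1 h2] := lin0_ratio (thead w) (behead w) i; rewrite ger0_norm.
Qed.

Lemma PS_dlin n : PS (X := T n.+1) r (fun v h => dlin h (thead v) (behead v)) (fun=> 2^-1).
Proof.
have P1 := @PS_weighted R (T n.+1) l m r 8^-1 1 _ _ _ (@measurable_lin0_weight n) _
  (fun j => PS_param (@measurable_tbehead R n) (PS_dev n j)).
have P2 := PS_sum (P := predT) (fun j _ => PS_mul (PS_lin_err n j)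
  (PS_add (PS_cst (T n.+1) m 1 r) (PS_param (@measurable_tbehead R n) (PS_dev n j)))).
apply: PS_le (PS_add (P1 _ _) P2) => [v|//|v].
  by rewrite sumr_const card_ord normr1 -[_ *+ l]mulr_natl mulrA d2E; lra.
under eq_bigr do rewrite ger0_norm ?divr_ge0 ?mulr_ge0 ?a0_ge0 ?(ltW (beta0_gt0 _ _)) ?(ltW (lin0_gt0 _ _))//.
by rewrite lin0_weights.
Qed.

(** Every such functional inherits the decomposition of [contraction] with the same [f]. For two
    functionals the quotient then changes by [(f + xi1) / (f + xi2)], which differs from 1 only
    through the small [xi1 - xi2]. *)
Lemma PS_lin_deviation n (f : n.+1.-tuple BR -> 'rV[R]_m -> R)
    (D : 'I_l -> n.+1.-tuple BR -> 'rV[R]_m -> R) phi :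
  (forall (w : n.+1.-tuple BR) h i, polydisc r h ->
    pert h w i = f w h * pert h (tbelast w) i + beta0 (tbelast w) i * D i w h) ->
  (forall i, PS (X := T n.+1) r (D i) (fun=> phi)) ->
  exists2 xi, PS (X := T n.+2) r xi (fun=> 9 / 4 * phi) &
    forall (v : n.+2.-tuple BR) h, polydisc r h ->
      lin h (thead v) (behead v) = (f [tuple of behead v] h + xi v h) *
        lin h (thead (tbelast v)) (behead (tbelast v)).
Proof.
move=> fD PD.
have phi0 : 0 <= phi by exact: (PS_ge0 (X := T n.+1) [tuple of nseq n.+1 0] (PD I)).
have PDx j : PS (X := T n.+2) r (fun w h => D j [tuple of behead w] h) (fun=> phi).
  exact: (PS_param (@measurable_tbehead R n.+1) (PD j)).
have mv := @measurable_tbelast R n.+1.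
pose S1 (v : n.+2.-tuple BR) (h : 'rV[R]_m) := \sum_i a 0 (thead (tbelast v)) i * beta0 (behead (tbelast v)) i /
  lin0 (thead (tbelast v)) (behead (tbelast v)) * D i [tuple of behead v] h.
pose S2 (v : n.+2.-tuple BR) h := \sum_i (a h (thead (tbelast v)) i - a 0 (thead (tbelast v)) i) *
  (beta0 (behead (tbelast v)) i / lin0 (thead (tbelast v)) (behead (tbelast v))) * D i [tuple of behead v] h.
pose g (v : n.+2.-tuple BR) h := dlin h (thead (tbelast v)) (behead (tbelast v)).
have Pg : PS (X := T n.+2) r g (fun=> 2^-1) by exact: (PS_param mv (PS_dlin n)).
have P1 : PS (X := T n.+2) r S1 (fun=> 1 * phi).
  apply: (@PS_weighted R (T n.+2) l m r phi 1 _ _ phi0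
    (fun j => measurableT_comp (@measurable_lin0_weight n j) mv) _ PDx) => v.
  under eq_bigr do rewrite ger0_norm ?divr_ge0 ?mulr_ge0 ?a0_ge0 ?(ltW (beta0_gt0 _ _)) ?(ltW (lin0_gt0 _ _))//.
  by rewrite lin0_weights.
have P2 : PS (X := T n.+2) r S2 (fun=> 8^-1 * phi).
  apply: PS_le (PS_sum (P := predT) (fun j _ => PS_mul (PS_param mv (PS_lin_err n j)) (PDx j))) => t.
  by rewrite sumr_const card_ord -[_ *+ l]mulr_natl mulrA d2E.
have i20 : 0 <= 2^-1 :> R by [].
have i21 : 2^-1 < 1 :> R by rewrite invf_lt1// ltr1n.
exists (fun v h => (S1 v h + S2 v h) / (1 + g v h)).
  apply: PS_le (PS_mul (PS_add P1 P2) (PS_inv1p i20 i21 Pg)) => v.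
  by have -> : (1 - 2^-1)^-1 = 2 :> R; [field|lra].
move=> v h hr.
have g1 : 1 + g v h != 0.
  have := PS_bound (X := T n.+2) v Pg hr; move: (g v h) => y /ler_normlP[h1 _].
  by rewrite gt_eqF// -ltrBlDl sub0r ltrNl (le_lt_trans h1).
rewrite [X in _ = _ * X]lin_dlin -/(g v h) mulrDl.
have -> : (S1 v h + S2 v h) / (1 + g v h) * (lin0 (thead (tbelast v)) (behead (tbelast v)) * (1 + g v h)) =
  \sum_i a h (thead (tbelast v)) i * beta0 (behead (tbelast v)) i * D i [tuple of behead v] h.
  rewrite -mulrA [X in _ * X]mulrCA mulVf// mulr1 /S1 /S2 -big_split/= mulr_suml; apply: eq_bigr => i _.
  have L0 := lin0_gt0 (thead (tbelast v)) (behead (tbelast v)).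
  by field; rewrite gt_eqF.
rewrite /g -lin_dlin /lin mulr_sumr -big_split/=; apply: eq_bigr => i _.
rewrite (thead_tbelast v) -[X in pert h X i]/([tuple of behead v] : seq R) fD// -behead_tbelast.
ring.
Qed.

End Functional.

(** * The logarithm of the conditional density and its memory loss *)

Section LogRatio.
Variables (a : 'rV[R]_m -> R -> 'I_l -> R) (p : 'rV[R]_m -> 'I_l -> R).
Let d2 := c ^+ 2 / (8 * l%:R).
Hypothesis has : forall z i, c * s z i <= a 0 z i <= s z i.
Hypothesis ma : forall i, measurable_fun setT ((fun z => a 0 z i) : BR -> R).
Hypothesis PSa : forall i, PS (X := measSpace BR R) r (fun z h => a h z i - a 0 z i) (fun=> d2).
Hypothesis hp : forall i, c <= p 0 i <= 1.
Hypothesis PSp : forall i, PS (X := measSpace BR R) r (fun _ h => p h i - p 0 i) (fun=> d2).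

Definition num h z w := lin a h z w.
Definition den h z w := lin (fun h _ => p h) h z w.
(** For the functionals of the channel, the logarithm of the conditional density of [z] given the
    later observations [w], minus the logarithm of the density of [z] under the symbol [I]. *)
Definition log_ratio h z w := ln (num h z w / den h z w).

Let s0 z i : 0 <= s z i. Proof. by case/andP: (hs z i). Qed.
Let hp1 (z : R) i : c * 1 <= p 0 i <= 1. Proof. by rewrite mulr1. Qed.
Let mp i : measurable_fun setT ((fun z => p 0 i) : BR -> R). Proof. exact: measurable_cst. Qed.
Let one0 (z : R) (i : 'I_l) : 0 <= 1 :> R. Proof. by []. Qed.
Let one1 (z : R) : 1 = 1 :> R. Proof. by []. Qed.

Let num0 := lin0 a.
Let den0 := lin0 (fun h _ => p h).
Let g1 := dlin a.
Let g2 := dlin (fun h _ => p h).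
Let num0_gt0 z w : 0 < num0 z w. Proof. exact: (lin0_gt0 has s0 sI). Qed.
Let den0_gt0 z w : 0 < den0 z w. Proof. exact: (lin0_gt0 (a := fun h _ => p h) hp1 one0 one1). Qed.
Let numE h z w : num h z w = num0 z w * (1 + g1 h z w). Proof. exact: (lin_dlin has s0 sI). Qed.
Let denE h z w : den h z w = den0 z w * (1 + g2 h z w).
Proof. exact: (lin_dlin (a := fun h _ => p h) hp1 one0 one1). Qed.
Let P1 n : PS (X := T n.+1) r (fun v h => g1 h (thead v) (behead v)) (fun=> 2^-1).
Proof. exact: (PS_dlin has s0 sI ma PSa). Qed.
Let P2 n : PS (X := T n.+1) r (fun v h => g2 h (thead v) (behead v)) (fun=> 2^-1).
Proof. exact: (PS_dlin (a := fun h _ => p h) hp1 one0 one1 mp PSp). Qed.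

Let half_gt0 (X : coefSpace R) (g : X -> 'rV[R]_m -> R) t h : PS r g (fun=> 2^-1) -> polydisc r h ->
  0 < 1 + g t h.
Proof.
move=> P hr; have := PS_bound t P hr; move: (g t h) => y /ler_normlP[h1 _].
by rewrite -ltrBlDl sub0r ltrNl (le_lt_trans h1)// invf_lt1// ltr1n.
Qed.

Lemma num_pos n (v : n.+1.-tuple BR) h : polydisc r h -> 0 < num h (thead v) (behead v).
Proof. by move=> hr; rewrite numE mulr_gt0// (half_gt0 (X := T n.+1) v (P1 n) hr). Qed.

Lemma den_pos n (v : n.+1.-tuple BR) h : polydisc r h -> 0 < den h (thead v) (behead v).
Proof. by move=> hr; rewrite denE mulr_gt0// (half_gt0 (X := T n.+1) v (P2 n) hr). Qed.

Lemma C_ge1 : 1 <= C.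
Proof. by have /andP[_] := hs 0 I; rewrite sI. Qed.

(** The coefficients of [num0] are at most [C] and those of [den0] at least [c]; conversely those of
    [den0] are at most 1 and each entry of [beta0] is at most [c ^- 2 * num0]. *)
Lemma ln_num0_den0 z w : `|ln (num0 z w / den0 z w)| <= ln (C / c) + ln (l%:R / c ^+ 2).
Proof.
have l0 : 0 < l%:R :> R by rewrite ltr0n; apply: leq_ltn_trans (ltn_ord I).
have l1 : 1 <= l%:R :> R by rewrite ler1n -(ltr0n R).
have C1 := C_ge1; have Cc : 1 <= C / c by rewrite ler_pdivlMr// mul1r (le_trans c1).
have lc : 1 <= l%:R / c ^+ 2.
  by rewrite ler_pdivlMr ?exprn_gt0// mul1r (le_trans _ l1)// exprn_ile1// ltW.
have q0 : 0 < num0 z w / den0 z w by rewrite divr_gt0.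
have up : num0 z w / den0 z w <= C / c.
  rewrite ler_pdivrMr// /num0 /den0 /lin0 mulr_sumr; apply: ler_sum => i _.
  rewrite mulrA ler_wpM2r ?(ltW (beta0_gt0 _ _))//.
  case/andP: (has z i) => _ /le_trans; apply; case/andP: (hs z i) => _ /le_trans; apply.
  rewrite -mulrA -[leLHS]mulr1 ler_wpM2l ?(le_trans ler01)//.
  by rewrite ler_pdivlMl// mulr1; case/andP: (hp i).
have lo : (num0 z w / den0 z w)^-1 <= l%:R / c ^+ 2.
  rewrite invf_div ler_pdivrMr// mulrAC ler_pdivlMr ?exprn_gt0// /den0 /lin0 mulr_suml.
  apply: (@le_trans _ _ (\sum_(i < l) num0 z w)); last by rewrite sumr_const card_ord mulr_natl.
  apply: ler_sum => i _; apply: le_trans (lin0_ge has s0 sI z w i).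
  rewrite mulrC ler_wpM2l ?exprn_ge0 ?(ltW c0)// -[leRHS]mul1r ler_wpM2r ?(ltW (beta0_gt0 _ _))//.
  by case/andP: (hp i).
have A0 := ln_ge0 Cc; have B0 := ln_ge0 lc.
rewrite ler_norml; apply/andP; split.
  rewrite lerNl -lnV ?posrE//; apply: (@le_trans _ _ (ln (l%:R / c ^+ 2))); last by rewrite lerDr.
  by rewrite ler_ln ?posrE ?invr_gt0// (lt_le_trans _ lc).
apply: (@le_trans _ _ (ln (C / c))); last by rewrite lerDl.
by rewrite ler_ln ?posrE// (lt_le_trans _ Cc).
Qed.

Lemma PS_log_ratio : exists2 A, 0 <= A & forall n, PS (X := T n.+1) r
  (fun v h => log_ratio h (thead v) (behead v)) (fun=> A).
Proof.
(* The final 2 pays for the logarithms of [1 + g1] and [1 + g2], each of norm at most 1 since the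
   [g] have norm [1 / 2]. *)
exists (ln (C / c) + ln (l%:R / c ^+ 2) + 2).
  by rewrite addr_ge0// (le_trans _ (ln_num0_den0 0 [::])).
move=> n.
have i20 : 0 <= 2^-1 :> R by [].
have i21 : 2^-1 < 1 :> R by rewrite invf_lt1// ltr1n.
have mq : measurable_fun setT (fun v : n.+1.-tuple BR => ln (num0 (thead v) (behead v) / den0 (thead v) (behead v))).
  apply: (measurableT_comp (@measurable_ln R)); apply: measurable_div.
    exact: measurable_lin0.
  exact: (measurable_lin0 (a := fun h _ => p h)).
have P := PS_sub (PS_add (PS_adm (X := T n.+1) m r mq) (PS_ln i20 i21 (P1 n))) (PS_ln i20 i21 (P2 n)).
apply: PS_ext (PS_le _ P) => [v h hr|v].
  have p1 := half_gt0 (X := T n.+1) v (P1 n) hr; have p2 := half_gt0 (X := T n.+1) v (P2 n) hr.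
  rewrite /log_ratio numE denE -mulf_div [X in _ = X]lnM ?posrE ?divr_gt0//.
  by rewrite [ln ((1 + _) / _)]ln_div ?posrE// -addrA.
have -> : 2^-1 / (1 - 2^-1) = 1 :> R by field.
by have := ln_num0_den0 (thead v) (behead v); lra.
Qed.

Lemma den0_tbelast n (v : n.+2.-tuple BR) :
  0 <= den0 (thead (tbelast v)) (behead (tbelast v)) / den0 (thead v) (behead v) <= c^-1.
Proof.
rewrite divr_ge0 ?(ltW (den0_gt0 _ _))//= ler_pdivrMr// mulrC ler_pdivlMr// mulrC.
rewrite /den0 /lin0 mulr_sumr; apply: ler_sum => i _; rewrite mulrCA ler_wpM2l//.
  by case/andP: (hp i) => h _; rewrite (le_trans _ h)// ltW.
have := beta0_tbelast [tuple of behead v] i.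
by rewrite -behead_tbelast.
Qed.

(** The quotient of the two ratios is [1 + del], where [del] is [x1 - x2] times a bounded quotient
    of denominators and so has order [rate ^+ n]; the logarithm keeps that order. *)
Lemma PS_log_ratio_step : exists2 A, 0 <= A & forall n, PS (X := T n.+2) r
  (fun v h => log_ratio h (thead v) (behead v) - log_ratio h (thead (tbelast v)) (behead (tbelast v)))
  (fun=> A * rate ^+ n).
Proof.
have [A A0 PA] := PS_log_ratio.
have rate0 : 0 <= rate by rewrite /rate; have := c1; lra.
(* Twice [9 / 4] for [x1 - x2], times [c^-1 * (3 / 2) * 2] for the quotient of denominators. *)
pose kk := 27 / 2 / c * (l%:R * C * (9 / 8)).
have kk0 : 0 <= kk.
  have C0 : 0 <= C by exact: le_trans ler01 C_ge1.
  by apply: mulr_ge0; [rewrite divr_ge0 ?(ltW c0)|rewrite !mulr_ge0].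
exists ((2 + 4 * A) * kk) => [|n]; first by rewrite mulr_ge0// addr_ge0// mulr_ge0.
pose kap := kk * rate ^+ n.
have kap0 : 0 <= kap by rewrite mulr_ge0// exprn_ge0.
have kapE : (2 + 4 * A) * kk * rate ^+ n = (2 + 4 * A) * kap by rewrite -mulrA.
rewrite kapE.
have mv := @measurable_tbelast R n.+1.
(* If [kap] exceeds [1 / 2], twice the uniform bound [A] is already at most [4 * A * kap]; otherwise
   the logarithmic series applies. *)
have [k2|k2] := leP kap 2^-1; last first.
  apply: PS_le (PS_sub (PA n.+1) (PS_param mv (PA n))) => v.
  apply: (@le_trans _ _ (4 * A * kap)); last by rewrite ler_wpM2r// lerDr.
  have : A * 2^-1 <= A * kap by rewrite ler_wpM2l// ltW.
  lra.
have [f [D [fD PD]]] := contraction n.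
have [x1 Px1 x1E] := PS_lin_deviation has s0 sI ma PSa fD PD.
have [x2 Px2 x2E] := @PS_lin_deviation (fun h _ => p h) (fun _ _ => 1) hp1 one0 one1 mp PSp _ _ _ _ fD PD.
have i20 : 0 <= 2^-1 :> R by [].
have i21 : 2^-1 < 1 :> R by rewrite invf_lt1// ltr1n.
have mq : measurable_fun setT (fun v : n.+2.-tuple BR => den0 (thead (tbelast v)) (behead (tbelast v)) / den0 (thead v) (behead v)).
  apply: measurable_div; last exact: (measurable_lin0 (a := fun h _ => p h)).
  by have := measurableT_comp (@measurable_lin0 (fun h _ => p h) mp n) mv; exact.
have PQ := PS_mul (PS_mul (PS_adm (X := T n.+2) m r mq)
  (PS_add (PS_cst (T n.+2) m 1 r) (PS_param mv (P2 n)))) (PS_inv1p i20 i21 (P2 n.+1)).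
have Pd := PS_mul (PS_sub Px1 Px2) PQ.
pose del (v : n.+2.-tuple BR) h := num h (thead v) (behead v) / den h (thead v) (behead v) /
  (num h (thead (tbelast v)) (behead (tbelast v)) / den h (thead (tbelast v)) (behead (tbelast v))) - 1.
have Pdel : PS (X := T n.+2) r del (fun=> kap).
  apply: PS_ext (PS_le _ Pd) => [v h hr|v].
    have n1 := num_pos v hr; have n2 := num_pos (tbelast v) hr.
    have e1 := den_pos v hr; have e2 := den_pos (tbelast v) hr.
    have p1 := half_gt0 (X := T n.+2) v (P2 n.+1) hr.
    have q1 := den0_gt0 (thead v) (behead v).
    have -> : den0 (thead (tbelast v)) (behead (tbelast v)) / den0 (thead v) (behead v) *
       (1 + g2 h (thead (tbelast v)) (behead (tbelast v))) / (1 + g2 h (thead v) (behead v)) =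
       den h (thead (tbelast v)) (behead (tbelast v)) / den h (thead v) (behead v).
      by rewrite !denE; field; rewrite !gt_eqF.
    have := x1E v h hr; have := x2E v h hr.
    rewrite -[lin a h (thead v) _]/(num h _ _) -[lin a h (thead (tbelast v)) _]/(num h _ _).
    rewrite -[lin _ h (thead v) _]/(den h _ _) -[lin _ h (thead (tbelast v)) _]/(den h _ _).
    rewrite /del => dE nE; rewrite nE dE; rewrite dE in e1.
    have gen (F X1 X2 nb db : R) : F + X2 != 0 -> db != 0 -> nb != 0 ->
      (X1 - X2) * (db / ((F + X2) * db)) = (F + X1) * nb / ((F + X2) * db) / (nb / db) - 1.
      by move=> F0 db0 nb0; field; rewrite F0 db0 nb0.
    by apply: gen; [apply: contraTneq e1 => ->; rewrite mul0r ltxx|rewrite gt_eqF..].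
  have i2E : (1 - 2^-1)^-1 = 2 :> R by field.
  have /andP[q0 q1] := den0_tbelast v.
  rewrite i2E normr1 ger0_norm// /kap /kk.
  set phi := l%:R * C * (9 / 8).
  have phi0 : 0 <= phi * rate ^+ n by exact: (PS_ge0 (X := T n.+1) [tuple of nseq n.+1 0] (PD I)).
  have -> : 27 / 2 / c * phi * rate ^+ n = (9 / 4 * (phi * rate ^+ n) + 9 / 4 * (phi * rate ^+ n)) * (c^-1 * (1 + 2^-1) * 2).
    by field; rewrite gt_eqF.
  apply: ler_wpM2l; first by rewrite addr_ge0// mulr_ge0.
  by apply: ler_wpM2r => //; apply: ler_wpM2r.
apply: PS_ext (PS_le _ (PS_ln kap0 (le_lt_trans k2 i21) Pdel)) => [v h hr|v].
  rewrite /del addrC subrK ln_div ?posrE ?divr_gt0 ?num_pos ?den_pos//.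
have : kap / (1 - kap) <= 2 * kap.
  rewrite ler_pdivrMr ?subr_gt0 ?(le_lt_trans k2)//.
  have : kap * kap <= kap * 2^-1 by rewrite ler_wpM2l.
  lra.
have : 0 <= A * kap by rewrite mulr_ge0.
lra.
Qed.

End LogRatio.

End Filter.

(** * Integration over tuples one letter at a time *)

Section TupleIntegrals.
Variable R : realType.
Local Notation BR := (measurableTypeR R).
Local Notation leb := (@lebesgue_measure R).
Local Notation lam n := (@lebesgue_tuple R n).

Lemma lebesgue_tupleS n :
  @lebesgue_tuple R n.+1 = pushforward (leb \x lam n)%E (@cons_pair R n).
Proof. by []. Qed.

Lemma tuple_tonelli n (F : n.+1.-tuple BR -> \bar R) : measurable_fun setT F ->
  (forall v, 0 <= F v)%E ->
  (\int[lam n.+1]_v F v = \int[leb]_z \int[lam n]_w F [tuple of z :: w])%E.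
Proof.
move=> mF F0; have mc := @measurable_cons_pair R n.
have E := ge0_integral_pushforward mc (leb \x lam n)%E measurableT mF (fun v _ => F0 v).
rewrite lebesgue_tupleS E preimage_setT.
rewrite (fubini_tonelli1 (m1 := leb) (m2 := lam n) (F \o @cons_pair R n)) => [||p]; [by []| |exact: F0].
exact: (measurableT_comp mF mc).
Qed.

Lemma tuple_product_ge0 n (f : BR -> \bar R) (g : n.-tuple BR -> \bar R) :
  measurable_fun setT f -> measurable_fun setT g -> (forall z, 0 <= f z)%E -> (forall w, 0 <= g w)%E ->
  (\int[lam n.+1]_v (f (thead v) * g [tuple of behead v]) = \int[leb]_z f z * \int[lam n]_w g w)%E.
Proof.
move=> mf mg f0 g0; rewrite tuple_tonelli//; last 2 first.
- apply: emeasurable_funM; first exact: (measurableT_comp mf (@measurable_thead R n)).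
  exact: (measurableT_comp mg (@measurable_tbehead R n)).
- by move=> v; exact: mule_ge0.
transitivity (\int[leb]_z (f z * \int[lam n]_w g w))%E.
  apply: eq_integral => z _; rewrite -ge0_integralZl//.
  by apply: eq_integral => w _; rewrite theadE; congr (_ * g _)%E; exact: val_inj.
by rewrite ge0_integralZr// integral_ge0.
Qed.

Lemma tuple_product n (f : BR -> R) (g : n.-tuple BR -> R) :
  leb.-integrable setT (EFin \o f) -> (lam n).-integrable setT (EFin \o g) ->
  (lam n.+1).-integrable setT (EFin \o (fun v => f (thead v) * g [tuple of behead v])) /\
  \int[lam n.+1]_v (f (thead v) * g [tuple of behead v]) = \int[leb]_z f z * \int[lam n]_w g w.
Proof.
move=> If Ig; have /integrableP[mf ff] := If; have /integrableP[mg gg] := Ig.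
have mF : measurable_fun setT (EFin \o (fun v : n.+1.-tuple BR => f (thead v) * g [tuple of behead v])).
  apply/measurable_EFinP; apply: measurable_funM.
    by apply: measurable_thead_comp; exact/measurable_EFinP.
  by apply: measurable_tbehead_comp; exact/measurable_EFinP.
have IF : (lam n.+1).-integrable setT (EFin \o (fun v => f (thead v) * g [tuple of behead v])).
  apply/integrableP; split => //.
  have -> : (\int[lam n.+1]_x `|(EFin \o (fun v => (f (thead v) * g [tuple of behead v])%R)) x| =
    \int[lam n.+1]_v ((fun z => `|(f z)%:E|) (thead v) * (fun w => `|(g w)%:E|) [tuple of behead v]))%E.
    by apply: eq_integral => v _ /=; rewrite normrM.
  rewrite (tuple_product_ge0 (f := fun z => `|(f z)%:E|%E) (g := fun w => `|(g w)%:E|%E))//;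
    [|exact: measurableT_comp..].
  by rewrite lte_mul_pinfty ?integral_ge0// ge0_fin_numE ?integral_ge0.
split => //.
have mc := @measurable_cons_pair R n.
have Ip : (leb \x lam n)%E.-integrable setT ((EFin \o (fun v => f (thead v) * g [tuple of behead v])) \o @cons_pair R n).
  apply/integrableP; split; first exact: (measurableT_comp mF mc).
  have /integrableP[_] := IF; apply: le_lt_trans.
  have maF : measurable_fun setT (fun v : n.+1.-tuple BR => `|(f (thead v) * g [tuple of behead v])%:E|%E).
    exact: measurableT_comp.
  have := ge0_integral_pushforward mc (leb \x lam n)%E measurableT maF (fun v _ => abse_ge0 _).
  by rewrite -lebesgue_tupleS preimage_setT => ->.
have E := integral_pushforward mc mF Ip measurableT.
rewrite preimage_setT in E.
rewrite /Rintegral lebesgue_tupleS E -integral12_prod_meas1//.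
transitivity (fine (\int[leb]_z ((f z)%:E * \int[lam n]_w (g w)%:E))%E).
  congr fine; apply: eq_integral => z _; rewrite /fubini_F -integralZl//.
  apply: eq_integral => w _ /=; rewrite theadE; congr (_ * g _)%:E; exact: val_inj.
have gfin : (\int[lam n]_w (g w)%:E)%E \is a fin_num by exact: integrable_fin_num.
have ffin : (\int[leb]_z (f z)%:E)%E \is a fin_num by exact: integrable_fin_num.
by rewrite -(fineK gfin) integralZr// fineM.
Qed.

End TupleIntegrals.

(** * Joint density, marginalisation and the chain rule for entropy *)

Section ForwardRecursion.
Variables (R : realType) (l : nat).
Local Notation BR := (measurableTypeR R).
Local Notation leb := (@lebesgue_measure R).
Local Notation lam n := (@lebesgue_tuple R n).
Variables (p : 'rV[R]_l) (P : 'M[R]_l) (f : R -> 'I_l -> R).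

(** Density of the observations [w] given the hidden state [i] one step before the first of them. *)
Fixpoint betaq (w : seq R) : 'I_l -> R :=
  if w is z :: w' then fun i => \sum_j P i j * f z j * betaq w' j else fun=> 1.

(** The stationary vector stands one step before the first observation, so there is one transition
    more than in [joint_density]. Stationarity removes the difference, and the empty block gets
    density 1. *)
Definition dens w := \sum_i p 0 i * betaq w i.

(** Hidden paths are split at their first state. The initial vector is arbitrary because the
    induction replaces it by a row of [P]. *)
Lemma path_sum n (v : 'I_l -> R) (z : n.+1.-tuple BR) :
  \sum_(y : {ffun 'I_n.+1 -> 'I_l}) v (y ord0) *
    (\prod_(i < n) P (y (widen_ord (leqnSn n) i)) (y (lift ord0 i))) * \prod_(i < n.+1) f (tnth z i) (y i) =
  \sum_i v i * f (thead z) i * betaq (behead z) i.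
Proof.
elim: n v z => [|n IH] v z.
  rewrite (reindex (fun i : 'I_l => [ffun _ : 'I_1 => i])); last first.
    exists (fun y : {ffun 'I_1 -> 'I_l} => y ord0) => [i|y] _; first by rewrite ffunE.
    by apply/ffunP => k; rewrite ffunE (ord1 k).
  apply: eq_bigr => i _; rewrite big_ord0 big_ord1 !ffunE mulr1 [behead z](_ : _ = [::]) ?mulr1//.
  by case: z => [[|a [|]]].
pose glue (x : 'I_l * {ffun 'I_n.+1 -> 'I_l}) : {ffun 'I_n.+2 -> 'I_l} :=
  [ffun k => if unlift ord0 k is Some j then x.2 j else x.1].
have glue0 x : glue x ord0 = x.1 by rewrite ffunE unlift_none.
have glueS x j : glue x (lift ord0 j) = x.2 j by rewrite ffunE liftK.
rewrite (reindex glue); last first.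
  exists (fun y : {ffun 'I_n.+2 -> 'I_l} => (y ord0, [ffun j : 'I_n.+1 => y (lift ord0 j)])) => [[i g]|y] _.
    by congr pair; [rewrite glue0|apply/ffunP => j; rewrite ffunE glueS].
  by apply/ffunP => k; case: (unliftP ord0 k) => [j ->|->]; rewrite ?glueS ?glue0// ffunE.
rewrite -(pair_bigA _ (fun i g => v (glue (i, g) ord0) *
  (\prod_(k < n.+1) P (glue (i, g) (widen_ord (leqnSn n.+1) k)) (glue (i, g) (lift ord0 k))) *
  \prod_(k < n.+2) f (tnth z k) (glue (i, g) k)))/=.
apply: eq_bigr => i _.
have e : \sum_j P i j * f (thead [tuple of behead z]) j * betaq (behead (behead z)) j = betaq (behead z) i.
  by rewrite [behead z in RHS](tuple_consE [tuple of behead z]).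
rewrite -e -(IH (P i)) mulr_sumr; apply: eq_bigr => g _.
have -> : \prod_(k < n.+2) f (tnth z k) (glue (i, g) k) =
    f (thead z) i * \prod_(k < n.+1) f (tnth [tuple of behead z] k) (g k).
  rewrite big_ord_recl glue0; congr (_ * _); apply: eq_bigr => k _.
  rewrite glueS tnth_behead; congr (f (tnth _ _) _); apply: val_inj => /=.
  by rewrite inordK// ltnS.
have -> : \prod_(k < n.+1) P (glue (i, g) (widen_ord (leqnSn n.+1) k)) (glue (i, g) (lift ord0 k)) =
    P i (g ord0) * \prod_(k < n) P (g (widen_ord (leqnSn n) k)) (g (lift ord0 k)).
  rewrite big_ord_recl glueS; congr (P _ _ * _).
    by rewrite -[RHS](glue0 (i, g)); congr (glue _ _); exact: val_inj.
  apply: eq_bigr => k _; rewrite glueS.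
  have -> : widen_ord (leqnSn n.+1) (lift ord0 k) = lift ord0 (widen_ord (leqnSn n) k) by exact: val_inj.
  by rewrite glueS.
rewrite glue0 /=; ring.
Qed.

Lemma joint_densityE n (z : n.+1.-tuple BR) : p *m P = p -> joint_density p P f z = dens z.
Proof.
move=> pP; rewrite /joint_density /path_prob (path_sum (fun i => p 0 i)) /dens.
under [RHS]eq_bigr do rewrite [X in betaq X _](tuple_consE z) /=.
have pj j : p 0 j = \sum_i p 0 i * P i j by rewrite -[in LHS]pP mxE.
under [LHS]eq_bigr do rewrite pj -mulrA mulr_suml.
rewrite exchange_big/=; apply: eq_bigr => i _; rewrite mulr_sumr; apply: eq_bigr => j _.
ring.
Qed.

Hypothesis stochP : stochastic P.
Hypothesis pdf : forall j, probability_density (f ^~ j).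

Let P0 i j : 0 <= P i j. Proof. by have [h _] := stochP. Qed.
Let f0 z j : 0 <= f z j. Proof. by have [_ h _] := pdf j. Qed.
Let mf j : measurable_fun setT ((fun z => f z j) : BR -> R). Proof. by have [h _ _] := pdf j. Qed.

Lemma betaq_ge0 w i : 0 <= betaq w i.
Proof. by elim: w i => [//|z w IH] i /=; rewrite sumr_ge0// => j _; rewrite !mulr_ge0. Qed.

Lemma betaq_tupleE n (v : n.+1.-tuple BR) i :
  betaq v i = \sum_j P i j * f (thead v) j * betaq (behead v) j.
Proof. by rewrite [X in betaq X _]tuple_consE. Qed.

Lemma measurable_betaq n i : measurable_fun setT (fun w : n.-tuple BR => betaq w i).
Proof.
elim: n i => [|n IH] i.
  rewrite (_ : (fun _ => _) = fun=> 1); first exact: measurable_cst.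
  by apply/funext => w; rewrite (tuple0 w).
rewrite (_ : (fun _ => _) = fun v : n.+1.-tuple BR =>
    \sum_j (P i j * f (thead v) j) * betaq (behead v) j); last first.
  by apply/funext => v; exact: betaq_tupleE.
apply: measurable_sum => j; apply: measurable_funM.
  by apply: (measurable_thead_comp (f := fun z => P i j * f z j)); apply: measurable_funM.
exact: (measurable_tbehead_comp (IH j)).
Qed.

Lemma density_integrable j : leb.-integrable setT (EFin \o (fun z => f z j)) /\ \int[leb]_z f z j = 1.
Proof.
have [m0 p0 p1] := pdf j; split; last by rewrite /Rintegral p1.
apply/integrableP; split; first exact/measurable_EFinP.
under eq_integral do rewrite /= ger0_norm//.
by rewrite p1 ltry.
Qed.

Lemma betaq_integral n i : (lam n).-integrable setT (EFin \o (fun w : n.-tuple BR => betaq w i)) /\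
  \int[lam n]_w betaq w i = 1.
Proof.
elim: n i => [|n IH] i.
  have e : (fun w : 0.-tuple BR => betaq w i) = fun=> 1 by apply/funext => w; rewrite (tuple0 w).
  have E : (\int[lam 0]_w 1%:E = 1 :> \bar R)%E.
    by rewrite integral_cst// mul1e /= diracE in_setT.
  rewrite e /Rintegral E; split => //.
  apply/integrableP; split; first exact: measurable_cst.
  by under eq_integral do rewrite /= normr1; rewrite E ltry.
pose g j (v : n.+1.-tuple BR) := f (thead v) j * betaq [tuple of behead v] j * P i j.
have e : (fun w : n.+1.-tuple BR => betaq w i) = fun v => \sum_j g j v.
  by apply/funext => v; rewrite betaq_tupleE; apply: eq_bigr => j _; rewrite /g; ring.
have fb j := tuple_product (density_integrable j).1 (IH j).1.
have Ig j : (lam n.+1).-integrable setT (EFin \o g j) by apply: integrableM_cst; exact: (fb j).1.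
have [I1 I2] := @Rintegral_sum _ _ _ (lam n.+1) _ (index_enum 'I_l) g Ig.
rewrite e; split => //; rewrite I2 -[RHS](stochP.2 i); apply: eq_bigr => j _.
rewrite RintegralZr//; last exact: (fb j).1.
by rewrite (fb j).2 (density_integrable j).2 (IH j).2 !mul1r.
Qed.

Let mbE k j : measurable_fun setT (fun w : k.-tuple BR => (betaq w j)%:E).
Proof. by apply/measurable_EFinP; exact: measurable_betaq. Qed.

Let b0E w j : (0 <= (betaq w j)%:E)%E. Proof. by rewrite lee_fin betaq_ge0. Qed.

Lemma betaq_cons_ge0 n (F : n.-tuple BR -> \bar R) z i : measurable_fun setT F ->
  (forall w, 0 <= F w)%E ->
  (\int[lam n]_w ((betaq (z :: w) i)%:E * F w) =
    \sum_j (P i j * f z j)%:E * \int[lam n]_w ((betaq w j)%:E * F w))%E.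
Proof.
move=> mF F0.
transitivity (\int[lam n]_w \sum_j ((P i j * f z j)%:E * ((betaq w j)%:E * F w)))%E.
  apply: eq_integral => w _ /=; rewrite -sumEFin ge0_sume_distrl => [|j _].
    by apply: eq_bigr => j _; rewrite EFinM muleA.
  by rewrite lee_fin !mulr_ge0// betaq_ge0.
rewrite ge0_integral_sum//; last 2 first.
- by move=> j; apply: emeasurable_funM; [exact: measurable_cst|exact: (emeasurable_funM (mbE _) mF)].
- by move=> j w _; rewrite !mule_ge0// lee_fin mulr_ge0.
apply: eq_bigr => j _; rewrite ge0_integralZl//.
- exact: (emeasurable_funM (mbE _) mF).
- by move=> w _; rewrite mule_ge0.
- by rewrite lee_fin mulr_ge0.
Qed.

(** The newest letter is integrated out by peeling off the older ones with Tonelli, until a single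
    letter of total mass 1 is left. *)
Lemma betaq_marginal_ge0 n (F : n.-tuple BR -> \bar R) i : measurable_fun setT F ->
  (forall w, 0 <= F w)%E ->
  (\int[lam n.+1]_v ((betaq v i)%:E * F (tbelast v)) = \int[lam n]_w ((betaq w i)%:E * F w))%E.
Proof.
elim: n F i => [|n IH] F i mF F0.
  have e (w : 0.-tuple BR) : F w = F [tuple] by rewrite (tuple0 w).
  under eq_integral do rewrite e; under [RHS]eq_integral do rewrite e.
  rewrite !ge0_integralZr//; do ?[exact: mbE|by move=> *; rewrite lee_fin betaq_ge0].
  have h k : (\int[lam k]_w (betaq w i)%:E = 1)%E.
    have [I1 I2] := @betaq_integral k i.
    by rewrite -[LHS]fineK; [rewrite [fine _]I2|exact: integrable_fin_num].
  by rewrite !h.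
have mFc z : measurable_fun setT (fun w : n.-tuple BR => F [tuple of z :: w]).
  by apply: (measurableT_comp mF); apply: measurable_cons; [exact: measurable_cst|exact: measurable_id].
rewrite tuple_tonelli; last 2 first.
- exact: (emeasurable_funM (mbE _) (measurableT_comp mF (@measurable_tbelast R n.+1))).
- by move=> v; rewrite mule_ge0.
rewrite [RHS]tuple_tonelli; last 2 first.
- exact: (emeasurable_funM (mbE _) mF).
- by move=> v; rewrite mule_ge0.
apply: eq_integral => z _.
rewrite (betaq_cons_ge0 z i (mFc z))//.
under [RHS]eq_bigr do rewrite -IH//.
rewrite -(betaq_cons_ge0 z i (F := fun w => F [tuple of z :: tbelast w]))//; last first.
  exact: (measurableT_comp (mFc z) (@measurable_tbelast R n)).
apply: eq_integral => w _; congr (_ * F _)%E.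
by rewrite tbelast_cons theadE; apply: val_inj => /=; congr (_ :: tval (tbelast _)); exact: val_inj.
Qed.

Lemma betaq_bounded_integrable n (G : n.-tuple BR -> R) A i : measurable_fun setT G ->
  (forall w, `|G w| <= A) -> (lam n).-integrable setT (EFin \o (fun w : n.-tuple BR => betaq w i * G w)).
Proof.
move=> mG GA; apply: (@integrable_bound _ _ _ (lam n) _ (fun w => betaq w i * A)).
- by apply: measurable_funM => //; exact: measurable_betaq.
- by move=> w; rewrite normrM ger0_norm ?betaq_ge0// ler_wpM2l// betaq_ge0.
- by apply: integrableM_cst; exact: (betaq_integral _ _).1.
Qed.

Lemma betaq_marginal n (G : n.-tuple BR -> R) A i : measurable_fun setT G ->
  (forall w, `|G w| <= A) ->
  \int[lam n.+1]_v (betaq v i * G (tbelast v)) = \int[lam n]_w (betaq w i * G w).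
Proof.
move=> mG GA.
have mGt : measurable_fun setT (fun v : n.+1.-tuple BR => G (tbelast v)).
  exact: (measurableT_comp mG (@measurable_tbelast R n)).
have I1 := betaq_bounded_integrable i mG GA.
have I2 := @betaq_bounded_integrable n.+1 _ A i mGt (fun v => GA _).
(* A bounded signed [G] is made nonnegative by adding [A], which integrates to [A] on both sides. *)
have A0 w : 0 <= G w + A by have := GA w; rewrite ler_norml => /andP[h _]; rewrite -lerBlDr sub0r.
have E : \int[lam n.+1]_v (betaq v i * (G (tbelast v) + A)) = \int[lam n]_w (betaq w i * (G w + A)).
  have mGA : measurable_fun setT (fun w : n.-tuple BR => (G w + A)%:E).
    by apply/measurable_EFinP; apply: measurable_funD => //; exact: measurable_cst.
  have := betaq_marginal_ge0 i mGA; rewrite /Rintegral => <-//.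
have shift k (H : k.-tuple BR -> R) : (lam k).-integrable setT (EFin \o (fun w : k.-tuple BR => betaq w i * H w)) ->
    \int[lam k]_w (betaq w i * (H w + A)) = \int[lam k]_w (betaq w i * H w) + A.
  move=> IH; have [J1 J2] := @betaq_integral k i.
  transitivity (\int[lam k]_w (betaq w i * H w + betaq w i * A)).
    by congr fine; apply: eq_integral => w _; rewrite mulrDr.
  rewrite RintegralD//; last exact: integrableM_cst.
  by rewrite RintegralZr// J2 mul1r.
by move: E; rewrite (shift _ _ I2) (shift _ _ I1) => /addIr.
Qed.

Hypothesis statp : stationary_vector P p.

Let p0 i : 0 <= p 0 i. Proof. by case: statp. Qed.

Lemma dens_ge0 w : 0 <= dens w.
Proof. by rewrite sumr_ge0// => i _; rewrite mulr_ge0// betaq_ge0. Qed.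

Lemma dens_cons z w : dens (z :: w) = \sum_j p 0 j * f z j * betaq w j.
Proof.
have [_ _ pP] := statp.
have pj j : p 0 j = \sum_i p 0 i * P i j by rewrite -[in LHS]pP mxE.
under [RHS]eq_bigr do rewrite pj -mulrA mulr_suml.
rewrite exchange_big/=; apply: eq_bigr => i _; rewrite mulr_sumr; apply: eq_bigr => j _.
by rewrite -/(betaq w j) !mulrA.
Qed.

Lemma measurable_dens n : measurable_fun setT (fun w : n.-tuple BR => dens w).
Proof.
apply: measurable_sum => i; apply: measurable_funM; [exact: measurable_cst|exact: measurable_betaq].
Qed.

Lemma dens_sum_integral n (G : 'I_l -> n.-tuple BR -> R) :
  (forall i, (lam n).-integrable setT (EFin \o G i)) ->
  (lam n).-integrable setT (EFin \o (fun w => \sum_i p 0 i * G i w)) /\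
  \int[lam n]_w (\sum_i p 0 i * G i w) = \sum_i p 0 i * \int[lam n]_w G i w.
Proof.
move=> IG.
have IG' i : (lam n).-integrable setT (EFin \o (fun w => G i w * p 0 i)) by exact: integrableM_cst.
have [I1 I2] := @Rintegral_sum _ _ _ (lam n) _ (index_enum 'I_l) _ IG'.
have e : (fun w => \sum_i p 0 i * G i w) = fun w => \sum_i G i w * p 0 i.
  by apply/funext => w; apply: eq_bigr => i _; rewrite mulrC.
rewrite e; split => //; rewrite I2; apply: eq_bigr => i _.
by rewrite RintegralZr// mulrC.
Qed.

Lemma dens_bounded_integral n (G : n.-tuple BR -> R) A : measurable_fun setT G ->
  (forall w, `|G w| <= A) ->
  (lam n).-integrable setT (EFin \o (fun w : n.-tuple BR => dens w * G w)) /\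
  \int[lam n]_w (dens w * G w) = \sum_i p 0 i * \int[lam n]_w (betaq w i * G w).
Proof.
move=> mG GA.
have [I1 I2] := dens_sum_integral (fun i => betaq_bounded_integrable i mG GA).
have e : (fun w : n.-tuple BR => dens w * G w) = fun w => \sum_i p 0 i * (betaq w i * G w).
  by apply/funext => w; rewrite mulr_suml; apply: eq_bigr => i _; rewrite mulrA.
by rewrite e.
Qed.

Lemma dens_marginal n (G : n.-tuple BR -> R) A : measurable_fun setT G ->
  (forall w, `|G w| <= A) ->
  \int[lam n.+1]_v (dens v * G (tbelast v)) = \int[lam n]_w (dens w * G w).
Proof.
move=> mG GA.
have mGt : measurable_fun setT (fun v : n.+1.-tuple BR => G (tbelast v)).
  exact: (measurableT_comp mG (@measurable_tbelast R n)).
rewrite (dens_bounded_integral mG GA).2 (@dens_bounded_integral n.+1 _ A mGt (fun v => GA _)).2.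
by apply: eq_bigr => i _; rewrite (betaq_marginal i mG GA).
Qed.

Variables (I : 'I_l) (G : forall n, n.+1.-tuple BR -> R) (A : R).
Arguments G {n}.
Hypothesis mG : forall n, measurable_fun setT (@G n).
Hypothesis GA : forall n v, `|@G n v| <= A.
Hypothesis p_gt0 : forall j, 0 < p 0 j.
Hypothesis If : forall j, leb.-integrable setT (EFin \o (fun z => f z j * ln (f z I))).
Hypothesis ln_dens : forall n (v : n.+1.-tuple BR),
  ln (dens v) = ln (f (thead v) I) + G v + ln (dens (behead v)).

Let a := \sum_j p 0 j * \int[leb]_z (f z j * ln (f z I)).
Definition gain n := \int[lam n.+1]_v (dens v * G v).

(** The chain rule [ln_dens], split off at the oldest letter. Integrability is part of the induction
    because [ln (dens v)] is controlled through the shorter block. *)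
Lemma dens_entropy n :
  (lam n).-integrable setT (EFin \o (fun w : n.-tuple BR => dens w * ln (dens w))) /\
  \int[lam n]_w (dens w * ln (dens w)) = \sum_(k < n) (a + gain k).
Proof.
elim: n => [|n [IH1 IH2]].
  have [_ p1 _] := statp.
  have e : (fun w : 0.-tuple BR => dens w * ln (dens w)) = fun=> 0.
    apply/funext => w; rewrite (tuple0 w) /dens /=.
    by under eq_bigr do rewrite mulr1; rewrite p1 ln1 mulr0.
  by rewrite e big_ord0; split; [exact: integrable0|rewrite /Rintegral integral0].
(* Because [p 0 j * betaq w j <= dens w] with [p 0 j] positive, integrability of [dens * ln dens]
   passes to each [betaq * ln dens]. *)
have Ib j : (lam n).-integrable setT (EFin \o (fun w : n.-tuple BR => betaq w j * ln (dens w))).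
  apply: (@integrable_bound _ _ _ (lam n) _ (fun w : n.-tuple BR => `|dens w * ln (dens w)| * (p 0 j)^-1)).
  - apply: measurable_funM; first exact: measurable_betaq.
    by apply: measurableT_comp; [exact: measurable_ln|exact: measurable_dens].
  - move=> w; rewrite !normrM mulrAC ler_wpM2r// ler_pdivlMr// !ger0_norm ?betaq_ge0 ?dens_ge0//.
    rewrite /dens (bigD1 j)//= mulrC lerDl sumr_ge0// => i _.
    by rewrite mulr_ge0 ?betaq_ge0.
  - by apply: integrableM_cst; have := integrable_abse IH1; exact.
pose D1 j (v : n.+1.-tuple BR) := (f (thead v) j * ln (f (thead v) I)) * betaq [tuple of behead v] j.
pose D3 j (v : n.+1.-tuple BR) := f (thead v) j * (betaq [tuple of behead v] j * ln (dens [tuple of behead v])).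
have T1 j := tuple_product (If j) (@betaq_integral n j).1.
have T3 j := tuple_product (density_integrable j).1 (Ib j).
have [I1 E1] := dens_sum_integral (G := D1) (fun j => (T1 j).1).
have [I3 E3] := dens_sum_integral (G := D3) (fun j => (T3 j).1).
have [I2 E2] := dens_bounded_integral (@mG n) (@GA n).
have e : (fun v : n.+1.-tuple BR => dens v * ln (dens v)) =
   fun v => \sum_j p 0 j * D1 j v + dens v * G v + \sum_j p 0 j * D3 j v.
  apply/funext => v; rewrite ln_dens !mulrDr; congr (_ + _ + _).
    rewrite [X in dens X]tuple_consE dens_cons mulr_suml; apply: eq_bigr => j _.
    by rewrite /D1; ring.
  rewrite [X in dens X * _]tuple_consE dens_cons mulr_suml; apply: eq_bigr => j _.
  by rewrite /D3; ring.
have I12 : (lam n.+1).-integrable setT (EFin \o (fun v : n.+1.-tuple BR => \sum_j p 0 j * D1 j v + dens v * G v)).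
  by have := integrableD measurableT I1 I2; exact.
rewrite e; split; first by have := integrableD measurableT I12 I3; exact.
have h1 : \sum_i p 0 i * \int[lam n.+1]_v D1 i v = a.
  by apply: eq_bigr => j _; rewrite (T1 j).2 (@betaq_integral n j).2 mulr1.
have h3 : \sum_i p 0 i * \int[lam n.+1]_v D3 i v = \int[lam n]_w (dens w * ln (dens w)).
  have [J1 J2] := dens_sum_integral Ib.
  transitivity (\sum_i p 0 i * \int[lam n]_w (betaq w i * ln (dens w))).
    by apply: eq_bigr => j _; rewrite (T3 j).2 (density_integrable j).2 mul1r.
  rewrite -J2; congr fine; apply: eq_integral => w _; rewrite mulr_suml.
  by congr EFin; apply: eq_bigr => j _; rewrite mulrA.
rewrite RintegralD// RintegralD// E1 E3 h1 h3 big_ord_recr/= -IH2.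
by rewrite -[gain n]/(\int[lam n.+1]_v (dens v * G v)) addrC.
Qed.

Lemma block_entropyE n : block_entropy p P f n = (- \sum_(k < n.+1) (a + gain k))%:E.
Proof.
have [_ _ pP] := statp; have [I1 <-] := dens_entropy n.+1.
rewrite /block_entropy EFinN /Rintegral fineK; last exact: integrable_fin_num.
by congr (- _)%E; apply: eq_integral => v _; rewrite joint_densityE.
Qed.

(** [- (a + gain n)] is the conditional entropy of the oldest letter given the [n] later ones, and
    the mean block entropies are its Cesaro means. *)
Lemma entropy_rate_limit t : gain n @[n --> \oo] --> t ->
  entropy_rate_defined p P f /\ entropy_rate p P f = (- (a + t))%:E.
Proof.
move=> gt; have gat : (a + gain n) @[n --> \oo] --> a + t by apply: cvgD => //; exact: cvg_cst.
have E : mean_block_entropy p P f = fun n => (- (arithmetic_mean (fun n => a + gain n) n))%:E.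
  apply/funext => n; rewrite /mean_block_entropy block_entropyE -EFinM mulrN.
  by rewrite /arithmetic_mean/= /series/= big_mkord.
have L : mean_block_entropy p P f @ \oo --> (- (a + t))%:E.
  rewrite E; apply: cvg_EFin; first by near=> n.
  by apply: cvgN; exact: cesaro.
split; last by rewrite /entropy_rate; exact: cvg_lim.
by split; [move=> n; rewrite block_entropyE|exists (- (a + t))].
Unshelve. all: by end_near. Qed.

End ForwardRecursion.

(** * Geometric convergence of the gain in the majorant norm *)

Section GainSeries.
Variables (R : realType) (l m : nat).
Local Notation BR := (measurableTypeR R).
Local Notation leb := (@lebesgue_measure R).
Local Notation lam n := (@lebesgue_tuple R n).
Local Notation T n := (measSpace (n.-tuple BR) R).
Local Notation S := (trivSpace (@sum_complete_real R)).
Variables (P : 'rV[R]_m -> 'M[R]_l) (p : 'rV[R]_m -> 'rV[R]_l) (q : 'rV[R]_m -> R -> 'I_l -> R).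
Variables (r rho rate : R) (a : 'I_l -> 'I_l -> R) (b : 'I_l -> R) (M : 'I_l -> R -> R).
Variables (G : forall n, n.+1.-tuple BR -> 'rV[R]_m -> R) (A A1 : R).
Arguments G {n}.
Hypothesis r0 : 0 < r.
Hypothesis PSP : forall i j, PS (X := S) r (fun _ h => P h i j) (fun=> a i j).
Hypothesis PSp : forall i, PS (X := S) r (fun _ h => p h 0 i) (fun=> b i).
Hypothesis PSq : forall j, PS (X := measSpace BR R) r (fun z h => q h z j) (M j).
Hypothesis IM : forall j, leb.-integrable setT (EFin \o M j).
Hypothesis rhoP : forall i, \sum_j a i j * \int[leb]_z M j z <= rho.
Hypothesis rho0 : 0 <= rho.
Hypothesis rate0 : 0 <= rate.
Hypothesis rho_rate : rho * rate < 1.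
Hypothesis PSG : forall n, PS (X := T n.+1) r (@G n) (fun=> A).
Hypothesis PSdG : forall n, PS (X := T n.+2) r (fun v h => G v h - G (tbelast v) h)
  (fun=> A1 * rate ^+ n).
Hypothesis stochP : forall h, polydisc r h -> stochastic (P h).
Hypothesis statp : forall h, polydisc r h -> stationary_vector (P h) (p h).
Hypothesis pdf : forall h j, polydisc r h -> probability_density (q h ^~ j).

Fixpoint bmaj (w : seq R) : 'I_l -> R :=
  if w is z :: w' then fun i => \sum_j a i j * M j z * bmaj w' j else fun=> 1.

Let a0 i j : 0 <= a i j. Proof. exact: (PS_ge0 (X := S) tt (PSP i j)). Qed.
Let b0 i : 0 <= b i. Proof. exact: (PS_ge0 (X := S) tt (PSp i)). Qed.
Let M0 j z : 0 <= M j z. Proof. exact: (PS_ge0 (X := measSpace BR R) z (PSq j)). Qed.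
Let A0 : 0 <= A. Proof. exact: (PS_ge0 (X := T 1) [tuple 0] (PSG 0)). Qed.
Let A10 : 0 <= A1.
Proof. by have := PS_ge0 (X := T 2) [tuple 0; 0] (PSdG 0); rewrite mulr1. Qed.
Let iM j : 0 <= \int[leb]_z M j z. Proof. by apply: Rintegral_ge0 => z _. Qed.

Lemma PS_betaq n i : PS (X := T n) r (fun w h => betaq (P h) (q h) w i) (fun w => bmaj w i).
Proof.
elim: n i => [|n IH] i.
  by apply: PS_ext (PS_le _ (PS_cst (T 0) m 1 r)) => [w h _|w]; rewrite (tuple0 w)//= normr1.
have Pm := PS_sum (P := predT) (fun j _ => PS_mul (PS_mul (PS_lift (T n.+1) (tt : S) (PSP i j))
  (PS_param (@measurable_thead R n) (PSq j))) (PS_param (@measurable_tbehead R n) (IH j))).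
by apply: PS_ext (PS_le _ Pm) => [w h _|w]; [rewrite betaq_tupleE|rewrite [X in _ <= bmaj X i]tuple_consE].
Qed.

(** Majorants replace the entries of [P] and the channel densities, so that every letter costs a
    factor [rho] where the true densities have total mass 1. *)
Lemma bmaj_integral n i : (lam n).-integrable setT (EFin \o (fun w : n.-tuple BR => bmaj w i)) /\
  0 <= \int[lam n]_w bmaj w i <= rho ^+ n.
Proof.
elim: n i => [|n IH] i.
  have e : (fun w : 0.-tuple BR => bmaj w i) = fun=> 1 by apply/funext => w; rewrite (tuple0 w).
  have E : (\int[lam 0]_w 1%:E = 1 :> \bar R)%E.
    by rewrite integral_cst// mul1e /= diracE in_setT.
  rewrite e /Rintegral E expr0 ler01 lexx; split => //.
  apply/integrableP; split; first exact: measurable_cst.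
  by under eq_integral do rewrite /= normr1; rewrite E ltry.
pose g j (v : n.+1.-tuple BR) := M j (thead v) * bmaj [tuple of behead v] j * a i j.
have e : (fun w : n.+1.-tuple BR => bmaj w i) = fun v => \sum_j g j v.
  by apply/funext => v; rewrite [X in bmaj X i]tuple_consE; apply: eq_bigr => j _; rewrite /g /= -mulrA mulrC.
have fb j := tuple_product (IM j) (IH j).1.
have Ig j : (lam n.+1).-integrable setT (EFin \o g j) by apply: integrableM_cst; exact: (fb j).1.
have [I1 I2] := @Rintegral_sum _ _ _ (lam n.+1) _ (index_enum 'I_l) g Ig.
rewrite e; split => //; rewrite I2.
have gE j : \int[lam n.+1]_v g j v = a i j * \int[leb]_z M j z * \int[lam n]_w bmaj w j.
  by rewrite RintegralZr//; [rewrite (fb j).2 mulrC mulrA|exact: (fb j).1].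
under eq_bigr do rewrite gE; apply/andP; split.
  by apply: sumr_ge0 => j _; rewrite !mulr_ge0//; case/andP: (IH j).2.
rewrite exprS; apply: (@le_trans _ _ (\sum_j a i j * \int[leb]_z M j z * rho ^+ n)).
  by apply: ler_sum => j _; rewrite ler_wpM2l ?mulr_ge0//; case/andP: (IH j).2.
by rewrite -mulr_suml ler_wpM2r ?exprn_ge0.
Qed.

Definition dmaj (w : seq R) := \sum_i b i * bmaj w i.

Lemma PS_dens n : PS (X := T n) r (fun w h => dens (p h) (P h) (q h) w) (fun w => dmaj w).
Proof.
exact: (PS_sum (P := predT) (fun i _ => PS_mul (PS_lift (T n) (tt : S) (PSp i)) (PS_betaq n i))).
Qed.

Lemma dmaj_integral n : (lam n).-integrable setT (EFin \o (fun w : n.-tuple BR => dmaj w)) /\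
  \int[lam n]_w dmaj w <= (\sum_i b i) * rho ^+ n.
Proof.
have Ig i : (lam n).-integrable setT (EFin \o (fun w : n.-tuple BR => bmaj w i * b i)).
  by apply: integrableM_cst; exact: (bmaj_integral n i).1.
have [I1 I2] := @Rintegral_sum _ _ _ (lam n) _ (index_enum 'I_l) _ Ig.
have e : (fun w : n.-tuple BR => dmaj w) = fun w => \sum_i bmaj w i * b i.
  by apply/funext => v; apply: eq_bigr => i _; rewrite mulrC.
rewrite e; split => //; rewrite I2 mulr_suml; apply: ler_sum => i _.
rewrite RintegralZr//; last exact: (bmaj_integral n i).1.
by rewrite mulrC ler_wpM2l//; case/andP: (bmaj_integral n i).2.
Qed.

Lemma PS_dens_int n (H : n.-tuple BR -> 'rV[R]_m -> R) B : PS (X := T n) r H (fun=> B) ->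
  PS (X := S) r (fun _ h => \int[lam n]_w (dens (p h) (P h) (q h) w * H w h))
    (fun=> (\sum_i b i) * rho ^+ n * B).
Proof.
move=> PH; have [I1 I2] := dmaj_integral n.
have B0 : 0 <= B by exact: (PS_ge0 (X := T n) [tuple of nseq n 0] PH).
apply: (PS_int (mu := lam n) _ r0 _ _ (PS_mul (PS_dens n) PH)); first exact: integrableM_cst.
by rewrite RintegralZr// ler_wpM2r.
Qed.

Let gn n h := gain (p h) (P h) (q h) (fun n v => @G n v h) n.

(** Marginalisation writes [gn n] as an integral over one more letter. The difference then
    integrates the density against [G v - G (tbelast v)]: growth [rho] per letter against decay
    [rate]. *)
Lemma PS_gain_step n : PS (X := S) r (fun _ h => gn n.+1 h - gn n h)
  (fun=> (\sum_i b i) * rho ^+ 2 * A1 * (rho * rate) ^+ n).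
Proof.
apply: PS_ext (PS_le _ (PS_dens_int (PSdG n))) => [_ h hr|_]; last first.
  by rewrite exprMn !exprS expr0 le_eqVlt; apply/orP; left; apply/eqP; ring.
have mG k : measurable_fun setT (fun v : k.+1.-tuple BR => G v h) by exact: PS_measurable (PSG k) hr.
have bG k (v : k.+1.-tuple BR) : `|G v h| <= A by exact: (PS_bound (X := T k.+1) v (PSG k) hr).
have ph j := pdf j hr.
rewrite /gn /gain -(dens_marginal (p h) (stochP hr) ph (mG n) (bG n)).
have mGt : measurable_fun setT (fun v : n.+2.-tuple BR => G (tbelast v) h).
  exact: (measurableT_comp (mG n) (@measurable_tbelast R n.+1)).
have I1 := (dens_bounded_integral (p h) (stochP hr) ph (mG n.+1) (bG n.+1)).1.
have I2 := (dens_bounded_integral (p h) (stochP hr) ph mGt (fun v => bG n _)).1.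
rewrite -RintegralB//; congr fine; apply: eq_integral => v _.
by rewrite mulrBr.
Qed.

Lemma gain_limit : exists t B, PS (X := S) r (fun _ => t) (fun=> B) /\
  forall h, polydisc r h -> gn n h @[n --> \oo] --> t h.
Proof.
pose D n := (\sum_i b i) * rho ^+ 2 * A1 * (rho * rate) ^+ n.
have rr0 : 0 <= rho * rate by rewrite mulr_ge0.
have rr1 : `|rho * rate| <= rho * rate by rewrite ger0_norm.
have [gb _] := geometric_sums S rr0 rho_rate rr1.
pose k := (\sum_i b i) * rho ^+ 2 * A1.
have k0 : 0 <= k by rewrite !mulr_ge0 ?exprn_ge0// sumr_ge0.
have Db : abs_bound D (k * (1 - rho * rate)^-1).
  move=> F; under eq_bigr do rewrite /D -/k normrM (ger0_norm k0).
  by rewrite -mulr_sumr ler_wpM2l.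
have [s hs] : exists s, forall h, polydisc r h -> sums (fun n => gn n.+1 h - gn n h) (s h).
  have /choice[s hs] : forall h, exists t, polydisc r h -> sums (fun n => gn n.+1 h - gn n h) t.
    move=> h; have [hr|nh] := pselect (polydisc r h); last by exists 0.
    have [|t ht] := @sum_complete_real R _ (fun n => gn n.+1 h - gn n h) (k * (1 - rho * rate)^-1).
      apply: abs_bound_dom Db => n; have := PS_bound (X := S) tt (PS_gain_step n) hr.
      by move/le_trans; apply; rewrite ler_norm.
    by exists t.
  by exists s.
have Ps : PS (X := S) r (fun _ => s) (fun=> k * (1 - rho * rate)^-1).
  by apply: PS_series PS_gain_step _ _ => // _ h hr; exact: hs.
have Pg := PS_dens_int (PSG 0).
eexists; eexists; split; first exact: PS_add Pg Ps.
move=> h hr /=; have := sums_cvg (hs h hr).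
move=> /(cvgD (cvg_cst (gn 0 h))); apply: cvg_trans.
apply: near_eq_cvg; near=> n.
transitivity (gn 0 h + \sum_(k < n) (gn k.+1 h - gn k h)); first by [].
by rewrite -(big_mkord predT (fun k => gn k.+1 h - gn k h)) telescope_sumr// addrC subrK.
Unshelve. all: by end_near. Qed.

End GainSeries.

(** * Analyticity of the stationary vector *)

Section Stationary.
Variables (R : realType) (l m : nat).
Local Notation S := (trivSpace (@sum_complete_real R)).
Variables (P : 'rV[R]_m -> 'M[R]_l) (p : 'rV[R]_m -> 'rV[R]_l) (r c e : R) (i0 : 'I_l).
Hypothesis r0 : 0 < r.
Hypothesis c0 : 0 < c.
Hypothesis ec : e < c.
Hypothesis cP : forall i j, c <= P 0 i j.
Hypothesis PSP : forall i j, PS (X := S) r (fun _ h => P h i j - P 0 i j) (fun=> e).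
Hypothesis stochP : forall h, polydisc r h -> stochastic (P h).
Hypothesis statp : forall h, polydisc r h -> stationary_vector (P h) (p h).

Let e0 : 0 <= e. Proof. exact: (PS_ge0 (X := S) tt (PSP i0 i0)). Qed.
Let qh i j := P 0 i j - c + e.
Let k : R := 1 - l%:R * (c - e).

Let qh0 i j : 0 <= qh i j. Proof. by rewrite addr_ge0// subr_ge0. Qed.

Let qh_sum i : \sum_j qh i j = k.
Proof.
have [_ h] := stochP (@polydisc0 R m r r0).
by rewrite big_split sumrB /= h !sumr_const card_ord /k -[_ *+ l]mulr_natl -[e *+ l]mulr_natl; ring.
Qed.

Let k0 : 0 <= k. Proof. by rewrite -(qh_sum i0) sumr_ge0. Qed.

Let k1 : k < 1.
Proof.
by rewrite /k ltrBlDr ltrDl mulr_gt0 ?subr_gt0// ltr0n (leq_ltn_trans _ (ltn_ord i0)).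
Qed.

Let PSq i j : PS (X := S) r (fun _ h => P h i j - c) (fun=> qh i j).
Proof.
apply: PS_ext (PS_le _ (PS_add (PSP i j) (PS_cst S m (P 0 i j - c) r))) => [_ h _|_].
  by rewrite addrA subrK.
by rewrite ger0_norm ?subr_ge0// addrC.
Qed.

Fixpoint iter_row (h : 'rV[R]_m) (v : 'I_l -> R) n : 'I_l -> R :=
  if n is n'.+1 then fun j => \sum_i iter_row h v n' i * (P h i j - c) else v.

Fixpoint iter_maj n : 'I_l -> R :=
  if n is n'.+1 then fun j => \sum_i iter_maj n' i * qh i j else fun=> c.

Let maj0 n j : 0 <= iter_maj n j.
Proof. by elim: n j => [|n IH] j /=; [exact: ltW|rewrite sumr_ge0// => i _; rewrite mulr_ge0]. Qed.

Let maj_sum n : \sum_j iter_maj n j = l%:R * c * k ^+ n.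
Proof.
elim: n => [|n IH] /=; first by rewrite sumr_const card_ord mulr1 mulr_natl.
rewrite exchange_big /= exprSr mulrA -IH mulr_suml; apply: eq_bigr => i _.
by rewrite -mulr_sumr qh_sum.
Qed.

Let maj_le n j : iter_maj n j <= l%:R * c * k ^+ n.
Proof. by rewrite -maj_sum (bigD1 j)//= lerDl sumr_ge0. Qed.

Let PSv n j : PS (X := S) r (fun _ h => iter_row h (fun=> c) n j) (fun=> iter_maj n j).
Proof.
elim: n j => [|n IH] j /=; first by apply: PS_le (PS_cst S m c r) => _; rewrite gtr0_norm.
exact: (PS_sum (P := predT) (fun i _ => PS_mul (IH i) (PSq i j))).
Qed.

Let remainder_step h n j : polydisc r h ->
  iter_row h (fun i => p h 0 i) n j = iter_row h (fun=> c) n j + iter_row h (fun i => p h 0 i) n.+1 j.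
Proof.
move=> hr; have [_ p1 pP] := statp hr.
elim: n j => [|n IH] j; last first.
  rewrite [LHS]/= [X in _ = X + _]/= [iter_row _ _ n.+2 j]/= -big_split/=; apply: eq_bigr => i _.
  by rewrite -mulrDl {1}IH.
rewrite /= -[in LHS]pP mxE; under [X in _ = _ + X]eq_bigr do rewrite mulrBr.
by rewrite sumrB -mulr_suml p1 mul1r addrC subrK.
Qed.

Let remainder_le h n : polydisc r h -> \sum_j `|iter_row h (fun i => p h 0 i) n j| <= k ^+ n.
Proof.
move=> hr; have [p0 p1 _] := statp hr.
elim: n => [|n IH] /=.
  by under eq_bigr do rewrite ger0_norm//; rewrite p1.
apply: (@le_trans _ _ (\sum_j \sum_i `|iter_row h (fun i => p h 0 i) n i| * qh i j)).
  apply: ler_sum => j _; apply: le_trans (ler_norm_sum _ _ _) _; apply: ler_sum => i _.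
  by rewrite normrM ler_wpM2l//; exact: (PS_bound (X := S) tt (PSq i j) hr).
rewrite exchange_big/=; under eq_bigr do rewrite -mulr_sumr qh_sum.
by rewrite -mulr_suml exprSr ler_wpM2r.
Qed.

(** As [p] sums to 1, subtracting [c] from all entries of [P] turns stationarity into
    [p = c + p (P - c)]. Iteration gives a Neumann series, which converges since the majorant [qh]
    of [P - c] has row sums [k = 1 - l * (c - e) < 1]. *)
Lemma PS_stationary j : PS (X := S) r (fun _ h => p h 0 j) (fun=> l%:R * c * (1 - k)^-1).
Proof.
have kk : `|k| <= k by rewrite ger0_norm.
have [gb _] := geometric_sums S k0 k1 kk.
have lc0 : 0 <= l%:R * c by rewrite mulr_ge0// ltW.
have Vb : abs_bound (fun n => iter_maj n j) (l%:R * c * (1 - k)^-1).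
  move=> F; apply: (@le_trans _ _ (\sum_(n <- F) l%:R * c * `|k ^+ n|)).
    by apply: ler_sum => n _; rewrite !ger0_norm ?exprn_ge0.
  by rewrite -mulr_sumr ler_wpM2l.
apply: (PS_series (f_ := fun n _ h => iter_row h (fun=> c) n j) (M_ := fun n _ => iter_maj n j)) => //.
move=> _ h hr.
have [|s hs] := @sum_complete_real R _ (fun n => iter_row h (fun=> c) n j) (l%:R * c * (1 - k)^-1).
  apply: abs_bound_dom Vb => n; rewrite (ger0_norm (maj0 n j)).
  exact: (PS_bound (X := S) tt (PSv n j) hr).
suff -> : p h 0 j = s by [].
(* The partial sum misses [p] by the remainder [p (P - c)^n], of size at most [k ^+ n]. *)
have tel n : \sum_(i < n) iter_row h (fun=> c) i j = p h 0 j - iter_row h (fun i => p h 0 i) n j.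
  elim: n => [|n IH]; first by rewrite big_ord0 subrr.
  have E := remainder_step n j hr; move: E; set u1 := iter_row _ _ n.+1 j => E.
  rewrite big_ord_recr; transitivity (p h 0 j - iter_row h (fun i => p h 0 i) n j + iter_row h (fun=> c) n j).
    by rewrite -IH.
  by rewrite E; ring.
have u0 : iter_row h (fun i => p h 0 i) n j @[n --> \oo] --> 0.
  apply/cvgr0Pnorm_le => d d0; have k1' : `|k| < 1 by rewrite ger0_norm.
  have /cvgr0Pnorm_le/(_ d d0) := cvg_expr k1'; apply: filterS => n; apply: le_trans.
  rewrite [leRHS]ger0_norm ?exprn_ge0//; apply: le_trans (remainder_le n hr).
  by rewrite (bigD1 j)//= lerDl sumr_ge0.
have := sums_cvg hs; under eq_fun do rewrite tel; move=> cs.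
have c2 : p h 0 j - iter_row h (fun i => p h 0 i) n j @[n --> \oo] --> p h 0 j - 0.
  by apply: cvgB => //; exact: cvg_cst.
by rewrite subr0 in c2; exact: (cvg_unique _ c2 cs).
Qed.

End Stationary.

(** * From the hidden Markov density to the normalised recursion *)

Lemma exists_radius (R : realType) l (f : 'I_l -> R) (r : R) : 0 < r -> (forall j, 0 < f j) ->
  exists s, [/\ 0 < s, s <= r & forall j, s <= f j].
Proof.
move=> r0 f0; exists (\big[Num.min/r]_j f j); split.
- by elim/big_ind: _ => // x y x0 y0; rewrite lt_min x0.
- exact: bigmin_le_id.
- by move=> j; exact: bigmin_le.
Qed.

Lemma PS_small (R : realType) (X : coefSpace R) m (J : Type) (f : J -> X -> 'rV[R]_m -> R) (r B e : R) :
  0 < r -> 0 <= B -> 0 < e -> (forall j, PS r (f j) (fun=> B)) ->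
  exists2 s, 0 < s <= r & forall j, PS s (fun t h => f j t h - f j t 0) (fun=> e).
Proof.
move=> r0 B0 e0 fB; pose k := Num.min 1 (e / (B + 1)).
have B1 : 0 < B + 1 by rewrite ltr_wpDl.
have k0 : 0 < k by rewrite lt_min ltr01 divr_gt0.
have k1 : k <= 1 by rewrite ge_min lexx.
exists (k * r) => [|j]; first by rewrite mulr_gt0//= ler_piMl// ltW.
apply: PS_le (PS_sub0 (ltW r0) (ltW k0) k1 (fB j)) => _.
apply: (@le_trans _ _ (e / (B + 1) * B)); first by rewrite ler_wpM2r// ge_min lexx orbT.
by rewrite mulrAC ler_pdivrMr// ler_wpM2l ?(ltW e0)// lerDl.
Qed.

Section Bridge.
Variables (R : realType) (l m : nat) (I : 'I_l).
Local Notation BR := (measurableTypeR R).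
Variables (P : 'rV[R]_m -> 'M[R]_l) (p : 'rV[R]_m -> 'rV[R]_l) (q : 'rV[R]_m -> R -> 'I_l -> R) (c : R).
Definition kern h z i j := P h i j * (q h z j / q h z I).
Definition ratio0 z j := q 0 z j / q 0 z I.
Definition wgt h z i := p h 0 i * (q h z i / q h z I).
Definition prow h i := p h 0 i.

Local Notation BB := (pert kern ratio0 c).
Local Notation nrm := (nrm kern ratio0 c).
Variable C : R.
Hypothesis c0 : 0 < c.
Hypothesis c1 : c <= 1.
Hypothesis hKs : forall z i j, c * ratio0 z j <= kern 0 z i j <= ratio0 z j.
Hypothesis hs : forall z j, 0 <= ratio0 z j <= C.
Hypothesis sI : forall z, ratio0 z I = 1.
Variable h : 'rV[R]_m.
Hypothesis qI : forall z, 0 < q h z I.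
Hypothesis nrm_gt0 : forall n (v : n.+1.-tuple BR), 0 < nrm h (thead v) (behead v).

(** The recursions of [betaq] and [pert] differ by the positive factors [q h z I] and [nrm], the
    same for all [i]; [N] collects them. *)
Lemma betaq_BB n (w : n.-tuple BR) : exists2 N, 0 < N & forall i, betaq (P h) (q h) w i = N * BB h w i.
Proof.
elim: n w => [|n IH] w.
  by exists 1 => // i; rewrite (tuple0 w) /= /pert /= addr0 !mulr1.
have [N N0 NE] := IH [tuple of behead w].
have n0 := nrm_gt0 w; have z0 := qI (thead w).
exists (q h (thead w) I * N * nrm h (thead w) (behead w)); first by rewrite !mulr_gt0.
move=> i; rewrite betaq_tupleE.
transitivity (q h (thead w) I * N * (BB h w i * nrm h (thead w) (behead w))); last by ring.
rewrite [X in BB h X i]tuple_consE (pert_cons c0 c1 hKs hs sI) ?gt_eqF//.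
rewrite mulr_sumr; apply: eq_bigr => j _; rewrite NE /kern.
by field; rewrite gt_eqF.
Qed.

Hypothesis num_gt0 : forall n (v : n.+1.-tuple BR), 0 < num kern ratio0 c wgt h (thead v) (behead v).
Hypothesis den_gt0 : forall n (v : n.+1.-tuple BR), 0 < den kern ratio0 c prow h (thead v) (behead v).
Hypothesis statp : stationary_vector (P h) (p h).

(** The factor [N] is common to the densities of [v] and [behead v], so it drops out of their
    quotient. *)
Lemma ln_dens_log_ratio n (v : n.+1.-tuple BR) :
  ln (dens (p h) (P h) (q h) v) = ln (q h (thead v) I) + log_ratio kern ratio0 c wgt prow h (thead v) (behead v) +
    ln (dens (p h) (P h) (q h) (behead v)).
Proof.
have [N N0 NE] := betaq_BB [tuple of behead v].
have z0 := qI (thead v); have n0 := num_gt0 v; have d0 := den_gt0 v.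
have dE : dens (p h) (P h) (q h) (behead v) = N * den kern ratio0 c prow h (thead v) (behead v).
  by rewrite /dens /den /lin mulr_sumr; apply: eq_bigr => i _; rewrite NE mulrCA.
have -> : dens (p h) (P h) (q h) v = q h (thead v) I * (num kern ratio0 c wgt h (thead v) (behead v) /
    den kern ratio0 c prow h (thead v) (behead v)) * dens (p h) (P h) (q h) (behead v).
  rewrite dE [X in dens _ _ _ X]tuple_consE (dens_cons _ statp).
  transitivity (q h (thead v) I * N * num kern ratio0 c wgt h (thead v) (behead v)).
    rewrite /num /lin mulr_sumr; apply: eq_bigr => i _; rewrite NE /wgt.
    by field; rewrite gt_eqF.
  by field; rewrite gt_eqF.
have D0 : 0 < dens (p h) (P h) (q h) (behead v) by rewrite dE mulr_gt0.
have Q0 : 0 < num kern ratio0 c wgt h (thead v) (behead v) / den kern ratio0 c prow h (thead v) (behead v).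
  by rewrite divr_gt0.
have E1 := lnM (z0 : _ \is Num.pos) (Q0 : _ \is Num.pos).
have E2 := lnM (mulr_gt0 z0 Q0 : _ \is Num.pos) (D0 : _ \is Num.pos).
by rewrite E2 E1.
Qed.

End Bridge.

(** * The entropy rate as a power series around the base point *)

Section LocalEntropyRate.
Variables (R : realType) (l m : nat) (I : 'I_l).
Local Notation BR := (measurableTypeR R).
Local Notation leb := (@lebesgue_measure R).
Local Notation X := (measSpace BR R).
Local Notation S := (trivSpace (@sum_complete_real R)).
Variables (P : 'rV[R]_m -> 'M[R]_l) (p : 'rV[R]_m -> 'rV[R]_l) (q : 'rV[R]_m -> R -> 'I_l -> R).
Variables (c C B r0 : R).
Hypothesis c0 : 0 < c.
Hypothesis cP : forall i j, c <= P 0 i j.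
Hypothesis C1 : 1 <= C.
Hypothesis q00 : forall z j, 0 < q 0 z j.
Hypothesis ratioC : forall z j, q 0 z j / q 0 z I <= C.
Hypothesis r00 : 0 < r0.
Hypothesis B0 : 0 <= B.
Hypothesis stochP : forall h, polydisc r0 h -> stochastic (P h).
Hypothesis statp : forall h, polydisc r0 h -> stationary_vector (P h) (p h).
Hypothesis pdf : forall h j, polydisc r0 h -> probability_density (q h ^~ j).
Hypothesis qI0 : forall h z, polydisc r0 h -> 0 < q h z I.
Hypothesis PSP : forall i j, PS (X := S) r0 (fun _ h => P h i j) (fun=> B).
Hypothesis PSr : forall j e, 0 < e -> exists2 s, 0 < s &
  PS (X := X) s (fun z h => q h z j / q h z I - q 0 z j / q 0 z I) (fun=> e).
Hypothesis PSq : forall j, exists s M, [/\ 0 < s, leb.-integrable setT (EFin \o M) &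
  PS (X := X) s (fun z h => q h z j) M].
Hypothesis PSl : forall j, exists s M, [/\ 0 < s, leb.-integrable setT (EFin \o M) &
  PS (X := X) s (fun z h => q h z j * ln (q h z I)) M].

Let stoch0 := stochP (@polydisc0 R m r0 r00).
Let stat0 := statp (@polydisc0 R m r0 r00).

Lemma P0_le1 i j : P 0 i j <= 1.
Proof.
have [h0 h1] := stoch0; rewrite -(h1 i) (bigD1 j)//= lerDl sumr_ge0// => k _; exact: h0.
Qed.

Let c1 : c <= 1. Proof. exact: le_trans (cP I I) (P0_le1 I I). Qed.

Lemma p0_bounds j : c <= p 0 0 j <= 1.
Proof.
have [h0 h1 hP] := stat0; apply/andP; split.
  rewrite -hP mxE -[leLHS]mul1r -h1 mulr_suml; apply: ler_sum => i _.
  exact: ler_wpM2l.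
by rewrite -h1 (bigD1 j)//= lerDl sumr_ge0.
Qed.

Let l0 : 0 < l%:R :> R. Proof. by rewrite ltr0n (leq_ltn_trans _ (ltn_ord I)). Qed.
Let d : R := c ^+ 3 / (32 * l%:R).
Let d0 : 0 < d. Proof. by rewrite divr_gt0 ?mulr_gt0 ?exprn_gt0. Qed.
Let d_le : d <= c ^+ 2 / (8 * l%:R).
Proof.
rewrite /d exprSr -mulrA ler_wpM2l ?exprn_ge0 ?(ltW c0)// ler_pdivrMr ?mulr_gt0// mulrC.
have -> : 32 * l%:R * (8 * l%:R)^-1 = 4 :> R by field; rewrite gt_eqF.
by apply: le_trans c1 _; rewrite ler1n.
Qed.
(** The first bound keeps the growth per letter below [1 + c / 4], the second keeps the perturbation
    of transition times density ratio below [d]. *)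
Let e : R := Num.min (c / (16 * l%:R)) (d / (2 * (C + 1))).
Let e0 : 0 < e.
Proof.
have C0 : 0 < C + 1 by rewrite ltr_wpDl// (le_trans ler01).
by rewrite lt_min; apply/andP; split; rewrite divr_gt0// mulr_gt0. Qed.

Let l1 : 1 <= l%:R :> R. Proof. by rewrite ler1n -(ltr0n R). Qed.

Let ec : e < c.
Proof.
apply: (@le_lt_trans _ _ (c / (16 * l%:R))); first by rewrite ge_min lexx.
by rewrite ltr_pdivrMr ?mulr_gt0// ltr_pMr//; have := l1; lra.
Qed.

Lemma common_polydisc : exists r, [/\ 0 < r <= r0,
  forall i j, PS (X := S) r (fun _ h => P h i j - P 0 i j) (fun=> e),
  (exists Bp, forall j, PS (X := S) r (fun _ h => p h 0 j) (fun=> Bp)) /\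
  (forall j, PS (X := S) r (fun _ h => p h 0 j - p 0 0 j) (fun=> e)),
  forall j, PS (X := X) r (fun z h => q h z j / q h z I - q 0 z j / q 0 z I) (fun=> d / 2) &
  forall j, (exists M, [/\ leb.-integrable setT (EFin \o M), \int[leb]_z M z <= 1 + c / (16 * l%:R) &
       PS (X := X) r (fun z h => q h z j) M]) /\
    (exists M, leb.-integrable setT (EFin \o M) /\ PS (X := X) r (fun z h => q h z j * ln (q h z I)) M)].
Proof.
have [r1 /andP[r10 r1r0] P1] : exists2 r1, 0 < r1 <= r0 & forall i j, PS (X := S) r1 (fun _ h => P h i j - P 0 i j) (fun=> e).
  have [s sr PPs] := PS_small r00 B0 e0 (fun ij : 'I_l * 'I_l => PSP ij.1 ij.2).
  by exists s => // i j; exact: (PPs (i, j)).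
have sub1 (h : 'rV[R]_m) : polydisc r1 h -> polydisc r0 h by move=> hr i; apply: le_trans (hr i) r1r0.
have Pp := PS_stationary I r10 c0 ec cP P1 (fun h hr => stochP (sub1 h hr)) (fun h hr => statp (sub1 h hr)).
set Bp := l%:R * c * _ in Pp.
have Bp0 : 0 <= Bp by exact: (PS_ge0 (X := S) tt (Pp I)).
have [r2 /andP[r20 r2r1] P2] : exists2 r2, 0 < r2 <= r1 & forall j, PS (X := S) r2 (fun _ h => p h 0 j - p 0 0 j) (fun=> e).
  exact: (PS_small r10 Bp0 e0 Pp).
have Q j : exists2 s, 0 < s & [/\ PS (X := X) s (fun z h => q h z j / q h z I - q 0 z j / q 0 z I) (fun=> d / 2),
   (exists M, [/\ leb.-integrable setT (EFin \o M), \int[leb]_z M z <= 1 + c / (16 * l%:R) &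
       PS (X := X) s (fun z h => q h z j) M]) &
    (exists M, leb.-integrable setT (EFin \o M) /\ PS (X := X) s (fun z h => q h z j * ln (q h z I)) M)].
  have d20 : 0 < d / 2 by rewrite divr_gt0.
  have [s1 s10 Q1] := PSr j d20; have [s2 [M [s20 IM Q2]]] := PSq j; have [s3 [M' [s30 IM' Q3]]] := PSl j.
  have M0 z : 0 <= M z by exact: (PS_ge0 (X := X) z Q2).
  have iM0 : 0 <= \int[leb]_z M z by apply: Rintegral_ge0 => z _.
  have iM1 : 0 < \int[leb]_z M z + 1 by rewrite ltr_wpDl.
  have e10 : 0 < c / (16 * l%:R) by rewrite divr_gt0// mulr_gt0.
  (* Shrinking the radius by [k] leaves the density at the base point, of integral 1, plus a
     variation whose majorant integrates to at most [c / (16 * l)]. *)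
  pose k := Num.min 1 (c / (16 * l%:R) / (\int[leb]_z M z + 1)).
  have k0 : 0 < k by rewrite lt_min ltr01 divr_gt0.
  have k1 : k <= 1 by rewrite ge_min lexx.
  have kM : k * \int[leb]_z M z <= c / (16 * l%:R).
    apply: (@le_trans _ _ (c / (16 * l%:R) / (\int[leb]_z M z + 1) * \int[leb]_z M z)).
      by rewrite ler_wpM2r// ge_min lexx orbT.
    by rewrite mulrAC ler_pdivrMr// ler_wpM2l ?(ltW e10)// lerDl.
  have [mq0 q0p q01] := pdf j (@polydisc0 R m r0 r00).
  have Iq : leb.-integrable setT (EFin \o (fun z => q 0 z j)).
    apply/integrableP; split; first exact/measurable_EFinP.
    by under eq_integral do rewrite /= ger0_norm//; rewrite q01 ltry.
  have ks0 : 0 < k * s2 by rewrite mulr_gt0.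
  pose s := Num.min s1 (Num.min (k * s2) s3).
  have ss : 0 < s by rewrite !lt_min s10 s30 ks0.
  have [ss1 ss2 ss3] : [/\ s <= s1, s <= k * s2 & s <= s3] by rewrite !ge_min !lexx ?orbT.
  exists s => //; split; first exact: PS_shrink (ltW ss) ss1 Q1; last first.
    by exists M'; split => //; exact: PS_shrink (ltW ss) ss3 Q3.
  exists (fun z => q 0 z j + M z * k).
  have IMk : leb.-integrable setT (EFin \o (fun z => M z * k)) by exact: integrableM_cst.
  split; first by have := integrableD measurableT Iq IMk; exact.
    have q1 : \int[leb]_z q 0 z j = 1 by rewrite /Rintegral q01.
    by rewrite RintegralD// q1 RintegralZr// lerD2l mulrC.
  apply: PS_shrink (ltW ss) ss2 _.
  have Pq := PS_add (PS_sub0 (ltW s20) (ltW k0) k1 Q2) (PS_adm (X := X) m (k * s2) mq0).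
  apply: PS_ext (PS_le _ Pq) => [z h _|z]; first by rewrite subrK.
  by rewrite ger0_norm// addrC [k * _]mulrC.
have /choice[f fQ] : forall j, exists s, 0 < s /\ [/\ PS (X := X) s (fun z h => q h z j / q h z I - q 0 z j / q 0 z I) (fun=> d / 2),
   (exists M, [/\ leb.-integrable setT (EFin \o M), \int[leb]_z M z <= 1 + c / (16 * l%:R) &
       PS (X := X) s (fun z h => q h z j) M]) &
    (exists M, leb.-integrable setT (EFin \o M) /\ PS (X := X) s (fun z h => q h z j * ln (q h z I)) M)].
  by move=> j; have [s s0 sQ] := Q j; exists s.
have [r [rr0 rr2 rf]] := exists_radius r20 (fun j => (fQ j).1).
have rr := ltW rr0.
exists r; split => //.
- by rewrite rr0 (le_trans rr2 (le_trans r2r1 r1r0)).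
- by move=> i j; exact: PS_shrink rr (le_trans rr2 r2r1) (P1 i j).
- split; last by move=> j; exact: PS_shrink rr rr2 (P2 j).
  by exists Bp => j; exact: PS_shrink rr (le_trans rr2 r2r1) (Pp j).
- by move=> j; have [_ [h _ _]] := fQ j; exact: PS_shrink rr (rf j) h.
- move=> j; have [_ [_ [M [M1 M2 M3]] [M' [M1' M2']]]] := fQ j; split.
    by exists M; split => //; exact: PS_shrink rr (rf j) M3.
  by exists M'; split => //; exact: PS_shrink rr (rf j) M2'.
Qed.

Let mq j : measurable_fun setT ((fun z => q 0 z j) : BR -> R).
Proof. by have [h _ _] := pdf j (@polydisc0 R m r0 r00). Qed.

Let s := ratio0 I q.
Let K := kern I P q.
Let w := wgt I p q.

Let ms j : measurable_fun setT (s ^~ j : BR -> R). Proof. exact: measurable_div. Qed.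

Let hs z j : 0 <= s z j <= C. Proof. by rewrite ratioC andbT divr_ge0// ltW. Qed.

Let sI z : s z I = 1. Proof. by rewrite /s /ratio0 divff// gt_eqF. Qed.

Let hKs z i j : c * s z j <= K 0 z i j <= s z j.
Proof.
have /andP[s0 _] := hs z j; rewrite /K /kern -/(ratio0 I q z j) ler_wpM2r//=.
by rewrite ler_piMl// P0_le1.
Qed.

Let has z i : c * s z i <= w 0 z i <= s z i.
Proof.
have /andP[s0 _] := hs z i; have /andP[p1 p2] := p0_bounds i.
by rewrite /w /wgt -/(ratio0 I q z i) ler_wpM2r//= ler_piMl.
Qed.

Let mK i j : measurable_fun setT ((fun z => K 0 z i j) : BR -> R).
Proof. by apply: measurable_funM; [exact: measurable_cst|exact: ms]. Qed.

Let mw i : measurable_fun setT ((fun z => w 0 z i) : BR -> R).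
Proof. by apply: measurable_funM; [exact: measurable_cst|exact: ms]. Qed.

Let d1 : d / 2 <= 1.
Proof.
rewrite ler_pdivrMr// mul1r (le_trans d_le)// ler_pdivrMr ?mulr_gt0//.
have := l1; have : c ^+ 2 <= 1 by rewrite exprn_ile1// ltW.
lra.
Qed.

Let eC : e * (C + 1) <= d / 2.
Proof.
have C0 : 0 < C + 1 by rewrite ltr_wpDl// (le_trans ler01).
apply: (@le_trans _ _ (d / (2 * (C + 1)) * (C + 1))).
  by rewrite ler_wpM2r ?(ltW C0)// ge_min lexx orbT.
by rewrite invfM -mulrA divfK// gt_eqF.
Qed.

Let e_le : e <= d / 2.
Proof.
apply: le_trans eC; rewrite -[leLHS]mulr1 ler_wpM2l ?(ltW e0)// lerDr.
exact: le_trans ler01 C1.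
Qed.

Let PS_scaled r (u : 'rV[R]_m -> R) j : 0 < r -> 0 <= u 0 <= 1 ->
  PS (X := S) r (fun _ h => u h - u 0) (fun=> e) ->
  PS (X := X) r (fun z h => q h z j / q h z I - q 0 z j / q 0 z I) (fun=> d / 2) ->
  PS (X := X) r (fun z h => u h * (q h z j / q h z I) - u 0 * (q 0 z j / q 0 z I)) (fun=> d).
Proof.
move=> r_gt0 /andP[u0 u1] Pu Pr.
have Pr' : PS (X := X) r (fun z h => q h z j / q h z I) (fun=> C + 1).
  apply: PS_ext (PS_le _ (PS_add Pr (PS_adm (X := X) m r (ms j)))) => [z h _|z]; first by rewrite subrK.
  have /andP[s0 s1] := hs z j; rewrite ger0_norm// addrC; apply: lerD => //; exact: d1.
have PQ := PS_add (PS_mul (PS_lift X (tt : S) Pu) Pr') (PS_mul (PS_cst X m (u 0) r) Pr).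
apply: PS_ext (PS_le _ PQ) => [z h _|z]; first by ring.
rewrite ger0_norm//; have := eC; have : u 0 * (d / 2) <= d / 2 by rewrite ler_piMl// divr_ge0// ltW.
lra.
Qed.

Lemma local_entropy_rate : exists r F A, [/\ 0 < r <= r0, PS (X := S) r (fun _ => F) (fun=> A) &
  forall h, polydisc r h -> entropy_rate_defined (p h) (P h) (q h) /\
    entropy_rate (p h) (P h) (q h) = (F h)%:E].
Proof.
have [r [/andP[rp rr0] dP [[Bp Pp] dp] dr dq]] := common_polydisc.
have sub0 (h : 'rV[R]_m) : polydisc r h -> polydisc r0 h by move=> hr i; apply: le_trans (hr i) rr0.
have hK i j : PS (X := X) r (fun z h => K h z i j - K 0 z i j) (fun=> d).
  apply: (PS_scaled (u := fun h => P h i j)) => //.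
  by rewrite P0_le1 andbT (le_trans (ltW c0)).
have PSw i : PS (X := X) r (fun z h => w h z i - w 0 z i) (fun=> c ^+ 2 / (8 * l%:R)).
  apply: PS_le (PS_scaled (u := fun h => p h 0 i) rp _ (dp i) (dr i)) => //.
  by have /andP[p1 ->] := p0_bounds i; rewrite andbT (le_trans (ltW c0)).
have PSp i : PS (X := X) r (fun _ h => prow p h i - prow p 0 i) (fun=> c ^+ 2 / (8 * l%:R)).
  apply: PS_le (PS_lift X (tt : S) (dp i)) => _; apply: le_trans e_le _; apply: le_trans d_le.
  by rewrite ler_pdivrMr// ler_pMr// ler1n.
pose G n (v : n.+1.-tuple BR) h := log_ratio K s c w (prow p) h (thead v) (behead v).
have [A A0 PA] := PS_log_ratio c0 c1 hKs hs sI ms mK hK has mw PSw p0_bounds PSp.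
have [A1 A10 PA1] := PS_log_ratio_step c0 c1 hKs hs sI ms mK hK has mw PSw p0_bounds PSp.
have /choice[M MP] := fun j => (dq j).1.
have /choice[N NP] := fun j => (dq j).2.
have PP i j : PS (X := S) r (fun _ h => P h i j) (fun=> P 0 i j + e).
  apply: PS_ext (PS_le _ (PS_add (dP i j) (PS_cst S m (P 0 i j) r))) => [_ h _|_]; first by rewrite subrK.
  by rewrite ger0_norm ?(le_trans (ltW c0))// addrC.
(* Bounded by [(1 + c / 16) ^+ 2]: the row of [P 0] sums to 1, the [l] errors [e] add at most
   [c / 16], and the integrals exceed 1 by at most [c / 16]. *)
have rhoP i : \sum_j (P 0 i j + e) * \int[leb]_z M j z <= 1 + c / 4.
  have e16 : 0 < c / (16 * l%:R) by rewrite divr_gt0// mulr_gt0.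
  have [_ P1] := stoch0.
  apply: (@le_trans _ _ (\sum_j (P 0 i j + e) * (1 + c / (16 * l%:R)))).
    apply: ler_sum => j _; rewrite ler_wpM2l ?addr_ge0 ?(ltW e0) ?(le_trans (ltW c0))//.
    by have [] := MP j.
  rewrite -mulr_suml big_split/= P1 sumr_const card_ord -[e *+ l]mulr_natl.
  have le16 : l%:R * e <= c / 16.
    have -> : c / 16 = l%:R * (c / (16 * l%:R)) by field; rewrite gt_eqF.
    by rewrite ler_wpM2l ?(ltW l0)// ge_min lexx.
  have c16 : c / (16 * l%:R) <= c / 16.
    by rewrite invfM mulrA ler_piMr ?divr_ge0 ?(ltW c0)// invf_le1.
  apply: (@le_trans _ _ ((1 + c / 16) * (1 + c / 16))).
    have a1 : 0 <= 1 + l%:R * e by rewrite addr_ge0// mulr_ge0// ltW.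
    have a2 : 0 <= 1 + c / (16 * l%:R) by rewrite addr_ge0// ltW.
    by apply: ler_pM => //; rewrite lerD2l.
  have : c * c <= c * 1 by rewrite ler_wpM2l// ltW.
  have := c0; nra.
have rho0 : 0 <= 1 + c / 4 by rewrite addr_ge0// divr_ge0// ltW.
have rate0 : 0 <= rate c by rewrite /rate; have := c1; lra.
(* The product is [1 - c / 4 - c ^+ 2 / 8]: contraction beats growth. *)
have rr1 : (1 + c / 4) * rate c < 1.
  rewrite /rate; have : 0 < c * c by rewrite mulr_gt0.
  have := c0; nra.
have [t [Bt [Pt tP]]] := gain_limit rp PP Pp (fun j => let: And3 _ _ h := MP j in h)
  (fun j => let: And3 h _ _ := MP j in h) rhoP rho0 rate0 rr1 PA PA1
  (fun h hr => stochP (sub0 h hr)) (fun h j hr => pdf j (sub0 h hr)).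
pose F h := - (\sum_j p h 0 j * \int[leb]_z (q h z j * ln (q h z I)) + t h).
have PL j : PS (X := S) r (fun _ h => \int[leb]_z (q h z j * ln (q h z I))) (fun=> \int[leb]_z N j z).
  by have [IN PN] := NP j; apply: (PS_int (mu := leb) _ rp IN (lexx _) PN).
have PF := PS_opp (PS_add (PS_sum (P := predT) (fun j _ => PS_mul (Pp j) (PL j))) Pt).
exists r, F; eexists; split; [by rewrite rp|exact: PF|].
move=> h hr; have hr0 := sub0 h hr.
have p_gt0 j : 0 < p h 0 j.
  have := PS_bound (X := S) tt (dp j) hr; have /andP[cp _] := p0_bounds j.
  by rewrite ler_norml => /andP[pe _]; have := ec; move: cp pe; lra.
apply: (@entropy_rate_limit R l (p h) (P h) (q h) (stochP hr0) (fun j => pdf j hr0) (statp hr0) I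
  (fun n v => G n v h) A).
- by move=> n; exact: PS_measurable (PA n) hr.
- by move=> n v; exact: (PS_bound (X := measSpace (n.+1.-tuple BR) R) v (PA n) hr).
- exact: p_gt0.
- by move=> j; have [IN PN] := NP j; exact: (PS_integrable (mu := leb) IN PN hr).
- move=> n v; apply: (ln_dens_log_ratio c0 c1 hKs hs sI).
  + by move=> z; exact: qI0.
  + move=> k x; apply: (nrm_gt0 c0 c1 hKs hs sI ms mK _ _ hr) => j.
    exact: (PS_dev c0 c1 hKs hs sI ms mK hK).
  + by move=> k x; exact: (num_pos c0 c1 hKs hs sI ms mK hK has mw PSw).
  + by move=> k x; exact: (den_pos c0 c1 hKs hs sI ms mK hK p0_bounds PSp).
  + exact: statp.
- exact: tP.
Qed.

End LocalEntropyRate.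

(** * Joint parameters and conclusion *)

Lemma PS_lsubmx (K : numFieldType) (X : coefSpace K) m1 m2 (r : K) (f : X -> 'rV[K]_m1 -> K) M : 0 <= r ->
  PS r f M -> PS r (fun t (h : 'rV[K]_(m1 + m2)) => f t (lsubmx h)) M.
Proof.
move=> r0 fM.
have P := PS_subst (g := fun i _ (h : 'rV[K]_(m1 + m2)) => h 0 (lshift m2 i))
  (fun i => PS_coord X (lshift m2 i) r0) fM.
by apply: PS_ext P => t h _; congr (f t _); apply/rowP => i; rewrite !mxE.
Qed.

Lemma PS_rsubmx (K : numFieldType) (X : coefSpace K) m1 m2 (r : K) (f : X -> 'rV[K]_m2 -> K) M : 0 <= r ->
  PS r f M -> PS r (fun t (h : 'rV[K]_(m1 + m2)) => f t (rsubmx h)) M.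
Proof.
move=> r0 fM.
have P := PS_subst (g := fun i _ (h : 'rV[K]_(m1 + m2)) => h 0 (rshift m1 i))
  (fun i => PS_coord X (rshift m1 i) r0) fM.
by apply: PS_ext P => t h _; congr (f t _); apply/rowP => i; rewrite !mxE.
Qed.

Lemma polydisc_lsubmx (K : numFieldType) m1 m2 (r : K) (h : 'rV[K]_(m1 + m2)) :
  polydisc r h -> polydisc r (lsubmx h).
Proof. by move=> hr i; rewrite mxE. Qed.

Lemma polydisc_rsubmx (K : numFieldType) m1 m2 (r : K) (h : 'rV[K]_(m1 + m2)) :
  polydisc r h -> polydisc r (rsubmx h).
Proof. by move=> hr i; rewrite mxE. Qed.

Lemma polydisc_shrink_center (R : realType) m (r : R) (x : 'rV[R]_m) : (forall i, `|x 0 i| < r) -> 0 < r ->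
  exists2 d, 0 < d & forall i, `|x 0 i| + d <= r.
Proof.
move=> xr r0; have d0 i : 0 < r - `|x 0 i| by rewrite subr_gt0.
have [d [dp _ dr]] := exists_radius r0 d0.
by exists d => // i; have := dr i; lra.
Qed.

Lemma polydisc_nbhs (R : realType) m (r : R) (x : 'rV[R]_m) :
  open [set y : 'rV[R]_m | forall i, `|(y - x) 0 i| < r].
Proof.
rewrite openE => y yr; apply/nbhs_ballP.
(* Without coordinates any ball will do; otherwise a coordinate of [y - x] shows that [r] is
   positive. *)
case: m x y yr => [|m] x y yr; first by exists 1 => //= z _ [].
have r0 : 0 < r by exact: le_lt_trans (normr_ge0 _) (yr ord0).
have [d d0 dr] := polydisc_shrink_center yr r0.
exists d => // z [_ zd] i; apply: lt_le_trans (dr i).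
have := zd 0 i; rewrite /ball /= => zi.
have -> : (z - x) 0 i = (y - x) 0 i + (z 0 i - y 0 i) by rewrite !mxE; ring.
by apply: le_lt_trans (ler_normD _ _) _; rewrite ltrD2l distrC.
Qed.

Lemma PS_family (R : realType) (X : coefSpace R) m l (F : 'I_l -> 'I_l -> 'rV[R]_m -> R) x :
  (forall i j, analytic_at (F i j) x) ->
  exists r B, [/\ 0 < r, 0 <= B & forall i j, PS (X := X) r (fun _ h => F i j (x + h)) (fun=> B)].
Proof.
move=> FA.
have /choice[f fP] : forall i, exists rB : R * R, [/\ 0 < rB.1, 0 <= rB.2 &
    forall j, PS (X := X) rB.1 (fun _ h => F i j (x + h)) (fun=> rB.2)].
  move=> i; have /choice[g gP] : forall j, exists rB : R * R, [/\ 0 < rB.1, 0 <= rB.2 &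
      PS (X := X) rB.1 (fun _ h => F i j (x + h)) (fun=> rB.2)].
    by move=> j; have [r [M rM]] := PS_of_analytic X (FA i j); exists (r, M).
  have g0 j : 0 < (g j).1 by have [] := gP j.
  have [r [r0 _ rg]] := exists_radius ltr01 g0.
  exists (r, \sum_j (g j).2); split => //=; first by apply: sumr_ge0 => j _; have [] := gP j.
  move=> j; have [_ _ h] := gP j; apply: PS_shrink (ltW r0) (rg j) _; apply: PS_le h => _.
  by rewrite (bigD1 j)//= lerDl sumr_ge0// => k _; have [] := gP k.
have f0 j : 0 < (f j).1 by have [] := fP j.
have [r [r0 _ rf]] := exists_radius ltr01 f0.
exists r, (\sum_j (f j).2); split => //=; first by apply: sumr_ge0 => j _; have [] := fP j.
move=> i j; have [_ _ h] := fP i; apply: PS_shrink (ltW r0) (rf i) _; apply: PS_le (h j) => _.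
by rewrite (bigD1 i)//= lerDl sumr_ge0// => k _; have [] := fP k.
Qed.

Theorem theorem1p3 (R : realType) (l m1 m2 : nat)
    (Om1 : set 'rV[R]_m1) (Om2 : set 'rV[R]_m2)
    (Pi : 'rV[R]_m1 -> 'M[R]_l) (pi : 'rV[R]_m1 -> 'rV[R]_l)
    (q : 'rV[R]_m2 -> R -> 'I_l -> R)
    (* complex analytic extension of q in its first argument *)
    (qC : 'rV[R[i]]_m2 -> R -> 'I_l -> R[i])
    (eps0 : 'rV[R]_m1) (theta0 : 'rV[R]_m2)
    (hOm1 : bounded_domain Om1) (hOm2 : bounded_domain Om2)
    (hPi : forall eps, Om1 eps -> stochastic (Pi eps))
    (hPi_an : forall i j, analytic_on Om1 (fun eps => Pi eps i j))
    (hpi : forall eps, Om1 eps -> stationary_vector (Pi eps) (pi eps))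
    (hq : forall theta y, Om2 theta ->
        probability_density (fun z => q theta z y))
    (hq_an : forall y z, analytic_on Om2 (fun theta => q theta z y))
    (heps0 : Om1 eps0) (htheta0 : Om2 theta0)
    (ha : forall i j, 0 < Pi eps0 i j)
    (hb : forall y z, 0 < q theta0 z y)
    (hc : exists2 r2 : R, 0 < r2 &
        [/\ forall y z, analytic_extension Om2 (Cball theta0 r2)
              (fun theta => q theta z y) (fun theta => qC theta z y),
            forall y, {within [set: R] `*` Cball theta0 r2,
              continuous (fun zt : R * 'rV[R[i]]_m2 => qC zt.2 zt.1 y)} &
            [/\ (@lebesgue_measure R).-integrable setT
                  (fun z => sup_envelope qC theta0 r2 z),
                (@lebesgue_measure R).-integrable setT
                  (fun z => sup_envelope qC theta0 r2 z *
                            lne (inf_envelope qC theta0 r2 z))%E &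
                (@lebesgue_measure R).-integrable setT
                  (fun z => sup_envelope qC theta0 r2 z *
                            lne (sup_envelope qC theta0 r2 z))%E]])
    (I : 'I_l)
    (hd1 : exists2 r2 : R, 0 < r2 &
        forall j, equicontinuous [set: R]
          (fun z (theta : subspace (Cball theta0 r2)) =>
             qC theta z j / qC theta z I))
    (hd2 : exists2 r2 : R, 0 < r2 &
        exists L : 'rV[R[i]]_m2 -> R -> R[i],
          (forall z, analytic_extension Om2 (Cball theta0 r2)
             (fun theta => ln (q theta z I)) (fun theta => L theta z)) /\
          (forall j, (\int[@lebesgue_measure R]_z
             ereal_sup [set (Normc.normc (qC theta z j * L theta z))%:E |
                          theta in Cball theta0 r2] < +oo)%E))
    (htail : exists2 r2 : R, 0 < r2 &
        forall e : R, 0 < e ->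
          exists2 Sigma : set R, compact Sigma &
            forall z j theta, ~ Sigma z -> j != I -> Cball theta0 r2 theta ->
              Normc.normc (qC theta z j / qC theta z I) <= e) :
  exists U : set 'rV[R]_(m1 + m2),
    [/\ open U, U (row_mx eps0 theta0),
        forall x, U x -> Om1 (lsubmx x) /\ Om2 (rsubmx x),
        forall x, U x -> entropy_rate_defined
          (pi (lsubmx x)) (Pi (lsubmx x)) (q (rsubmx x)) &
        analytic_on U (fun x => fine (entropy_rate
          (pi (lsubmx x)) (Pi (lsubmx x)) (q (rsubmx x))))].
Proof.
have [oOm1 _ _] := hOm1; have [oOm2 _ _] := hOm2.
have hq' theta y : Om2 theta -> probability_density (fun z => q theta z y) by exact: hq.
have [r2 r20 [qCan qcont [Isup _ _]]] := hc.
have [rL rL0 [L [Lan LI]]] := hd2.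
have hb' y z : 0 < q theta0 z y by [].
have [c c0 cP] : exists2 c, 0 < c & forall i j, c <= Pi eps0 i j.
  have /choice[f fP] : forall i, exists s, 0 < s /\ forall j, s <= Pi eps0 i j.
    by move=> i; have [s [s0 _ sP]] := exists_radius ltr01 (ha i); exists s.
  have [s [s0 _ sf]] := exists_radius ltr01 (fun i => (fP i).1).
  by exists s => // i j; exact: le_trans (sf i) ((fP i).2 j).
have [C C1 ratioC] := ratio_bounded oOm2 htheta0 hb' r20 qCan qcont htail.
pose S := trivSpace (@sum_complete_real R).
have [rP [B [rP0 B0 PP]]] := PS_family S (fun i j => hPi_an i j eps0 heps0).
have [s1 s10 Om1P] := open_polydisc oOm1 heps0.
have [s2 s20 Om2P] := open_polydisc oOm2 htheta0.
have [s3 s30 qIpos] := density_gt0 oOm2 hq' htheta0 hb' r20 qCan hd1.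
pose r0 := Num.min (Num.min rP s1) (Num.min s2 s3).
have r00 : 0 < r0 by rewrite !lt_min rP0 s10 s20 s30.
have [r0P r01 r02 r03] : [/\ r0 <= rP, r0 <= s1, r0 <= s2 & r0 <= s3].
  by rewrite /r0 !ge_min !lexx ?orbT.
(* Both parameters are read off one joint increment [h], with the base point moved to 0. *)
pose P h := Pi (eps0 + lsubmx (h : 'rV[R]_(m1 + m2))).
pose p h := pi (eps0 + lsubmx (h : 'rV[R]_(m1 + m2))).
pose Q h := q (theta0 + rsubmx (h : 'rV[R]_(m1 + m2))).
have P0 : P 0 = Pi eps0 by rewrite /P linear0 addr0.
have Q0 : Q 0 = q theta0 by rewrite /Q linear0 addr0.
have inOm1 (h : 'rV[R]_(m1 + m2)) : polydisc r0 h -> Om1 (eps0 + lsubmx h).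
  by move=> hr; apply: Om1P r01 _; exact: polydisc_lsubmx.
have inOm2 (h : 'rV[R]_(m1 + m2)) : polydisc r0 h -> Om2 (theta0 + rsubmx h).
  by move=> hr; apply: Om2P r02 _; exact: polydisc_rsubmx.
have := @local_entropy_rate R l (m1 + m2) I P p Q c C B r0 c0.
rewrite P0 Q0 => /(_ cP C1 (fun z j => hb j z) ratioC r00 B0).
move=> /(_ (fun h hr => hPi _ (inOm1 h hr)) (fun h hr => hpi _ (inOm1 h hr)) (fun h j hr => hq _ j (inOm2 h hr))).
case.
- by move=> h z hr; apply: qIpos r03 _; exact: polydisc_rsubmx.
- by move=> i j; apply: (PS_lsubmx m2 (f := fun _ h => Pi (eps0 + h) i j) (ltW r00)); exact: PS_shrink (ltW r00) r0P (PP i j).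
- move=> j e e0; have [s s0 Ps] := PS_ratio oOm2 hq' htheta0 hb' r20 qCan hd1 j e0.
  by exists s => //; exact: (PS_rsubmx m1 (ltW s0) Ps).
- move=> j; have [s [M [s0 mM M0 IM Ps]]] := PS_density oOm2 hq' htheta0 r20 qCan Isup j.
  by exists s, M; split => //; exact: (PS_rsubmx m1 (ltW s0) Ps).
- move=> j; have [s [M [s0 mM M0 IM Ps]]] := PS_density_log oOm2 hq' htheta0 r20 qCan rL0 Lan LI j.
  by exists s, M; split => //; exact: (PS_rsubmx m1 (ltW s0) Ps).
move=> r [F [A [/andP[rp rr0] PF FP]]].
pose x0 := row_mx eps0 theta0.
have x0l x : lsubmx x = eps0 + lsubmx (x - x0) by rewrite linearB /= row_mxKl addrC subrK.
have x0r x : rsubmx x = theta0 + rsubmx (x - x0) by rewrite linearB /= row_mxKr addrC subrK.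
exists [set x | forall i, `|(x - x0) 0 i| < r].
have inr x : (forall i, `|(x - x0) 0 i| < r) -> polydisc r (x - x0) by move=> h i; exact: ltW.
have in0 (h : 'rV[R]_(m1 + m2)) : polydisc r h -> polydisc r0 h by move=> hr i; exact: le_trans (hr i) rr0.
split.
- exact: polydisc_nbhs.
- by move=> i; rewrite subrr mxE normr0.
- move=> x /inr /in0 xr; rewrite x0l x0r; split; [exact: inOm1|exact: inOm2].
- by move=> x /inr xr; rewrite x0l x0r; exact: (FP _ xr).1.
move=> x xr.
have [d d0 dr] := polydisc_shrink_center xr rp.
(* The one series at the base point is recentred at [x], with a radius [d] that stays inside its
   polydisc. *)
apply: (PS_analytic_at (t := tt : S) d0 (PS_recenter (ltW d0) dr PF)) => h hd.
have xh : polydisc r (x - x0 + h).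
  by move=> i; rewrite mxE; apply: le_trans (ler_normD _ _) _; apply: le_trans (dr i); rewrite lerD2l.
rewrite x0l x0r addrAC -[fine _]/(fine (entropy_rate (p _) (P _) (Q _))).
by rewrite (FP _ xh).2.
Qed.
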